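(* Let $d\ge 2$ be an integer and consider the family of polynomial maps $f_a:\mathbb{R}\to\mathbb{R}$, $$f_a(x)=-x+\sum_{j=2}^d a_j x^j,\qquad a=(a_2,a_3,\ldots,a_d)\in\mathbb{R}^{d-1}.$$ The only involution in this family (i.e. the only $f_a$ with $f_a\circ f_a=\mathrm{Id}$) is the trivial one $f_{\mathbf{0}}(x)=-x$, corresponding to $a=\mathbf{0}$, and the cyclicity of the family is at most $\left[(d^2-1)/2\right]$, where $[\,\cdot\,]$ denotes the integer part. Furthermore: (a) For $d$ even, the cyclicity of the family is at least $d-2$. Moreover: (i) for $d=2,4$ the cyclicity of the family is $d-2$; (ii) for $d=6,8,10$ the cyclicity of $f_a$ is at most $d-2$ for any $a\neq\mathbf{0}$; (iii) for $d=6,8,10$ the cyclicity of $f_{\mathbf{0}}$ is at most $5,9,13$, respectively. (b) For $d$ odd, the cyclicity of the family is at least $d-3$. Moreover: (i) for $d=3$ the cyclicity of the family is $d-2=1$; (ii) for $d=5,7,9$ the cyclicity of $f_a$ is at most $d-2$ for any $a\neq\mathbf{0}$, and there is some $a$ such that the cyclicity of $f_a$ is $d-2$; (iii) for $d=5,7,9$ the cyclicity of $f_{\mathbf{0}}$ is at most $4,7,10$, respectively; (iv) for $d=4m+3$, $m\ge 0$ an integer, there are some values of $a$ such that the origin is a weak fixed point of order $d-2$ for the corresponding $f_a$.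
   Context: A $2$-periodic orbit of a map $f:\mathbb{R}\to\mathbb{R}$ is a set $\{x,y\}$ with $f(x)=y$, $f(y)=x$ and $x\neq y$. For $x\in\mathbb{R}^m$ and $\rho>0$, $D_\rho(x)=\{y\in\mathbb{R}^m: \|y-x\|<\rho\}$. Cyclicity (short for $2$-cyclicity at the origin): let $f_a(x)=-x+\sum_{i\ge2}c_i(a)x^i$ be a family of analytic maps with $a$ in an open set $\mathcal{V}\subseteq\mathbb{R}^n$. The origin of a map $f_{a^*}$, $a^*\in\mathcal{V}$, has cyclicity $N\in\mathbb{N}\cup\{0\}$ if: (i) there exist $\varepsilon_0>0$ and $\delta_0>0$ such that the maximum number of isolated $2$-periodic orbits within $D_{\delta_0}(0)\subset\mathbb{R}$, over the maps $f_a$ with $a\in D_{\varepsilon_0}(a^* )\subset\mathcal{V}$, is $N$; and (ii) for any $\varepsilon>0$ and any $\delta>0$ there exists $a\in D_\varepsilon(a^* )\subset\mathcal{V}$ such that $f_a$ has $N$ different isolated $2$-periodic orbits within $D_\delta(0)$. The cyclicity of the family is the maximum cyclicity achieved by a map in the family. In the claim, ''the cyclicity of $f_{a^*}$'' is the cyclicity of the origin of $f_{a^*}$ within the family $\{f_a\}_{a\in\mathbb{R}^{d-1}}$ (so $\mathcal{V}=\mathbb{R}^{d-1}$). Weak fixed points: write $f_a(f_a(x))=x+\sum_{j\ge3}W_j(a)x^j$. The stability constants are $V_3(a)=W_3(a)$ and, for $k>3$, $V_k(a)=W_k(a)$ whenever $W_j(a)=0$ for all $j=3,\ldots,k-1$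 (the first non-zero one, if $f_a$ is not an involution, always has odd index). If $V_3(a)=V_5(a)=\cdots=V_{2k-1}(a)=0$ and $V_{2k+1}(a)\neq0$, the origin is called a weak fixed point of order $k-1$ of $f_a$; equivalently $f_a(f_a(x))=x+W_{2k+1}(a)x^{2k+1}+O(x^{2k+2})$ with $W_{2k+1}(a)\ne0$. *)

(* Defs.v *)
From mathcomp Require Export all_boot all_order all_algebra.
From mathcomp Require Export all_classical all_reals all_analysis.
Export Order.TTheory GRing.Theory Num.Theory.
Export numFieldNormedType.Exports.

Set Implicit Arguments.
Unset Strict Implicit.
Unset Printing Implicit Defensive.

Local Open Scope classical_set_scope.
Local Open Scope card_scope.
Local Open Scope ring_scope.

(* Euclidean disc: the library norm on ['rV[R]_m] is the sup norm. *)
Definition disc (R : realType) (m : nat) (rho : R) (x : 'rV[R]_m) :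
    set 'rV[R]_m :=
  [set y | Num.sqrt (\sum_(i < m) (y 0 i - x 0 i) ^+ 2) < rho].

Definition periodic2_orbits (R : realType) (f : R -> R) : set (set R) :=
  [set O | exists x y, [/\ f x = y, f y = x, x <> y & O = [set x; y]]].

Definition isolated_periodic2_orbits (R : realType) (f : R -> R) :
    set (set R) :=
  [set O | periodic2_orbits f O /\
     exists U : set R, [/\ open U, O `<=` U &
       forall O', periodic2_orbits f O' -> O' `<=` U -> O' = O]].

Definition isolated_periodic2_orbits_in (R : realType) (f : R -> R)
    (delta : R) : set (set R) :=
  [set O | isolated_periodic2_orbits f O /\ O `<=` ball (0 : R) delta].

(* The second clause says "at least N": for large [delta] a map realizing N
   orbits near the origin may have further ones away from it; for small
   [eps] and [delta] the first clause forces exactly N. *)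
Definition origin_cyclicity (R : realType) (n : nat) (V : set 'rV[R]_n)
    (f : 'rV[R]_n -> R -> R) (a : 'rV[R]_n) (N : nat) : Prop :=
  (exists eps0 delta0 : R, [/\ 0 < eps0, 0 < delta0, disc eps0 a `<=` V,
     (forall b, disc eps0 a b ->
        isolated_periodic2_orbits_in (f b) delta0 #<= `I_N) &
     (exists2 b, disc eps0 a b &
        isolated_periodic2_orbits_in (f b) delta0 #= `I_N)]) /\
  (forall eps delta : R, 0 < eps -> 0 < delta -> disc eps a `<=` V ->
     exists2 b, disc eps a b &
       `I_N #<= isolated_periodic2_orbits_in (f b) delta).

(* There is at most one N with [origin_cyclicity V f a N], but possibly none;
   an upper bound includes the existence of the cyclicity. *)
Definition origin_cyclicity_le (R : realType) (n : nat) (V : set 'rV[R]_n)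
    (f : 'rV[R]_n -> R -> R) (a : 'rV[R]_n) (N : nat) : Prop :=
  exists2 k, origin_cyclicity V f a k & (k <= N)%N.

Definition family_cyclicity (R : realType) (n : nat) (V : set 'rV[R]_n)
    (f : 'rV[R]_n -> R -> R) (N : nat) : Prop :=
  (forall a, V a -> origin_cyclicity_le V f a N) /\
  (exists2 a, V a & origin_cyclicity V f a N).

Definition family_cyclicity_le (R : realType) (n : nat) (V : set 'rV[R]_n)
    (f : 'rV[R]_n -> R -> R) (N : nat) : Prop :=
  exists2 k, family_cyclicity V f k & (k <= N)%N.

Definition family_cyclicity_ge (R : realType) (n : nat) (V : set 'rV[R]_n)
    (f : 'rV[R]_n -> R -> R) (N : nat) : Prop :=
  exists2 k, family_cyclicity V f k & (N <= k)%N.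

(* The coordinate [a 0 i], i = 0, ..., d - 2, is the coefficient of X^(i+2). *)
Definition family_poly (R : realType) (d : nat) (a : 'rV[R]_d.-1) : {poly R} :=
  - 'X + \sum_(i < d.-1) a 0 i *: 'X^(i.+2).

Definition family_map (R : realType) (d : nat) (a : 'rV[R]_d.-1) (x : R) : R :=
  (family_poly a).[x].

(* [stability_constant p k v]: the constant V_k is defined, i.e. W_j = 0 for
   3 <= j < k with W_j the coefficients of p o p, and V_k = W_k = v. *)
Definition stability_constant (R : realType) (p : {poly R}) (k : nat) (v : R) :
    Prop :=
  (forall j, (3 <= j < k)%N -> (p \Po p)`_j = 0) /\ (p \Po p)`_k = v.

(* V_3 = V_5 = ... = V_(2m+1) = 0 and V_(2m+3) <> 0. *)
Definition weak_fixed_point (R : realType) (p : {poly R}) (m : nat) : Prop :=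
  (forall i, (1 <= i <= m)%N -> stability_constant p i.*2.+1 0) /\
  (exists2 v, stability_constant p m.*2.+3 v & v <> 0).

(* Main.v *)
(* Let F_a = f_a o f_a - X, whose nonzero roots near the origin come in pairs, one pair for each 2-periodic orbit.

   Upper bounds: F_a has degree at most d^2 and a triple root at 0. For d <= 10 moreover the coefficients of F_a of degree less than 2d vanish simultaneously only at a = 0. By compactness, after the weighted rescaling a_j -> t^(j-1) a_j, all higher coefficients are then bounded by a multiple of the largest of these, and such a polynomial has at most 2d - 1 small roots, hence at most d - 2 small orbits, also near a = 0. To see that there is no nonzero common zero, write a_j = 2 y_j and eliminate the odd y_j; the remaining conditions G_n(y) = 0 have integer coefficients, and modulo 11 their Groebner basis contains a power of each variable up to terms of the same weight. So every monomial in y of a given large weight is 11 times an integral combination of monomials of that weight, and since det(1 - 11 C) = 1 mod 11 they all vanish, over any field of characteristic 0.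

   Lower bounds at a = 0: with e = X^2 (X^2 - r^2) ... (X^2 - (m r)^2) and f = -X + t e - c t^2 X^3, one has F = t^2 (2 c X^3 - (e^2)'/2) + O(t^3), which changes sign 2m times.

   Lower bounds for d = 3, 5, 7, 9: perturb successively the coefficients of F of degree 2d-1, 2d-3, ..., 3, each time giving the lowest nonzero coefficient the opposite sign, so that a new sign change appears. The coefficients of degree at most d are moved by the odd a_j. Those of degree d+2, ..., 2d-3 must be annihilated first: the one of degree d+2 by the last even a_j, in which it is affine for d = 7, 9, the next ones by following explicit curves on which polynomials with integer coefficients change sign.

   For d = 4m+3 the weak fixed point of order d-2 is that of -X + X^k - (k/2) X^(2k-1) with k = 2m+2. *)
From Stdlib Require Import ZArith.
Require Import Defs.
From mathcomp Require Import ssrZ zify ring lra.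
From mathcomp Require Import polyrcf.

Set Implicit Arguments.
Unset Strict Implicit.
Unset Printing Implicit Defensive.

Local Open Scope classical_set_scope.
Local Open Scope card_scope.
Local Open Scope ring_scope.

(** * Symbolic polynomials *)

(** Reduction modulo 11 keeps all coefficients small enough for the eliminations to be run by
    [vm_compute], and nothing has to be proved about the Groebner algorithm: only that each
    polynomial it outputs lies in the ideal. The obstacle is the return to characteristic 0, where
    11 is invertible; congruences are therefore relative to the subring generated by the unknowns,
    and a formal variable records weights so that each congruence can be cut down to finitely many
    monomials. At the trivial involution every coefficient of F vanishes, so no leading coefficient
    controls the nearby maps; the uniform tail estimate replaces it and gives d - 2 there too, which
    is below the values 5, 9, 13 and 4, 7, 10 of the statement. The points carrying the lower bounds
    for d = 5, 7, 9 are never computed: signs are certified on whole boxes, and zeros are obtained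
    from continuity and monotonicity alone. *)

(* Polynomials with integer coefficients, as sorted lists of exponents and coefficients. Coefficients are reduced modulo N; N = 0 gives exact arithmetic, since Z.modulo c 0 = c. *)
Definition mono := seq nat.
Definition sym := seq (mono * Z).

Fixpoint mono_mul (m n : mono) : mono :=
  match m, n with
  | [::], _ => n
  | _, [::] => m
  | a :: m', b :: n' => (a + b)%N :: mono_mul m' n'
  end.

Fixpoint mono_cmp (m n : mono) : comparison :=
  match m, n with
  | [::], [::] => Eq
  | [::], _ => Lt
  | _, [::] => Gt
  | a :: m', b :: n' =>
      match Nat.compare a b with Eq => mono_cmp m' n' | c => c end
  end.

Fixpoint sym_insert (N : Z) (m : mono) (c : Z) (f : sym) : sym :=
  match f with
  | [::] => if Z.eqb c 0 then [::] else [:: (m, c)]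
  | (m', c') :: f' =>
      match mono_cmp m m' with
      | Eq => let s := Z.modulo (Z.add c c') N in
              if Z.eqb s 0 then f' else (m', s) :: f'
      | Lt => if Z.eqb c 0 then f else (m, c) :: f
      | Gt => (m', c') :: sym_insert N m c f'
      end
  end.

Definition sym_axpy (N c : Z) (m : mono) (g f : sym) : sym :=
  foldr (fun t acc => sym_insert N (mono_mul m t.1) (Z.modulo (Z.mul c t.2) N) acc)
    f g.

Definition sym_muladd (N : Z) (f g h : sym) : sym :=
  foldr (fun t acc => sym_axpy N t.2 t.1 g acc) h f.

Section Eval.
Variables (A : comNzRingType) (r : nat) (Y : nat -> A) (N : Z).

Definition zeta (z : Z) : A := (int_of_Z z)%:~R.

Lemma zetaD x y : zeta (Z.add x y) = zeta x + zeta y.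
Proof. by rewrite /zeta -[Z.add x y]/(x + y) rmorphD intrD. Qed.
Lemma zetaM x y : zeta (Z.mul x y) = zeta x * zeta y.
Proof. by rewrite /zeta -[Z.mul x y]/(x * y) rmorphM intrM. Qed.
Lemma zeta0 : zeta 0 = 0. Proof. by []. Qed.
Lemma zeta1 : zeta 1 = 1. Proof. by []. Qed.

Definition mono_val (m : mono) : A := \prod_(i < r) Y i ^+ nth 0%N m i.

Definition sym_val (f : sym) : A := \sum_(t <- f) zeta t.2 * mono_val t.1.

Lemma nth_mono_mul m n i : nth 0%N (mono_mul m n) i = (nth 0 m i + nth 0 n i)%N.
Proof.
elim: m n i => [|a m IH] [|b n] [|i] //=; rewrite ?nth_nil ?addn0 //.
Qed.

Lemma mono_valM m n : mono_val (mono_mul m n) = mono_val m * mono_val n.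
Proof.
by rewrite /mono_val -big_split /=; apply: eq_bigr => i _; rewrite nth_mono_mul exprD.
Qed.

Lemma mono_val_nil : mono_val [::] = 1.
Proof. by rewrite /mono_val big1 // => i _; rewrite nth_nil expr0. Qed.

Lemma mono_cmp_eq m n : mono_cmp m n = Eq -> m = n.
Proof.
elim: m n => [|a m IH] [|b n] //=.
case E : (Nat.compare a b) => // /IH ->; by rewrite (PeanoNat.Nat.compare_eq _ _ E).
Qed.

Lemma sym_val_nil : sym_val [::] = 0.
Proof. exact: big_nil. Qed.

Lemma sym_val_cons m c f : sym_val ((m, c) :: f) = zeta c * mono_val m + sym_val f.
Proof. exact: big_cons. Qed.

Lemma sym_val_cat f g : sym_val (f ++ g) = sym_val f + sym_val g.
Proof. exact: big_cat. Qed.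

Lemma sym_val_scale c m g :
  sym_val [seq (mono_mul m t.1, Z.mul c t.2) | t <- g] =
    zeta c * mono_val m * sym_val g.
Proof.
rewrite /sym_val big_map big_distrr; apply: eq_bigr => t _ /=.
rewrite zetaM mono_valM; ring.
Qed.

Lemma sym_val_mul f g : exists h, sym_val f * sym_val g = sym_val h.
Proof.
elim: f => [|[m c] f [h Eh]]; first by exists [::]; rewrite sym_val_nil mul0r.
exists ([seq (mono_mul m t.1, Z.mul c t.2) | t <- g] ++ h).
by rewrite sym_val_cat sym_val_scale -Eh sym_val_cons mulrDl.
Qed.

(* Congruence modulo N times the subring generated by the Y i. *)
Definition cong (x y : A) := exists g, x = y + zeta N * sym_val g.

Lemma cong_refl x : cong x x.
Proof. by exists [::]; rewrite sym_val_nil mulr0 addr0. Qed.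

Lemma cong_trans x y z : cong x y -> cong y z -> cong x z.
Proof.
move=> [g ->] [h ->]; exists (h ++ g); rewrite sym_val_cat; ring.
Qed.

Lemma congZ c m x y : cong x y ->
  cong (zeta c * mono_val m * x) (zeta c * mono_val m * y).
Proof.
move=> [g ->]; exists [seq (mono_mul m t.1, Z.mul c t.2) | t <- g].
rewrite sym_val_scale; ring.
Qed.

Lemma congN x y : cong x y -> cong (- x) (- y).
Proof.
move=> /(congZ (Z.opp 1) [::]).
have -> : zeta (Z.opp 1) = - 1 by [].
by rewrite mono_val_nil mulr1 !mulN1r.
Qed.

Lemma congD x y z t : cong x y -> cong z t -> cong (x + z) (y + t).
Proof.
move=> [g ->] [h ->]; exists (g ++ h); rewrite sym_val_cat; ring.
Qed.

Lemma cong_sym x y : cong x y -> cong y x.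
Proof.
move=> /congN /(congD (cong_refl (x + y))).
by rewrite addrAC subrr add0r addrK.
Qed.

Lemma congMr x y f : cong x y -> cong (x * sym_val f) (y * sym_val f).
Proof.
move=> [g ->]; have [h Eh] := sym_val_mul g f.
by exists h; rewrite mulrDl -mulrA Eh.
Qed.

(** Congruence is taken modulo N times a subring and not modulo an ideal of [A]: where N is
    invertible in [A], an ideal would say nothing. Hence a congruence can only be multiplied by
    symbolic values, and both right-hand sides must have that form. *)
Lemma congM x y f g : cong x (sym_val f) -> cong y (sym_val g) ->
  cong (x * y) (sym_val f * sym_val g).
Proof.
move=> xf yg; have [h ->] := yg.
have [k Ek] := sym_val_mul h g.
apply: (@cong_trans _ (x * sym_val g)); last exact: congMr.
have [k1 ->] := xf; have [h1 E1] := sym_val_mul f h.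
have [h2 E2] := sym_val_mul k1 h.
exists (h1 ++ [seq (mono_mul [::] t.1, Z.mul N t.2) | t <- h2]).
rewrite sym_val_cat sym_val_scale mono_val_nil -E1 -E2; ring.
Qed.

Lemma cong_sum (I : Type) (s : seq I) (P : pred I) (F G : I -> A) :
  (forall i, P i -> cong (F i) (G i)) ->
  cong (\sum_(i <- s | P i) F i) (\sum_(i <- s | P i) G i).
Proof.
move=> FG; elim/big_rec2: _ => [|i x y /FG Fi xy]; first exact: cong_refl.
exact: congD.
Qed.

Lemma cong_mod c : cong (zeta c) (zeta (Z.modulo c N)).
Proof.
exists [:: ([::], Z.div c N)]; rewrite sym_val_cons sym_val_nil mono_val_nil.
rewrite mulr1 addr0 -zetaM -zetaD; congr zeta.
have := Z.div_mod c N; case: (Z.eqb_spec N 0) => [->|ne0]; last lia.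
by move=> _; case: c => [|c|c].
Qed.

Lemma cong_modM c m : cong (zeta (Z.modulo c N) * mono_val m) (zeta c * mono_val m).
Proof.
apply: cong_sym; have := congMr [:: (m, Zpos xH)] (cong_mod c).
by rewrite sym_val_cons sym_val_nil zeta1 mul1r addr0.
Qed.

Lemma sym_insertP m c f :
  cong (sym_val (sym_insert N m c f)) (zeta c * mono_val m + sym_val f).
Proof.
elim: f => [|[m' c'] f IH] /=.
  case: Z.eqb_spec => [->|_]; first by rewrite zeta0 mul0r add0r; exact: cong_refl.
  by rewrite sym_val_cons; exact: cong_refl.
case E: mono_cmp.
- rewrite (mono_cmp_eq E) sym_val_cons addrA -mulrDl -zetaD.
  suff H : cong (zeta (Z.modulo (Z.add c c') N) * mono_val m' + sym_val f)
     (zeta (Z.add c c') * mono_val m' + sym_val f).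
    case: Z.eqb_spec => [E0|_]; last by rewrite sym_val_cons.
    by move: H; rewrite E0 zeta0 mul0r add0r.
  apply: congD; last exact: cong_refl; exact: cong_modM.
- case: Z.eqb_spec => [->|_]; first by rewrite zeta0 mul0r add0r; exact: cong_refl.
  by rewrite !sym_val_cons; exact: cong_refl.
- by rewrite !sym_val_cons addrCA; apply: congD => //; exact: cong_refl.
Qed.

Lemma sym_axpyP c m g f :
  cong (sym_val (sym_axpy N c m g f)) (zeta c * mono_val m * sym_val g + sym_val f).
Proof.
elim: g => [|[m' c'] g IH] /=.
  by rewrite sym_val_nil mulr0 add0r; exact: cong_refl.
apply: cong_trans (sym_insertP _ _ _) _ => /=.
rewrite sym_val_cons mulrDr -addrA; apply: congD => //.
apply: cong_trans (cong_modM _ _) _; rewrite zetaM mono_valM.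
by rewrite mulrACA; exact: cong_refl.
Qed.

Lemma sym_muladdP f g h :
  cong (sym_val (sym_muladd N f g h)) (sym_val f * sym_val g + sym_val h).
Proof.
elim: f => [|[m c] f IH] /=.
  by rewrite sym_val_nil mul0r add0r; exact: cong_refl.
apply: cong_trans (sym_axpyP _ _ _ _) _.
by rewrite sym_val_cons mulrDl -addrA; apply: congD => //; exact: cong_refl.
Qed.

End Eval.

(** * The second iterate as a symbolic power series *)

Section HalfPow.
Variable A : comNzRingType.
Implicit Types b : {poly A}.

Definition refl_poly b : {poly A} := - 'X + b *+ 2.

(* For p = -X + 2b, half_pow b j is (p^j - (-X)^j) / 2 and quarter d b below is (p o p - X) / 4, obtained without division. *)
Fixpoint half_pow b j : {poly A} :=
  if j is i.+1 then refl_poly b * half_pow b i + (- 'X) ^+ i * b else 0.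

Lemma half_powE b j : refl_poly b ^+ j = (- 'X) ^+ j + half_pow b j *+ 2.
Proof.
elim: j => [|j IH] /=; first by rewrite !expr0 mul0rn addr0.
by rewrite exprS IH exprS /refl_poly; ring.
Qed.

Definition quarter d b : {poly A} :=
  \sum_(j < d.+1)
    ((b`_j)%:P * half_pow b j - (if odd j then (b`_j)%:P * 'X^j else 0)).

(** Since p o p = -p + 2 (b o p), the difference is twice (b o p) - b. In b_j (p^j - X^j) the even
    part of p^j - (-X)^j gives one more factor 2, and for odd j the sign leaves -2 b_j X^j, whence
    the correction term of [quarter]. *)
Lemma comp_refl_poly d b : (size b <= d.+1)%N ->
  refl_poly b \Po refl_poly b - 'X = quarter d b *+ 4.
Proof.
move=> sb; set p := refl_poly b.
have -> : p \Po p = - p + (b \Po p) *+ 2.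
  by rewrite {1}/p /refl_poly linearD linearN /= comp_polyX linearMn.
have sumE (F : nat -> {poly A}) : (forall j, (size b <= j)%N -> F j = 0) ->
    \sum_(j < size b) F j = \sum_(j < d.+1) F j.
  move=> F0; rewrite (big_ord_widen _ _ sb) [RHS](bigID (fun j : 'I__ => (j < size b)%N)) /=.
  by rewrite [X in _ = _ + X]big1 ?addr0 // => j; rewrite -leqNgt => /F0.
have -> : b \Po p = \sum_(j < d.+1) b`_j *: p ^+ j.
  rewrite comp_polyE (sumE (fun j => b`_j *: p ^+ j)) // => j sj.
  by rewrite nth_default ?scale0r.
have Eb : b = \sum_(j < d.+1) (b`_j)%:P * 'X^j.
  rewrite -{1}[b]coefK poly_def (sumE (fun j => b`_j *: 'X^j)).
    by apply: eq_bigr => j _; rewrite mul_polyC.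
  by move=> j sj; rewrite nth_default ?scale0r.
set S := \sum_(_ < _) _.
suff E : S - b = quarter d b *+ 2.
  transitivity ((S - b) *+ 2); last by rewrite E -mulrnA.
  by rewrite /p /refl_poly; ring.
rewrite {1}Eb /S -sumrN -big_split /= /quarter -sumrMnl.
apply: eq_bigr => j _; rewrite -mul_polyC half_powE exprNn.
by rewrite -signr_odd; case: (odd j) => /=; rewrite ?expr0 ?expr1; ring.
Qed.

End HalfPow.

Section Ser.
Variables (N : Z) (r K : nat).
Definition ser := seq sym.
Local Notation sc := (nth ([::] : sym)).

Definition ser_mul (s t : ser) : ser :=
  mkseq (fun n => foldr (fun k acc => sym_muladd N (sc s k) (sc t (n - k)%N) acc)
                    [::] (iota 0 n.+1)) K.

Definition ser_refl (al : ser) : ser :=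
  mkseq (fun n => if (n == 1)%N then [:: (nseq r 0%N, Z.modulo (Z.opp 1) N)]
                  else sym_axpy N 2 [::] (sc al n) [::]) K.

Definition ser_half_step (al p : ser) (j : nat) (h : ser) : ser :=
  let ph := ser_mul p h in
  mkseq (fun n => if (j <= n)%N
                  then sym_axpy N (if odd j then Z.opp 1 else 1) [::]
                         (sc al (n - j)%N) (sc ph n)
                  else sc ph n) K.

Definition ser_quarter_step (al h : ser) (j : nat) (acc : ser) : ser :=
  mkseq (fun n => let a := sym_muladd N (sc al j) (sc h n) (sc acc n) in
                  if odd j && (n == j) then sym_axpy N (Z.opp 1) [::] (sc al j) a
                  else a) K.

Fixpoint ser_quarter_loop (al p : ser) (fuel j : nat) (h acc : ser) : ser :=
  if fuel is f.+1 then
    ser_quarter_loop al p f j.+1 (ser_half_step al p j h)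
      (ser_quarter_step al h j acc)
  else acc.

Definition ser_quarter (d : nat) (al : ser) : ser :=
  ser_quarter_loop al (ser_refl al) d.+1 0 [::] [::].

Section Correct.
Variables (A : comNzRingType) (Y : nat -> A).
Local Notation ev := (sym_val r Y).
Local Notation cong := (cong r Y N).

Definition repr (s : ser) (P : {poly A}) :=
  forall n, (n < K)%N -> cong P`_n (ev (sc s n)).

Lemma repr_mul s t P Q : repr s P -> repr t Q -> repr (ser_mul s t) (P * Q).
Proof.
move=> sP tQ n ltnK; rewrite nth_mkseq // coefM.
rewrite -(big_mkord xpredT (fun k => P`_k * Q`_(n - k))) /index_iota subn0.
have : all (fun k => k <= n)%N (iota 0 n.+1).
  by apply/allP => k; rewrite mem_iota.
elim: (iota 0 n.+1) => [_|k ks IH /= /andP[lekn /IH {}IH]].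
  by rewrite big_nil /= sym_val_nil; exact: cong_refl.
rewrite big_cons; apply: cong_trans (cong_sym (sym_muladdP _ _ _ _ _ _)).
apply: congD => //; apply: congM; [apply: sP|apply: tQ].
  exact: leq_ltn_trans ltnK.
exact: leq_ltn_trans (leq_subr _ _) ltnK.
Qed.

Lemma ev_one c : ev [:: (nseq r 0%N, c)] = zeta A c.
Proof.
rewrite /sym_val big_seq1 /= /mono_val big1 ?mulr1 // => i _.
by rewrite nth_nseq ltn_ord expr0.
Qed.

Lemma cong_axpy0 c f g : cong (zeta A c * ev f + ev g) (ev (sym_axpy N c [::] f g)).
Proof.
apply: cong_sym; apply: cong_trans (sym_axpyP _ _ _ _ _ _ _) _.
by rewrite mono_val_nil mulr1; exact: cong_refl.
Qed.

Lemma congZ0 c x y : cong x y -> cong (zeta A c * x) (zeta A c * y).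
Proof. by move=> /(congZ c [::]); rewrite mono_val_nil mulr1. Qed.

Lemma repr_refl al b : repr al b -> b`_1 = 0 -> repr (ser_refl al) (refl_poly b).
Proof.
move=> alb b1 n ltnK; rewrite nth_mkseq // /refl_poly coefD coefN coefX coefMn.
case: eqP => [->|_] /=.
  rewrite b1 mul0rn addr0 ev_one -[- _]/(zeta A (Z.opp 1)); exact: cong_mod.
rewrite oppr0 add0r; apply: cong_trans (cong_axpy0 _ _ _).
rewrite sym_val_nil addr0 -mulr_natl -[2%:R]/(zeta A 2); apply: congZ0; exact: alb.
Qed.

Lemma repr_half_step al b p j h H : repr al b -> repr p (refl_poly b) ->
  repr h H ->
  repr (ser_half_step al p j h) (refl_poly b * H + (- 'X) ^+ j * b).
Proof.
move=> alb pb hH n ltnK; rewrite nth_mkseq // coefD.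
have phP := repr_mul pb hH ltnK.
have -> : (- 'X) ^+ j * b = (-1) ^+ odd j *: (b * 'X^j).
  by rewrite [(- 'X) ^+ j]exprNn -signr_odd; case: (odd j);
      rewrite ?expr1 ?expr0 ?scale1r ?scaleN1r ?mulN1r ?mul1r ?mulNr mulrC.
rewrite coefZ coefMXn; case: (leqP j n) => ljn; last by rewrite mulr0 addr0.
apply: cong_trans (cong_axpy0 _ _ _); rewrite addrC; apply: congD => //.
have -> : (-1) ^+ odd j = zeta A (if odd j then Z.opp 1 else 1).
  by case: (odd j).
by apply: congZ0; apply: alb; exact: leq_ltn_trans (leq_subr _ _) ltnK.
Qed.

Lemma repr_quarter_step al b h H j acc S : repr al b -> repr h H -> repr acc S ->
  (j < K)%N ->
  repr (ser_quarter_step al h j acc)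
    (S + ((b`_j)%:P * H - (if odd j then (b`_j)%:P * 'X^j else 0))).
Proof.
move=> alb hH aS ltjK n ltnK; rewrite nth_mkseq // !coefD coefN coefCM.
set a := sym_muladd _ _ _ _.
have aP : cong (S`_n + b`_j * H`_n) (ev a).
  apply: cong_trans (cong_sym (sym_muladdP _ _ _ _ _ _)); rewrite addrC.
  by apply: congD; [apply: congM; [exact: alb|exact: hH]|exact: aS].
case: (odd j) => /=; last by rewrite coef0 subr0.
rewrite coefCM coefXn; case: eqP => _ /=; last by rewrite mulr0 subr0.
apply: cong_trans (cong_axpy0 _ _ _); rewrite mulr1 addrA addrC.
rewrite -mulN1r -[-1]/(zeta A (Z.opp 1)); apply: congD => //.
by apply: congZ0; exact: alb.
Qed.

Lemma repr_nil : repr [::] 0.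
Proof. by move=> n _; rewrite coef0 nth_nil sym_val_nil; exact: cong_refl. Qed.

(** Used twice: modulo 11 for the obstructions to involutions, and with N = 0 for the exact
    coefficients behind the lower bounds. *)
Lemma repr_quarter d al b : repr al b -> b`_1 = 0 -> (d < K)%N ->
  repr (ser_quarter d al) (quarter d b).
Proof.
move=> alb b1 ltdK; rewrite /ser_quarter /quarter.
pose T j := (b`_j)%:P * half_pow b j - (if odd j then (b`_j)%:P * 'X^j else 0).
suff H f j h acc S : (j + f <= K)%N -> repr h (half_pow b j) -> repr acc S ->
    repr (ser_quarter_loop al (ser_refl al) f j h acc)
      (S + \sum_(i < f) T (j + i)%N).
  rewrite -[X in repr _ X]add0r; apply: H => //; exact: repr_nil.
elim: f j h acc S => [|f IH] j h acc S leK hj aS /=.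
  by rewrite big_ord0 addr0.
rewrite big_ord_recl addn0 addrA.
have -> : \sum_(i < f) T (j + lift ord0 i)%N = \sum_(i < f) T (j.+1 + i)%N.
  by apply: eq_bigr => i _; rewrite lift0 addnS addSn.
apply: IH; first by rewrite addSnnS.
  by apply: repr_half_step => //; exact: repr_refl.
apply: repr_quarter_step => //.
by apply: leq_trans leK; rewrite addnS ltnS leq_addr.
Qed.

End Correct.
End Ser.

(** * Obstructions to formal involutions modulo 11 *)

Fixpoint mono_dvd (l m : mono) : bool :=
  match l, m with
  | a :: l', b :: m' => (a <= b)%N && mono_dvd l' m'
  | _, _ => true
  end.

Fixpoint mono_zip (op : nat -> nat -> nat) (l m : mono) : mono :=
  match l, m with
  | a :: l', b :: m' => op a b :: mono_zip op l' m'
  | _, _ => [::]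
  end.

(** The head is the lexicographically smallest monomial. The polynomials to be reduced are weighted
    homogeneous with positive weights, so only finitely many monomials compete and this order is as
    good as the opposite one. *)
Definition sym_lead (f : sym) : mono := if f is (m, _) :: _ then m else [::].

Section Algo.
Variable N : Z.

(* The leading coefficient is inverted by the little Fermat theorem, N being prime. *)
Definition sym_monic (f : sym) : sym :=
  if f is (_, c) :: _ then
    sym_axpy N (Z.modulo (Z.pow c (Z.sub N 2)) N) [::] f [::]
  else [::].

Fixpoint sym_reduce (fuel : nat) (G : seq sym) (f : sym) : sym :=
  match fuel, f with
  | k.+1, (m, c) :: _ =>
      let i := find (fun g => mono_dvd (sym_lead g) m) G in
      if (i < size G)%N then
        let g := nth [::] G i in
        sym_reduce k G (sym_axpy N (Z.opp c) (mono_zip subn m (sym_lead g)) g f)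
      else f
  | _, _ => f
  end.

Definition sym_spoly (f g : sym) : sym :=
  let l := mono_zip maxn (sym_lead f) (sym_lead g) in
  sym_axpy N 1 (mono_zip subn l (sym_lead f)) f
    (sym_axpy N (Z.opp 1) (mono_zip subn l (sym_lead g)) g [::]).

(** The pairs are indices into the growing list, each new element being appended. They are a
    certificate: no completeness of the resulting list is claimed or needed. *)
Definition groebner_run (fuel : nat) (G : seq sym) (pairs : seq (nat * nat)) :=
  foldl (fun G ij => rcons G (sym_monic (sym_reduce fuel G
           (sym_spoly (nth [::] G ij.1) (nth [::] G ij.2)))))
    G pairs.

Definition even_vars (r d : nat) : ser :=
  mkseq (fun n => if (0 < n)%N && ~~ odd n
                  then [:: (mkseq (fun i => nat_of_bool (i == n./2.-1)) r, Zpos xH)]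
                  else [::]) d.+1.

(* The coefficient of odd index n of (p o p - X) / 4 is -b_n plus a polynomial in the lower coefficients, so it is solved for b_n = al_n, starting from al_n = 0. *)
Definition elim_odd (r K d : nat) (ns : seq nat) : ser :=
  foldl (fun al n => set_nth [::] al n (nth [::] (ser_quarter N r K d al) n))
    (even_vars r d) ns.

Definition odds (m n : nat) : seq nat := [seq i <- index_iota m n | odd i].

(** The odd degrees up to d are spent on eliminating the odd b_n, and even degrees bring no new
    condition by [coef_comp_even]. There remain d./2 conditions on the d./2 even unknowns. *)
Definition obstructions (d : nat) : seq sym :=
  let r := d./2 in let K := d.*2 in
  let v := ser_quarter N r K d (elim_odd r K d (odds 3 d.+1)) in
  [seq nth [::] v n | n <- odds d.+1 K].

End Algo.

Definition wsum (w : seq nat) (m : mono) : nat :=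
  foldr addn 0%N (mono_zip muln w m).

(* g is a pure power of the variable i, plus terms of the same weight w and of larger secondary weight u; the latter makes the rewriting by g terminate. *)
Definition pure_lead (r i : nat) (w u : seq nat) (g : sym) : bool :=
  if g is (m, c) :: tl then
    [&& m == mkseq (fun k => if k == i then nth 0%N m i else 0%N) r,
        (0 < nth 0%N m i)%N, Z.eqb c 1 &
        all (fun t => (wsum w t.1 == wsum w m) && (wsum u m < wsum u t.1)%N) tl]
  else false.

Definition cofinite_check (r : nat) (w u : seq nat) (pure : seq nat) (G : seq sym) :=
  all (fun i => pure_lead r i w u (nth [::] G (nth 0%N pure i))) (iota 0 r).

(** The weights 2i + 1 are those of the rescaling: variable i stands for the coefficient of degree
    2i + 2, divided by 2. *)
Definition obstruction_check (d : nat) (u pure : seq nat) (pairs : seq (nat * nat)) :=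
  let G := groebner_run 11 1000 [seq sym_monic 11 f | f <- obstructions 11 d] pairs in
  cofinite_check d./2 (mkseq (fun i => i.*2.+1) d./2) u pure G.

(** * Vanishing of monomials of large weight modulo N *)

Section Groebner.
Variables (A : comNzRingType) (r : nat) (Y : nat -> A) (N : Z).
Local Notation ev := (sym_val r Y).
Local Notation cong := (cong r Y N).
Definition vanishing f := cong (ev f) 0.

Lemma vanishing_axpy c m f g : vanishing f -> vanishing g ->
  vanishing (sym_axpy N c m f g).
Proof.
move=> f0 g0; apply: cong_trans (sym_axpyP _ _ _ _ _ _ _) _.
rewrite -[0]addr0; apply: congD => //.
by have := congZ c m f0; rewrite mulr0.
Qed.

Lemma vanishing_nil : vanishing [::].
Proof. by rewrite /vanishing sym_val_nil; exact: cong_refl. Qed.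

Lemma vanishing_nth G i : {in G, forall f, vanishing f} -> vanishing (nth [::] G i).
Proof.
move=> G0; case: (ltnP i (size G)) => [lt|ge]; first by apply: G0; exact: mem_nth.
by rewrite nth_default //; exact: vanishing_nil.
Qed.

Lemma vanishing_monic f : vanishing f -> vanishing (sym_monic N f).
Proof.
by case: f => // -[m c] f f0; apply: vanishing_axpy => //; exact: vanishing_nil.
Qed.

Lemma vanishing_reduce k G f : {in G, forall f, vanishing f} -> vanishing f ->
  vanishing (sym_reduce N k G f).
Proof.
move=> G0; elim: k f => [|k IH] [|[m c] f] //= f0; case: ifP => // _.
by apply: IH; apply: vanishing_axpy => //; exact: vanishing_nth.
Qed.

Lemma vanishing_groebner k G pairs : {in G, forall f, vanishing f} ->
  {in groebner_run N k G pairs, forall f, vanishing f}.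
Proof.
elim: pairs G => [|[i j] pairs IH] G G0 //=; apply: IH => f.
rewrite mem_rcons inE => /orP[/eqP-> | /G0 //].
apply/vanishing_monic/vanishing_reduce => //.
do !apply: vanishing_axpy; [exact: vanishing_nth..|exact: vanishing_nil].
Qed.

Lemma wsumE (w : seq nat) m :
  wsum w m = (\sum_(i < size w) nth 0 w i * nth 0 m i)%N.
Proof.
elim: w m => [|a w IH] [|b m] //=; rewrite ?big_ord0 ?big_ord_recl //=.
  by rewrite muln0 big1 // => i _; rewrite muln0.
by rewrite /wsum /= -/(wsum w m) IH.
Qed.

Lemma wsumD w m n : wsum w (mono_mul m n) = (wsum w m + wsum w n)%N.
Proof.
rewrite !wsumE -big_split /=; apply: eq_bigr => i _.
by rewrite nth_mono_mul mulnDr.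
Qed.

(** A monomial of large weight is divisible by one of the pure powers and can be rewritten by it.
    This preserves the weight w and raises the secondary weight u, which is at most U w; the
    induction is on the gap U w - u. *)
Lemma cofinite_vanishing (w u pure : seq nat) (G : seq sym) :
    size w = r -> size u = r -> all (leq 1) w ->
    cofinite_check r w u pure G -> {in G, forall f, vanishing f} ->
  exists D0, forall m, (D0 < wsum w m)%N -> cong (mono_val r Y m) 0.
Proof.
move=> sw su w1 /allP chk G0.
pose g i := nth [::] G (nth 0%N pure i).
pose e i := nth 0%N (sym_lead (g i)) i.
exists (\sum_(i < r) nth 0 w i * e i)%N => m0 ltD.
have {ltD} : (\sum_(i < r) nth 0 w i * e i < wsum w m0)%N by [].
set U := (\sum_(i < r) nth 0 u i)%N.
have uw m : (wsum u m <= U * wsum w m)%N.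
  rewrite !wsumE su sw big_distrr /=; apply: leq_sum => i _.
  rewrite mulnA leq_mul2r; apply/orP; right.
  have w1i : (1 <= nth 0 w i)%N by apply: (allP w1); rewrite mem_nth // sw.
  by rewrite -[leqLHS]muln1 leq_mul // /U (bigD1 i) //= leq_addr.
have [k] := ubnP (U * wsum w m0 - wsum u m0)%N.
elim: k m0 => // k IH m ltk ltD.
(* If every exponent were below that of the corresponding pure power, the weight could not exceed
   the chosen bound. *)
have [i ei] : exists i : 'I_r, (e i <= nth 0 m i)%N.
  apply/existsP; apply: contraLR ltD; rewrite negb_exists -leqNgt => /forallP H.
  rewrite wsumE sw; apply: leq_sum => i _; rewrite leq_mul2l.
  by apply/orP; right; have := H i; rewrite -ltnNge => /ltnW.
have := chk i; rewrite mem_iota /= ltn_ord -/(g i) => /(_ isT).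
have gi0 : vanishing (g i) by exact: vanishing_nth.
move: gi0 ei; rewrite /e; case: (g i) => // -[mi c] tl /= gi0 ei.
case/and4P => /eqP Emi mi0 /Z.eqb_eq Ec /allP tlP.
pose q := mkseq (fun k => nth 0 m k - nth 0 mi k)%N r.
have nq k' : (k' < r)%N -> (nth 0 q k' + nth 0 mi k')%N = nth 0%N m k'.
  move=> lt; rewrite nth_mkseq // subnK // Emi nth_mkseq //.
  by case: eqP => // ->.
have Em : mono_val r Y m = mono_val r Y q * mono_val r Y mi.
  by rewrite -mono_valM; apply: eq_bigr => j _; rewrite nth_mono_mul nq.
have wq v : size v = r -> wsum v m = (wsum v q + wsum v mi)%N.
  move=> sv; rewrite -wsumD !wsumE sv.
  by apply: eq_bigr => j _; rewrite nth_mono_mul nq.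
have tl0 : cong (mono_val r Y q * sym_val r Y tl) 0.
  rewrite /sym_val big_distrr /= big_seq_cond.
  have Z0 : \sum_(t <- tl | (t \in tl) && true) (0 : A) = 0 by rewrite big1.
  rewrite -[X in cong _ X]Z0.
  apply: cong_sum => t; rewrite andbT => /tlP /andP[/eqP wt ut].
  have wqt : wsum w (mono_mul q t.1) = wsum w m by rewrite wsumD wt wq.
  rewrite mulrCA -mono_valM.
  have /(congZ t.2 [::]) : cong (mono_val r Y (mono_mul q t.1)) 0.
    apply: IH; last by rewrite wqt.
    have := uw (mono_mul q t.1); rewrite wqt [wsum u (mono_mul _ _)]wsumD.
    move: ltk ut; rewrite (wq u) //; move: (U * _)%N (wsum u q) (wsum u mi) (wsum u t.1).
    by move=> *; lia.
  by rewrite mono_val_nil mulr1 mulr0.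
have : cong (mono_val r Y q * ev ((mi, c) :: tl)) 0.
  have /(congZ (Zpos xH) q) := gi0; rewrite -[zeta _ _]/(1 : A).
  by rewrite mul1r mulr0.
rewrite sym_val_cons Ec -[zeta _ _]/(1 : A) mul1r mulrDr -Em => H.
have := congD H (congN tl0); by rewrite oppr0 addr0 addrK.
Qed.

End Groebner.

(* v = p C v with C integral, and det (1 - p C) = 1 modulo p. *)
Lemma integral_divisible_eq0 (R : numFieldType) (T : finType) (v : T -> R) (p : nat) :
    prime p ->
    (forall x, exists c : {ffun T -> int}, v x = p%:R * \sum_y (c y)%:~R * v y) ->
  forall x, v x = 0.
Proof.
move=> pp /fin_all_exists[C CE].
pose M : 'M[int]_#|T| := 1%:M - p%:Z *: \matrix_(i, j) C (enum_val i) (enum_val j).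
pose V : 'cV[R]_#|T| := \col_i v (enum_val i).
have detM : \det M != 0.
  have Mp : map_mx (intr : int -> 'F_p) M = 1%:M.
    apply/matrixP => i j; rewrite !mxE rmorphB rmorphM /=.
    have -> : (p%:Z%:~R : 'F_p) = 0 by apply/eqP; rewrite -(dvdn_pcharf (pchar_Fp pp)).
    by rewrite mul0r subr0; case: (i == j).
  apply/negP => /eqP d0; have := det_map_mx (intr : int -> 'F_p) M.
  by rewrite Mp det1 d0 rmorph0 => /eqP; rewrite oner_eq0.
have MV : map_mx (intr : int -> R) M *m V = 0.
  apply/matrixP => i j; rewrite !mxE.
  under eq_bigr do rewrite !mxE rmorphB rmorphM /= mulrBl.
  rewrite sumrB; apply/eqP; rewrite subr_eq0; apply/eqP.
  rewrite (bigD1 i) //= big1 ?addr0; last first.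
    by move=> k ki; rewrite eq_sym (negbTE ki) mul0r.
  rewrite eqxx mul1r CE big_distrr /= (big_enum_val _) /=.
  by apply: eq_bigr => k _; rewrite mulrA.
have V0 : V = 0.
  have : \adj (map_mx intr M) *m (map_mx intr M *m V) = 0 by rewrite MV mulmx0.
  rewrite mulmxA mul_adj_mx det_map_mx mul_scalar_mx => /eqP.
  by rewrite scaler_eq0 intr_eq0 (negbTE detM) => /eqP.
move=> x; have := congr1 (fun V : 'cV_#|T| => V (enum_rank x) 0) V0.
by rewrite !mxE enum_rankK.
Qed.

(** * Homogeneous parts of congruences *)

Section Graded.
Variables (R : numFieldType) (r : nat) (y : nat -> R) (w : seq nat).
Hypothesis sw : size w = r.
Hypothesis w1 : all (leq 1) w.

(* The powers of X record the weight of a monomial. *)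
Definition graded_var i : {poly R} := y i *: 'X^(nth 0%N w i).

Lemma mono_val_graded m : mono_val r graded_var m = mono_val r y m *: 'X^(wsum w m).
Proof.
rewrite /mono_val wsumE sw.
rewrite -[RHS]mul_polyC rmorph_prod expr_sum -big_split /=; apply: eq_bigr => i _.
by rewrite /graded_var exprZn mul_polyC exprM.
Qed.

Lemma zeta_polyC z : zeta {poly R} z = (zeta R z)%:P.
Proof. by rewrite /zeta rmorph_int. Qed.

(** A congruence only says that a monomial is p times some integral polynomial in the unknowns. Its
    coefficient at X^D keeps the monomials of weight D, so the finitely many of these satisfy v = p
    C v, to which [integral_divisible_eq0] applies. *)
Lemma vanish_of_congruence (p D0 : nat) : prime p ->
    (forall m, (D0 < wsum w m)%N ->
       cong r graded_var (Z.of_nat p) (mono_val r graded_var m) 0) ->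
  forall i, (i < r)%N -> y i = 0.
Proof.
move=> pp H i ltir.
(* The weight of y_i^(D0+1): it exceeds D0, and this power is among the monomials shown to
   vanish. *)
pose D := (D0.+1 * nth 0 w i)%N.
have w1j j : (j < r)%N -> (1 <= nth 0 w j)%N.
  by move=> jr; apply: (allP w1); rewrite mem_nth // sw.
have ltD : (D0 < D)%N by rewrite /D leq_pmulr ?w1j.
(* Weights being at least 1, every monomial of weight D has exponents at most D, so a finite type
   indexes them. The other exponent vectors in it get the value 0 in [v]. *)
pose T := {ffun 'I_r -> 'I_D.+1}.
pose ofT (x : T) : mono := mkseq (fun k => if insub k is Some i then val (x i) else 0%N) r.
have ofTE (x : T) (k : 'I_r) : nth 0%N (ofT x) k = x k.
  by rewrite nth_mkseq // valK.
pose toT (m : mono) : T := [ffun k : 'I_r => inord (nth 0%N m k)].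
have toTK m : wsum w m = D -> mono_val r y (ofT (toT m)) = mono_val r y m.
  move=> wm; apply: eq_bigr => k _; rewrite ofTE ffunE inordK // ltnS -wm wsumE sw.
  rewrite (bigD1 k) //= (leq_trans _ (leq_addr _ _)) // leq_pmull //.
  exact: w1j.
have wtoT m : wsum w m = D -> wsum w (ofT (toT m)) = D.
  move=> wm; rewrite -[RHS]wm !wsumE sw; apply: eq_bigr => k _.
  rewrite ofTE ffunE inordK // ltnS -wm wsumE sw.
  rewrite (bigD1 k) //= (leq_trans _ (leq_addr _ _)) // leq_pmull //.
  exact: w1j.
pose v (x : T) := if wsum w (ofT x) == D then mono_val r y (ofT x) else 0.
have v0 : forall x, v x = 0.
  apply: (integral_divisible_eq0 pp) => x; rewrite /v; case: eqP => wx; last first.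
    by exists [ffun => 0]; rewrite big1 ?mulr0 // => z _; rewrite ffunE mul0r.
  have [|g] := H (ofT x); first by rewrite wx.
  move=> /(congr1 (fun P : {poly R} => P`_D)).
  rewrite add0r mono_val_graded zeta_polyC coefZ coefXn wx eqxx mulr1 coefCM.
  rewrite -[zeta R (Z.of_nat p)]/((int_of_Z (Z.of_nat p))%:~R).
  have -> : int_of_Z (Z.of_nat p) = p by rewrite -[Z.of_nat p]/(Z_of_int p) Z_of_intK.
  move=> ->.
  exists [ffun z => \sum_(t <- g | (wsum w t.1 == D) && (toT t.1 == z)) int_of_Z t.2].
  congr (_ * _); rewrite /sym_val coef_sum.
  under [RHS]eq_bigr => z _ do rewrite ffunE rmorph_sum /= big_distrl /= big_mkcond /=.
  rewrite exchange_big /=; apply: eq_bigr => t _.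
  rewrite mono_val_graded zeta_polyC coefCM coefZ coefXn eq_sym.
  case: eqP => [wt|_] /=; last by rewrite !mulr0 big1.
  rewrite -big_mkcond (big_pred1 (toT t.1)) => [|z]; last by rewrite eq_sym.
  by rewrite wtoT // eqxx toTK // mulr1.
pose m : mono := mkseq (fun k => if k == i then D0.+1 else 0%N) r.
have wm : wsum w m = D.
  rewrite wsumE sw (bigD1 (Ordinal ltir)) //= big1 => [|k ki].
    by rewrite nth_mkseq // eqxx addn0 mulnC.
  by move: ki; rewrite -val_eqE nth_mkseq //= => /negbTE->; rewrite muln0.
have := v0 (toT m); rewrite /v wtoT // eqxx toTK // /mono_val.
rewrite (bigD1 (Ordinal ltir)) //= big1 => [|k ki].
  rewrite nth_mkseq // eqxx mulr1 => /eqP; rewrite expf_eq0 /= => /eqP //.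
by move: ki; rewrite -val_eqE nth_mkseq //= => /negbTE->.
Qed.

End Graded.

(** * Coefficients of composed polynomials *)

Section CompCoef.
Variable A : comNzRingType.
Implicit Types p q u v s : {poly A}.

Lemma coef0_comp p u : u`_0 = 0 -> (p \Po u)`_0 = p`_0.
Proof. by move=> u0; rewrite -!horner_coef0 horner_comp [u.[0]]horner_coef0 u0. Qed.

(** The quotient k is the divided difference of p between u and v; both vanish at 0, so its constant
    term is the derivative p'(0). *)
Lemma comp_poly_diff p u v : u`_0 = 0 -> v`_0 = 0 ->
  exists2 k, (p \Po u) - (p \Po v) = (u - v) * k & k`_0 = p`_1.
Proof.
move=> u0 v0; elim/poly_ind: p => [|p c [k Ek k0]].
  by exists 0; rewrite ?mulr0 ?comp_poly0 ?subrr ?coef0.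
exists (k * u + (p \Po v)).
  rewrite !comp_poly_MXaddC; transitivity (((p \Po u) - (p \Po v)) * u + (p \Po v) * (u - v)).
    by ring.
  by rewrite Ek; ring.
by rewrite coefD coef0M u0 mulr0 add0r coef0_comp // coefD coefC coefMX addr0.
Qed.

Lemma coef0_eq_mulX u : u`_0 = 0 -> exists2 s, u = 'X * s & s`_0 = u`_1.
Proof.
move=> u0; exists (\poly_(i < (size u).-1) u`_i.+1).
  apply/polyP => -[|i]; rewrite mulrC coefMX //= coef_poly.
  by case: ltnP => // h; rewrite nth_default //; move: h; case: (size u).
rewrite coef_poly; case: ltnP => // h; rewrite nth_default //; move: h; by case: (size u) => [|[]].
Qed.

Lemma eq_coef_mulXn n u v : (forall j, (j < n)%N -> u`_j = v`_j) ->
  exists2 s, u - v = 'X^n * s & s`_0 = u`_n - v`_n.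
Proof.
move=> uv; exists (\poly_(i < size (u - v)) (u - v)`_(i + n)).
  apply/polyP => i; rewrite mulrC coefMXn; case: ltnP => h.
    by rewrite coefB uv // subrr.
  rewrite coef_poly subnK //; case: ltnP => // h'.
  by rewrite nth_default //; apply: leq_trans h' _; exact: leq_subr.
rewrite coef_poly add0n coefB; case: ltnP => // h.
by rewrite -coefB nth_default //; exact: leq_trans h _.
Qed.

Lemma coef_Xn_mul n s k : ('X^n * s * k)`_n = s`_0 * k`_0.
Proof. by rewrite -mulrA mulrC coefMXn ltnn subnn coef0M. Qed.

Lemma coef_mulXn_comp n u s :
  u`_0 = 0 -> (('X^n * s) \Po u)`_n = u`_1 ^+ n * s`_0.
Proof.
move=> u0; have [w Ew w0] := coef0_eq_mulX u0.
rewrite comp_polyM comp_Xn_poly {1}Ew exprMn coef_Xn_mul coef0_comp // -w0.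
by congr (_ * _); rewrite -!horner_coef0 horner_exp.
Qed.

(** Changing the inner map contributes the change times p'(0) = -1, changing the outer one
    contributes it times (-1)^n. An odd coefficient thus moves its counterpart in p o p by -2 times
    the change, an even one not at all. *)
Lemma coef_comp_perturb n p q : p`_0 = 0 -> p`_1 = -1 -> (1 < n)%N ->
  (forall j, (j < n)%N -> q`_j = p`_j) ->
  (q \Po q)`_n = (p \Po p)`_n + (q`_n - p`_n) * ((-1) ^+ n - 1).
Proof.
move=> p0 p1 n1 qp; have q0 : q`_0 = 0 by rewrite qp // ltnW.
have [s Es s0] := eq_coef_mulXn qp.
have [k Ek k0] := comp_poly_diff p q0 p0.
have -> : q \Po q = (p \Po p) + (q - p) * k + ((q - p) \Po q).
  by rewrite -Ek linearB /=; ring.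
rewrite !coefD Es coef_Xn_mul coef_mulXn_comp // s0 k0 (qp 1%N) // p1.
by rewrite -addrA; congr (_ + _); ring.
Qed.

(** If p o p = X + s X^n + ..., the term of degree n of p o p o p - p is -s when p is applied last
    and (-1)^n s when it is applied first. For even n this forces 2 s = 0. *)
Lemma coef_comp_even n p : p`_0 = 0 -> p`_1 = -1 -> (1 < n)%N -> ~~ odd n ->
  (forall j, (j < n)%N -> (p \Po p)`_j = 'X`_j) -> (p \Po p)`_n *+ 2 = 0.
Proof.
move=> p0 p1 n1 en pp; have [s Es s0] := eq_coef_mulXn pp.
have pp0 : (p \Po p)`_0 = 0 by rewrite pp ?coefX // ltnW.
have X0 : ('X : {poly A})`_0 = 0 by rewrite coefX.
have [k Ek k0] := comp_poly_diff p pp0 X0.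
have := congr1 (fun P : {poly A} => P`_n) Ek.
rewrite comp_polyXr Es coef_Xn_mul comp_polyA.
have -> : (p \Po p) \Po p - p = ('X^n * s) \Po p.
  by rewrite -Es linearB /= comp_polyX.
rewrite coef_mulXn_comp // p1 k0 p1 -signr_odd (negbTE en) mul1r mulrN1.
by rewrite s0 coefX gtn_eqF // subr0 => /eqP; rewrite -addr_eq0 mulr2n => /eqP.
Qed.

Lemma coef_comp_scale p (t : A) n : (p \Po (t *: 'X))`_n = p`_n * t ^+ n.
Proof.
rewrite comp_polyE; under eq_bigr do rewrite exprZn scalerA.
rewrite -(poly_def (size p) (fun i => p`_i * t ^+ i)) coef_poly.
by case: ltnP => // h; rewrite nth_default ?mul0r.
Qed.

End CompCoef.

Section NoSolution.
Variable R : numFieldType.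
Implicit Types p : {poly R}.

(** q is p conjugated by the homothety whose ratio t is the inner variable: t q(Z) = p(t Z). *)
Lemma coef_graded_comp d p (q : {poly {poly R}}) n : (size p <= d.+1)%N -> p`_0 = 0 ->
    (forall j, q`_j = p`_j *: 'X^(j.-1)) ->
  (q \Po q)`_n * 'X = (p \Po p)`_n *: 'X^n.
Proof.
move=> sp p0 qE; pose P := map_poly polyC p.
have E : 'X *: q = P \Po ('X *: 'X).
  apply/polyP => -[|j]; rewrite coefZ coef_comp_scale coef_map qE /=.
    by rewrite p0 scale0r mulr0 mul0r.
  by rewrite -scalerAr -exprS mul_polyC.
have -> : (q \Po q)`_n * 'X = ('X *: (q \Po q))`_n by rewrite coefZ mulrC.
rewrite -linearZ /= E -comp_polyA linearZ /= comp_polyX E comp_polyA.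
by rewrite coef_comp_scale -map_comp_poly coef_map mul_polyC.
Qed.

Theorem no_formal_involution d (u pure : seq nat) pairs p :
    obstruction_check d u pure pairs -> size u = d./2 ->
    (size p <= d.+1)%N -> p`_0 = 0 -> p`_1 = -1 ->
    (forall n, odd n -> (2 < n < d.*2)%N -> (p \Po p)`_n = 0) ->
  p = - 'X.
Proof.
move=> chk su sp p0 p1 pp.
pose r := d./2; pose w := mkseq (fun i => i.*2.+1) r.
pose y i := p`_(i.*2.+2) / 2.
have sw : size w = r by rewrite size_mkseq.
have w1 : all (leq 1) w by apply/allP => _ /mapP[i _ ->].
pose Y := graded_var y w.
(* Half of the conjugate of p by the homothety of ratio the inner variable, which records weights.
   Index 1 is set to 0 because [refl_poly] supplies -X. *)
pose b : {poly {poly R}} :=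
  \poly_(j < d.+1) (if j == 1%N then 0 else (p`_j / 2) *: 'X^(j.-1)).
have two : (2 : R) != 0 by rewrite pnatr_eq0.
have qE j : (refl_poly b)`_j = p`_j *: 'X^(j.-1).
  rewrite /refl_poly coefD coefN coefX coefMn coef_poly.
  case: eqP => [->|/eqP j1]; first by rewrite if_same mul0rn addr0 p1 expr0 scaleN1r mulr1n.
  rewrite mulr0n oppr0 add0r; case: ltnP => [_|h]; last first.
    by rewrite (nth_default _ (leq_trans sp h)) scale0r mul0rn.
  by rewrite -scaler_nat scalerA mulrC divfK.
have quart n : odd n -> (2 < n < d.*2)%N -> (quarter d b)`_n = 0.
  move=> on nd; have := coef_graded_comp n sp p0 qE; rewrite pp // scale0r => /eqP.
  rewrite mulf_eq0 polyX_eq0 orbF => /eqP qq.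
  have := congr1 (fun P : {poly {poly R}} => P`_n) (comp_refl_poly (size_poly _ _ : (size b <= d.+1)%N)).
  rewrite coefB qq coefX coefMn gtn_eqF ?subrr; last by case/andP: nd => /ltnW.
  by move/esym/eqP; rewrite -mulr_natl mulf_eq0 -polyC_natr polyC_eq0 pnatr_eq0 => /eqP.
have b1 : b`_1 = 0 by rewrite coef_poly; case: ifP.
have b0 : b`_0 = 0 by rewrite coef_poly /= p0 mul0r scale0r.
(* The stage of the elimination at which the odd coefficients of index at least n have not yet been
   solved for. *)
pose bt n : {poly {poly R}} := \poly_(j < d.+1) (if odd j && (n <= j)%N then 0 else b`_j).
have bt_lt n j : (j < n)%N -> (bt n)`_j = b`_j.
  move=> jn; rewrite [LHS]coef_poly [(n <= j)%N]leqNgt jn andbF [b`_j]coef_poly.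
  by case: (j < d.+1)%N.
(* For [b] this coefficient is 0 and contains b_n as the summand -b_n; without that summand it
   equals b_n. *)
have quart_bt n : odd n -> (2 < n < d.*2)%N -> (quarter d (bt n))`_n = b`_n.
  move=> on nd; have n1 : (1 < n)%N by case/andP: nd => /ltnW.
  have btn : (bt n)`_n = 0 by rewrite coef_poly on leqnn if_same.
  have quartE (c : {poly {poly R}}) : (size c <= d.+1)%N ->
      (refl_poly c \Po refl_poly c)`_n = (quarter d c)`_n *+ 4.
    by move=> sc; rewrite -coefMn -(comp_refl_poly sc) coefB coefX gtn_eqF // subr0.
  have Eb := quartE b (size_poly _ _); rewrite quart // mul0rn in Eb.
  move: (quartE (bt n) (size_poly _ _)) Eb.
  have r0 : (refl_poly b)`_0 = 0.
    by rewrite /refl_poly coefD coefN coefX coefMn b0 mul0rn addr0 oppr0.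
  have r1 : (refl_poly b)`_1 = -1.
    by rewrite /refl_poly coefD coefN coefX coefMn b1 mul0rn addr0.
  have rn j : (j < n)%N -> (refl_poly (bt n))`_j = (refl_poly b)`_j.
    by move=> jn; rewrite /refl_poly !coefD bt_lt.
  rewrite (coef_comp_perturb r0 r1 n1 rn).
  move=> + qb; rewrite {}qb add0r /refl_poly !coefD btn !addr0.
  rewrite -signr_odd on expr1 opprD addNKr => E.
  apply/eqP; rewrite -subr_eq0 -[_ == 0](orFb).
  have : (4%:R : {poly R}) * ((quarter d (bt n))`_n - b`_n) == 0.
    by rewrite mulrBr !mulr_natl -E; apply/eqP; ring.
  by rewrite mulf_eq0 -polyC_natr polyC_eq0 pnatr_eq0.
pose rep := @repr 11 r d.*2 _ Y.
have rep_even : rep (even_vars r d) (bt 3).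
  move=> n nK; rewrite coef_poly; case: ltnP => [nd|nd]; last first.
    rewrite nth_default ?size_mkseq // sym_val_nil; exact: cong_refl.
  rewrite nth_mkseq //; case: ifP => [/andP[on n3]|/negbT n3].
    by rewrite on andbF sym_val_nil; exact: cong_refl.
  case: n nK nd n3 => [|n] nK nd n3; first by rewrite b0 sym_val_nil; exact: cong_refl.
  case: (boolP (odd n.+1)) => [on|en].
    rewrite andbF.
    have -> : n = 0%N by move: n3; rewrite on /=; case: (n) on => [|[|]].
    by rewrite b1 sym_val_nil; exact: cong_refl.
  rewrite andbT.
  set i := n.+1./2.-1.
  have Ei : n.+1 = i.*2.+2.
    have := odd_double_half n.+1; rewrite (negbTE en) add0n /i.
    by case: (n.+1./2) => // k <-.
  have ir : (i < r)%N by rewrite /r -(ltn_double) -ltnS; lia.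
  rewrite -/i; set m := mkseq _ _.
  have -> : sym_val r Y [:: (m, Zpos xH)] = Y i.
    rewrite sym_val_cons sym_val_nil addr0 mul1r /mono_val (bigD1 (Ordinal ir)) //=.
    rewrite nth_mkseq // eqxx expr1 big1 ?mulr1 // => k.
    by rewrite -val_eqE nth_mkseq //= => /negbTE->; rewrite expr0.
  have -> : b`_n.+1 = Y i; last exact: cong_refl.
  have [En] : n.+1 = (i.*2.+1).+1 by [].
  by rewrite /b coef_poly nd En /Y /graded_var /y /w nth_mkseq.
have bt_even n : ~~ odd n -> bt n = bt n.+1.
  move=> en; apply/polyP => j; rewrite !coef_poly; case: (j < d.+1)%N => //.
  case: (boolP (odd j)) => //= oj; rewrite [(n <= j)%N]leq_eqVlt.
  by case: eqP => [E|] //; rewrite E oj in en.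
have rep_elim : rep (elim_odd 11 r d.*2 d (odds 3 d.+1)) b.
  have rep_k k : (3 + k <= d.+1)%N ->
      rep (elim_odd 11 r d.*2 d [seq i <- iota 3 k | odd i]) (bt (3 + k)%N).
    elim: k => [|k IH] kd; first by rewrite addn0.
    rewrite -[k.+1]addn1 iotaD filter_cat /elim_odd foldl_cat.
    rewrite -/(elim_odd 11 r d.*2 d [seq i <- iota 3 k | odd i]).
    have {}IH := IH (leq_trans (leq_add (leqnn 3) (leqnSn k)) kd).
    set al := elim_odd _ _ _ _ _ in IH *; set n := (3 + k)%N in IH kd *.
    rewrite [(3 + _)%N]addnA addn1 -/n; have n3 : (2 < n)%N by [].
    have {}kd : (n < d.+1)%N by rewrite /n -addnS.
    clearbody n => /=; case: (boolP (odd n)) => on /=; last by rewrite -bt_even.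
    have nd : (2 < n < d.*2)%N by lia.
    move=> j jK; rewrite nth_set_nth /=; case: eqP => [->|jn]; last first.
      have -> : (bt n.+1)`_j = (bt n)`_j by rewrite !coef_poly [(n <= j)%N]leq_eqVlt (introF eqP (nesym jn)).
      exact: IH.
    rewrite bt_lt // -(quart_bt n) //.
    by apply: (repr_quarter IH); [rewrite bt_lt // ltnW | lia | lia].
  have [d3|d2] := leqP 3 d.+1.
    have := rep_k (d.+1 - 3)%N; rewrite subnKC // => /(_ (leqnn _)).
    have -> // : bt d.+1 = b.
    apply/polyP => j; have [jd|jd] := ltnP j d.+1; first exact: bt_lt.
    by rewrite [LHS]coef_poly [RHS]coef_poly ltnNge jd.
  have -> : odds 3 d.+1 = [::].
    by rewrite /odds /index_iota (_ : d.+1 - 3 = 0)%N //; apply/eqP; rewrite subn_eq0 ltnW.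
  suff <- : bt 3 = b by [].
  apply/polyP => j; have [jd|jd] := ltnP j d.+1.
    by apply: bt_lt; apply: leq_trans jd _; exact: ltnW.
  by rewrite [LHS]coef_poly [RHS]coef_poly ltnNge jd.
have obs0 : {in obstructions 11 d, forall f, vanishing r Y 11 f}.
  move=> f /mapP[n]; rewrite mem_filter mem_index_iota => /andP[on nd] ->.
  apply: cong_sym; rewrite -(quart n) //; last by lia.
  apply: (repr_quarter rep_elim) => //; last by case/andP: nd.
  by case/andP: nd; lia.
have y0 i : (i < r)%N -> y i = 0.
  have [D0 HD] := cofinite_vanishing sw su w1 chk (vanishing_groebner (fun f fG =>
    let: ex_intro2 g gG E := mapP fG in
    eq_ind_r (fun f => vanishing r Y 11 f) (vanishing_monic (obs0 g gG)) E)).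
  exact: (@vanish_of_congruence _ r y w sw w1 11 D0 isT HD).
have ev0 i : p`_(i.*2.+2) = 0.
  have [ir|ri] := ltnP i r; last first.
    by rewrite nth_default //; apply: leq_trans sp _; rewrite /r in ri; lia.
  by move/eqP: (y0 i ir); rewrite mulf_eq0 invr_eq0 (negbTE two) orbF => /eqP.
(* The even coefficients are now 0. If p agrees with -X below an odd degree n, the coefficient of
   degree n of p o p is -2 p_n, so p_n = 0 as well. *)
apply/polyP => n; have [m] := ubnP n; elim: m n => // m IH [|[|n]] nm.
- by rewrite p0 coefN coefX oppr0.
- by rewrite p1 coefN coefX.
rewrite coefN coefX oppr0; case: (boolP (odd n)) => [on|en]; last first.
  by rewrite -(odd_double_half n) (negbTE en) ev0.
have [nd|nd] := ltnP n.+2 d.+1; last by rewrite nth_default // (leq_trans sp).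
have agree j : (j < n.+2)%N -> p`_j = (- 'X : {poly R})`_j.
  by move=> jn; apply: IH; apply: leq_trans jn _.
have x0 : (- 'X : {poly R})`_0 = 0 by rewrite coefN coefX oppr0.
have x1 : (- 'X : {poly R})`_1 = -1 by rewrite coefN coefX.
have := coef_comp_perturb x0 x1 (isT : (1 < n.+2)%N) agree.
rewrite pp; [|by rewrite /= on|by lia].
rewrite linearN /= comp_polyX opprK coefX /= add0r coefN coefX /= oppr0 subr0.
rewrite -signr_odd /= ?negbK on expr1 => /esym/eqP; rewrite mulf_eq0.
by rewrite -opprD oppr_eq0 -mulr2n pnatr_eq0 orbF => /eqP.
Qed.

End NoSolution.

(* The S-pairs to reduce, the secondary weights and the positions of the pure powers were found by running Buchberger's algorithm modulo 11. *)
Lemma obstruction_checks d : (2 <= d <= 10)%N ->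
  exists u pure pairs, obstruction_check d u pure pairs /\ size u = d./2.
Proof.
case: d => [|[|[|[|[|[|[|[|[|[|[|d]]]]]]]]]]] // _.
- by exists [:: 1]%N, [:: 0]%N, [::]; vm_compute.
- by exists [:: 1]%N, [:: 0]%N, [::]; vm_compute.
- by exists [:: 1; 0]%N, [:: 2; 1]%N, [:: (0, 1)]%N; vm_compute.
- by exists [:: 1; 0]%N, [:: 3; 0]%N, [:: (0, 1); (0, 2)]%N; vm_compute.
- by exists [:: 1; 0; 0]%N, [:: 5; 0; 2]%N, [:: (0, 1); (1, 2); (0, 4)]%N; vm_compute.
- exists [:: 1; 0; 0]%N, [:: 7; 2; 1]%N,
    [:: (0, 1); (2, 3); (0, 2); (3, 4); (1, 5)]%N.
  by vm_compute.
- exists [:: 4; 1; 0; 1]%N, [:: 13; 5; 1; 3]%N,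
    [:: (0, 1); (0, 2); (1, 2); (2, 3); (3, 4); (0, 6); (7, 8); (0, 7); (4, 7);
        (1, 11)].
  by vm_compute.
- exists [:: 8; 1; 0; 0]%N, [:: 18; 7; 0; 2]%N,
    [:: (0, 3); (0, 1); (1, 2); (1, 4); (2, 4); (0, 6); (6, 8); (1, 6); (4, 9);
        (0, 8); (1, 8); (2, 9); (1, 12); (2, 12); (0, 16)].
  by vm_compute.
- exists [:: 16; 2; 1; 1; 2]%N, [:: 22; 13; 0; 2; 4]%N,
    [:: (0, 1); (1, 2); (1, 3); (2, 3); (0, 6); (3, 4); (1, 6); (0, 8); (1, 8);
        (2, 10); (5, 8); (3, 10); (6, 8); (9, 10); (0, 15); (6, 14); (18, 20);
        (2, 17)].
  by vm_compute.
Qed.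

(** * Weak fixed points *)

Section Weak.
Variable R : numFieldType.

Lemma expr1D_mod4 (A : comNzRingType) (q : A) n : exists k,
  (1 + q) ^+ n =
    1 + n%:R * q + 'C(n, 2)%:R * q ^+ 2 + 'C(n, 3)%:R * q ^+ 3 + q ^+ 4 * k.
Proof.
elim: n => [|n [k Ek]]; first by exists 0; rewrite expr0 !mul0r mulr0 !addr0.
exists ('C(n, 3)%:R + k * (1 + q)).
rewrite exprSr Ek !binS bin1 !natrD -natr1.
by move: ('C(n, 2))%:R ('C(n, 3))%:R n%:R => a b c; ring.
Qed.

Definition weak_poly m : {poly R} :=
  - 'X + 'X^(m.*2.+2) - m.+1%:R * 'X^((4 * m).+3).

Lemma bin3_natr (A : comNzRingType) n :
  3%:R * 'C(n, 3)%:R = 'C(n, 2)%:R * (n%:R - 2%:R) :> A.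
Proof.
case: n => [|[|n]]; rewrite ?mulr0 ?mul0r // -[n.+2]addn2 natrD addrK -!natrM.
by congr (_%:R); have := mul_bin_left (n + 2) 2; rewrite addnK mulnC [RHS]mulnC.
Qed.

(** With n = 2m + 1 and k = m + 1 the map is -X g(X^n), where g = 1 - x + k x^2. As n is odd, its
    second iterate is X g(x) (1 + w + k w^2) with x = X^n and w = x g(x)^n. The value k = (n + 1)/2
    cancels the order x^2, then x^3 cancels too, and x^4 corresponds to the degree 4n + 1 = 8m +
    5. *)
Lemma weak_poly_comp m : exists2 e : {poly R},
  weak_poly m \Po weak_poly m = 'X + 'X^((8 * m).+4.+1) * e & e`_0 != 0.
Proof.
pose n := m.*2.+1; pose k : {poly R} := m.+1%:R; pose N : {poly R} := n%:R.
have kN : N = 2%:R * k - 1.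
  by rewrite /N /k /n -muln2 -!natr1 natrM; ring.
pose c2 : {poly R} := 'C(n, 2)%:R; pose c3 : {poly R} := 'C(n, 3)%:R.
have c2E : c2 = N * (k - 1).
  by rewrite /c2 /N /n /k bin2 /= -[m.+1%:R]natr1 addrK -natrM; congr (_%:R); nia.
have c3E : 3%:R * c3 = c2 * (N - 2%:R) by exact: bin3_natr.
pose x : {poly R} := 'X; pose g := 1 - x + k * x ^+ 2.
have [K0 EK] := expr1D_mod4 (x * (k * x - 1)) n.
have Eg : g ^+ n = (1 + x * (k * x - 1)) ^+ n by congr (_ ^+ _); rewrite /g; ring.
pose g1 := - N; pose g2 := N ^+ 2; pose g3 := - (2%:R * k * c2) - c3.
pose K := k ^+ 2 * c2 + c3 * (3%:R * k - 3%:R * k ^+ 2 * x + k ^+ 3 * x ^+ 2)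
          + (k * x - 1) ^+ 4 * K0.
have {}Eg : g ^+ n = 1 + g1 * x + g2 * x ^+ 2 + g3 * x ^+ 3 + x ^+ 4 * K.
  rewrite Eg EK -/N -/c2 -/c3 /g1 /g2 /g3 /K.
  have -> : N ^+ 2 = N * k + c2 by rewrite c2E kN; ring.
  by ring.
pose b := g3 + x * K.
pose S := 2%:R * g1 * g2 + g2 ^+ 2 * x + 2%:R * (1 + g1 * x + g2 * x ^+ 2) * b
          + x ^+ 3 * b ^+ 2.
pose t2 := g1 + k; pose t3 := g2 + 2%:R * k * g1.
pose t4 := g3 + k * (g1 ^+ 2 + 2%:R * g2).
pose D := t4 - t3 + k * t2 + x * ((K + k * S) * g - t4 + k * t3 + k * t4 * x).
have gD : g * (1 + x * g ^+ n + k * (x * g ^+ n) ^+ 2) = 1 + x ^+ 4 * D.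
  rewrite Eg.
  have T : 1 + x * (1 + g1 * x + g2 * x ^+ 2 + g3 * x ^+ 3 + x ^+ 4 * K) +
      k * (x * (1 + g1 * x + g2 * x ^+ 2 + g3 * x ^+ 3 + x ^+ 4 * K)) ^+ 2 =
      1 + x + t2 * x ^+ 2 + t3 * x ^+ 3 + t4 * x ^+ 4 + x ^+ 5 * (K + k * S).
    rewrite /t2 /t3 /t4 /S /b; ring.
  rewrite {}T /D /g.
  have e2 : t2 = 1 - k by rewrite /t2 /g1 kN; ring.
  have e3 : t3 = t2 - k by rewrite e2 /t3 /g2 /g1 kN; ring.
  have e2' : t2 - 1 + k = 0 by rewrite e2; ring.
  have e3' : t3 - t2 + k = 0 by rewrite e3; ring.
  transitivity (1 + x ^+ 2 * (t2 - 1 + k) + x ^+ 3 * (t3 - t2 + k) + x ^+ 4 *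
    (t4 - t3 + k * t2 + x * ((K + k * S) * (1 - x + k * x ^+ 2) - t4 + k * t3 + k * t4 * x))).
    by ring.
  by rewrite e2' e3'; ring.
exists (D \Po 'X^n); last first.
  rewrite coef0_comp; last by rewrite coefXn.
  (* The binomials and k = (n + 1)/2 make D(0) a rational polynomial in n; the factor 12 clears its
     denominators and shows positive coefficients, so no n makes it vanish. *)
  have D12 : 12%:R * D = (10 * (n * n * n) + 21 * (n * n) + 14 * n + 3)%N%:R +
      x * (12%:R * ((K + k * S) * g - t4 + k * t3 + k * t4 * x)).
    have k2 : 2%:R * k = N + 1 by rewrite kN; ring.
    have c2N : 2%:R * c2 = N * (N - 1).
      by rewrite c2E mulrCA mulrBr k2; ring.
    have c3N : 6%:R * c3 = N * (N - 1) * (N - 2%:R).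
      by rewrite -c2N -mulrA -c3E; ring.
    rewrite /D mulrDr; congr (_ + _); last by ring.
    rewrite !natrD !natrM -/N.
    transitivity (2%:R * (6%:R * g3) + 3%:R * (2%:R * k) * 2%:R * (g1 ^+ 2 + 2%:R * g2)
      - 12%:R * t3 + 3%:R * (2%:R * k) * (2%:R * t2)); first by rewrite /t4; ring.
    have -> : 6%:R * g3 = - (3%:R * (2%:R * k) * (2%:R * c2) + 6%:R * c3).
      by rewrite /g3; ring.
    have -> : 2%:R * t2 = 1 - N by rewrite /t2 mulrDr k2 /g1; ring.
    have -> : t3 = N ^+ 2 + (2%:R * k) * g1 by [].
    by rewrite c2N c3N k2 /g1 /g2; ring.
  have := congr1 (fun P : {poly R} => P`_0) D12.
  rewrite coefD [X in _ = _ + X]coef0M coefX mul0r addr0 coef0M.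
  rewrite -!polyC_natr !coefC /= => E; apply/eqP => D0.
  by move: E; rewrite D0 mulr0 => /esym/eqP; rewrite pnatr_eq0 !addn_eq0 andbF.
have gP u : g \Po u = 1 - u + k * u ^+ 2.
  by rewrite /g /k rmorphD rmorphB rmorphM rmorphXn rmorph1 rmorph_nat /= comp_polyX.
set G := g \Po 'X^n.
have pE : weak_poly m = - 'X * G.
  rewrite /G gP /weak_poly -/k.
  have -> : 'X^(m.*2.+2) = 'X * 'X^n :> {poly R} by rewrite -exprS.
  have -> : 'X^((4 * m).+3) = 'X * 'X^n ^+ 2 :> {poly R}.
    by rewrite -exprM -exprS; congr (_ ^+ _); rewrite /n; lia.
  by ring.
pose w := 'X^n * G ^+ n.
have -> : weak_poly m \Po weak_poly m = 'X * (G * (1 + w + k * w ^+ 2)).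
  have Gp : G \Po weak_poly m = g \Po weak_poly m ^+ n.
    by rewrite /G -comp_polyA comp_Xn_poly.
  have pn : weak_poly m ^+ n = - w.
    by rewrite pE mulNr exprNn -signr_odd /n /= odd_double expr1 mulN1r exprMn.
  by rewrite {2}pE comp_polyM linearN /= comp_polyX Gp pn gP pE; ring.
have -> : G * (1 + w + k * w ^+ 2) = 1 + 'X^n ^+ 4 * (D \Po 'X^n).
  have cg : (g ^+ n) \Po 'X^n = G ^+ n by exact: rmorphXn.
  have cw : (x * g ^+ n) \Po 'X^n = w by rewrite comp_polyM comp_polyX cg.
  have ck : k \Po 'X^n = k by exact: rmorph_nat.
  have c1 : (1 : {poly R}) \Po 'X^n = 1 by exact: rmorph1.
  have := congr1 (fun P => P \Po 'X^n) gD.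
  move: (x * g ^+ n) cw => h cw; rewrite !expr2.
  rewrite comp_polyM -/G comp_polyD comp_polyD c1 cw comp_polyM ck comp_polyM cw => ->.
  by rewrite comp_polyD c1 comp_polyM comp_Xn_poly.
rewrite mulrDr mulr1 mulrA; congr (_ + _ * _).
by rewrite -exprM -exprS; congr (_ ^+ _); rewrite /n; lia.
Qed.

End Weak.

(** * Cyclicity and roots of the second iterate *)

Local Open Scope card_scope.

Lemma card_le_IIP (T : Type) (A : set T) N : A #<= `I_N ->
  exists2 n, (n <= N)%N & A #= `I_n.
Proof.
move=> AN; have /finite_setP[n An] : finite_set A.
  exact: card_le_finite AN (finite_II N).
exists n => //; rewrite -card_le_II; apply: card_le_trans AN.
by rewrite card_eq_le in An; case/andP: An.
Qed.

Section Cyclicity.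
Variables (R : realType) (n : nat) (f : 'rV[R]_n -> R -> R).
Local Notation V := [set: 'rV[R]_n].
Local Notation S b := (isolated_periodic2_orbits_in (f b)).

Lemma disc_self (eps : R) (a : 'rV[R]_n) : 0 < eps -> disc eps a a.
Proof.
move=> e0; rewrite /disc /= big1 ?sqrtr0 // => i _.
by rewrite subrr expr0n.
Qed.

Lemma sub_disc (eps eps' : R) (a b : 'rV[R]_n) :
  eps <= eps' -> disc eps a b -> disc eps' a b.
Proof. by move=> le lt; exact: lt_le_trans lt le. Qed.

Lemma sub_orbits_in b (delta delta' : R) : delta <= delta' ->
  S b delta `<=` S b delta'.
Proof.
move=> le O [isoO Od]; split=> //; apply: subset_trans Od _.
exact: le_ball.
Qed.

(** The cyclicity is the least N that bounds the orbits for some pair of neighbourhoods. As N - 1 is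
    a bound for no pair, N is attained, and attained arbitrarily close to [a] and to the origin. *)
Lemma origin_cyclicity_exists (a : 'rV[R]_n) K :
    (exists eps0 delta0 : R, [/\ 0 < eps0, 0 < delta0 &
       forall b, disc eps0 a b -> S b delta0 #<= `I_K]) ->
  origin_cyclicity_le V f a K.
Proof.
pose P N := exists eps0 delta0 : R, [/\ 0 < eps0, 0 < delta0 &
  forall b, disc eps0 a b -> S b delta0 #<= `I_N].
move=> PK; have exP : exists N, `[< P N >] by exists K; apply/asboolP.
case: (ex_minnP exP) => N /asboolP[eps0 [delta0 [e0 d0 PN]]] minN.
exists N; last by apply: minN; apply/asboolP.
have strict (eps delta : R) : 0 < eps -> 0 < delta ->
    ~ (forall b, disc eps a b -> exists2 k, (k < N)%N & S b delta #= `I_k).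
  move=> ep dp H; have [k kN _] := H a (disc_self a ep).
  suff /minN : `[< P N.-1 >] by case: (N) kN => //= N'; rewrite ltnn.
  apply/asboolP; exists eps, delta; split => // b /H[k' k'N bk'].
  apply: (@card_le_trans _ _ _ `I_k').
    by rewrite card_eq_le in bk'; case/andP: bk'.
  by rewrite card_le_II; case: (N) k'N.
split.
  exists eps0, delta0; split => //.
  apply: contrapT => noN; apply: (strict _ _ e0 d0) => b ab.
  have [k kN bk] := card_le_IIP (PN b ab); exists k => //.
  rewrite ltn_neqAle kN andbT; apply/eqP => kE.
  by apply: noN; exists b; rewrite -?kE.
move=> eps delta ep dp _; apply: contrapT => noN.
apply: (strict (Num.min eps eps0) (Num.min delta delta0)).
- by rewrite lt_min ep.
- by rewrite lt_min dp.
move=> b ab.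
have /PN bN : disc eps0 a b by apply: sub_disc ab; rewrite ge_min lexx orbT.
have sub0 : S b (Num.min delta delta0) `<=` S b delta0.
  by apply: sub_orbits_in; rewrite ge_min lexx orbT.
have [k kN bk] := card_le_IIP (card_le_trans (subset_card_le sub0) bN).
exists k => //; rewrite ltn_neqAle kN andbT; apply/eqP => kE.
apply: noN; exists b; first by apply: sub_disc ab; rewrite ge_min lexx.
apply: (@card_le_trans _ _ _ (S b (Num.min delta delta0))).
  by rewrite -kE; rewrite card_eq_le in bk; case/andP: bk.
by apply/subset_card_le/sub_orbits_in; rewrite ge_min lexx.
Qed.

Definition unfolds (a : 'rV[R]_n) N := forall eps delta : R, 0 < eps -> 0 < delta ->
  exists2 b, disc eps a b & `I_N #<= S b delta.

Lemma unfolds_le a N k : unfolds a N -> origin_cyclicity V f a k -> (N <= k)%N.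
Proof.
move=> un [[eps0 [delta0 [e0 d0 _ up _]]] _].
have [b ab Nb] := un _ _ e0 d0.
by rewrite -card_le_II; exact: card_le_trans Nb (up b ab).
Qed.

Lemma origin_cyclicity_le_unfolds a N :
  unfolds a N -> origin_cyclicity_le V f a N -> origin_cyclicity V f a N.
Proof.
move=> un [k fk kN]; suff -> : N = k by [].
by apply/eqP; rewrite eqn_leq kN (unfolds_le un fk).
Qed.

Lemma origin_cyclicity_leq a k K :
  origin_cyclicity V f a k -> origin_cyclicity_le V f a K -> (k <= K)%N.
Proof.
move=> [_ fk] [k' fk' /(leq_trans _)]; apply; apply: unfolds_le fk'.
by move=> eps delta ep dp; exact: fk.
Qed.

Lemma family_cyclicity_exists K : (forall a, origin_cyclicity_le V f a K) ->
  exists2 k, family_cyclicity V f k & (k <= K)%N.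
Proof.
move=> fK.
pose P k := `[< exists a, origin_cyclicity V f a k >].
have PK k : P k -> (k <= K)%N.
  by move/asboolP => [a fk]; exact: origin_cyclicity_leq fk (fK a).
have exP : exists k, P k.
  by have [k fk _] := fK 0; exists k; apply/asboolP; exists 0.
case: (ex_maxnP exP PK) => k Pk maxk; exists k; last exact: PK.
split=> [a _|]; last by have /asboolP[a fk] := Pk; exists a.
have [k' fk' _] := fK a; exists k' => //.
by apply: maxk; apply/asboolP; exists a.
Qed.

Lemma family_cyclicity_ge_unfolds a N K : (forall a, origin_cyclicity_le V f a K) ->
  unfolds a N -> family_cyclicity_ge V f N.
Proof.
move=> fK un; have [k fk kK] := family_cyclicity_exists fK.
exists k => //; case: fk => /(_ a I)[k' fk' /(leq_trans _) le] _; apply: le.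
exact: unfolds_le un fk'.
Qed.

Lemma family_cyclicity_eq a N : (forall a, origin_cyclicity_le V f a N) ->
  unfolds a N -> family_cyclicity V f N.
Proof.
move=> fN un; split=> [b _|]; first exact: fN.
by exists a => //; exact: origin_cyclicity_le_unfolds.
Qed.

End Cyclicity.

(** * Orbits as roots of the second iterate minus the identity *)

Section Orbits.
Variables (R : realType) (p : {poly R}).
Hypothesis p0 : p`_0 = 0.
Local Notation f := (fun x => p.[x]).
Definition second_iterate : {poly R} := (p \Po p) - 'X.
Local Notation F := second_iterate.
Local Notation S := (isolated_periodic2_orbits_in f).

Lemma rootF x : root F x = (f (f x) == x).
Proof. by rewrite /root /F hornerD hornerN hornerX horner_comp subr_eq0. Qed.

Lemma periodic2_roots O x : periodic2_orbits f O -> O x -> root F x /\ O = [set x; f x].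
Proof.
move=> [y [z [yz zy _ ->]]] /= [->|->]; rewrite rootF.
  by rewrite yz zy eqxx.
by rewrite zy yz eqxx setUC.
Qed.

(** A nonzero F has finitely many roots; the complement of those outside the orbit is an open set
    that contains no other orbit. *)
Lemma periodic2_isolated O : F != 0 -> periodic2_orbits f O ->
  isolated_periodic2_orbits f O.
Proof.
move=> F0 pO; split => //.
have [x [y [xy yx nxy OE]]] := pO.
have [rs rsP] : exists rs : seq R, forall z, (z \in rs) = root F z.
  have [s uniq_s rs] : exists2 s : seq R, uniq s & forall z, root F z -> z \in s.
    apply: contrapT => nos.
    have H n : exists2 s : seq R, uniq s & all (root F) s /\ size s = n.
      elim: n => [|n [s us [as_ ss]]]; first by exists [::].
      have [z [rz zs]] : exists z, root F z /\ z \notin s.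
        apply: contrapT => noz; apply: nos; exists s => // z rz.
        by apply: contrapT => /negP zs; apply: noz; exists z.
      by exists (z :: s); rewrite /= ?zs // rz ss.
    have [s us [as_ ss]] := H (size F).
    by have := max_poly_roots F0 as_ us; rewrite ss ltnn.
  exists [seq z <- s | root F z] => z; rewrite mem_filter andb_idr //; exact: rs.
pose bad := [seq z <- rs | (z != x) && (z != y)].
exists (~` [set` bad]); split.
- apply: closed_openC; apply: compact_closed; first exact: Rhausdorff.
  exact: finite_compact (finite_seq bad).
- by move=> z; rewrite OE => -[->|->] /=; rewrite mem_filter eqxx ?andbF.
- move=> O' pO' O'bad; have [x' [y' [xy' yx' nxy' O'E]]] := pO'.
  have O'x' : O' x' by rewrite O'E; left.
  have [rx' O'x'E] := periodic2_roots pO' O'x'.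
  have Ox' : O x'.
    have := O'bad _ O'x'; rewrite /= mem_filter rsP rx' andbT => /negP.
    rewrite negb_and !negbK OE => /orP[/eqP->|/eqP->]; [by left|by right].
  by have [_ ->] := periodic2_roots pO Ox'.
Qed.

(** An orbit is determined by either of its points, so distinct orbits are disjoint and each adds
    two new roots; 0 is fixed and lies in none. *)
Lemma orbits_roots K delta : `I_K #<= S delta ->
  exists s : seq R, [/\ uniq s, size s = K.*2 &
    forall x, x \in s -> [/\ root F x, x != 0 & `|x| < delta]].
Proof.
move=> /pcard_leP[g].
have gS i : (i < K)%N -> S delta (g i) by move=> iK; exact: (@funS _ _ _ _ g).
have ginj i j : (i < K)%N -> (j < K)%N -> g i = g j -> i = j.
  by move=> iK jK; apply: (@inj _ _ _ g); rewrite inE.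
suff H k : (k <= K)%N -> exists s : seq R, [/\ uniq s, size s = k.*2,
    forall x, x \in s -> [/\ root F x, x != 0 & `|x| < delta] &
    forall x, x \in s -> exists2 i, (i < k)%N & g i = [set x; p.[x]]].
  by have [s [us ss sP _]] := H K (leqnn K); exists s.
elim: k => [_|k IH kK]; first by exists [::].
have [s [us ss sP sg]] := IH (ltnW kK).
have [[pO _] Od] := gS k kK.
have [x [y [xy yx nxy OE]]] := pO.
have Ox : g k x by rewrite OE; left.
have Oy : g k y by rewrite OE; right.
have fresh z : g k z -> z \notin s.
  move=> Oz; apply/negP => /sg[i ik gi]; have [_ gk] := periodic2_roots pO Oz.
  have := ginj i k (ltn_trans ik kK) kK; rewrite gi gk => /(_ erefl) ikE.
  by rewrite ikE ltnn in ik.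
have pz0 : p.[0] = 0 by rewrite horner_coef0.
have nz z : g k z -> z != 0.
  move=> Oz; apply/eqP => z0; move: (periodic2_roots pO Oz) => [_].
  rewrite z0 pz0 OE => E; apply: nxy.
  have : [set 0; 0] x by rewrite -E; left.
  have : [set 0; 0] y by rewrite -E; right.
  by move=> -[] -> [] ->.
have zP z : g k z -> [/\ root F z, z != 0 & `|z| < delta].
  move=> Oz; split; [by have [] := periodic2_roots pO Oz|exact: nz|].
  by have := Od z Oz; rewrite -ball_normE /ball_ /= sub0r normrN.
exists [:: x, y & s]; split.
- rewrite /= inE negb_or us !andbT (fresh _ Ox) (fresh _ Oy) andbT andbT.
  exact/eqP.
- by rewrite /= ss doubleS.
- by move=> z; rewrite !inE => /or3P[/eqP->|/eqP->|/sP //]; exact: zP.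
- move=> z; rewrite !inE => /or3P[/eqP->|/eqP->|].
  + by exists k => //; have [] := periodic2_roots pO Ox.
  + by exists k => //; have [] := periodic2_roots pO Oy.
  + by move=> /sg[i ik gi]; exists i => //; exact: ltnW.
Qed.

End Orbits.

Section Alternation.
Variable R : realType.
Implicit Types (P p : {poly R}).

(** The leftmost sample carries the sign of [s], so that a further sample of sign -s can be put
    between it and 0. *)
Definition alternating P n (s : R) (xi : nat -> R) (delta : R) :=
  [/\ 0 < xi 0%N, xi n < delta, forall i, (i < n)%N -> xi i < xi i.+1 &
      forall i, (i <= n)%N -> 0 < s * (-1) ^+ i * P.[xi i]].

Lemma alternating_le P n s xi delta i j : alternating P n s xi delta ->
  (i <= j <= n)%N -> xi i <= xi j.
Proof.
move=> [_ _ lt _]; elim: j => [|j IH]; first by rewrite leqn0 => /andP[/eqP->].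
move=> /andP[]; rewrite leq_eqVlt => /orP[/eqP-> //|ij jn].
by apply: le_trans (ltW (lt j jn)); apply: IH; rewrite -ltnS ij ltnW.
Qed.

(** Near 0 the map sends positive points to negative ones, so an orbit through a positive root has
    no second positive point and distinct roots give distinct orbits. *)
Lemma alternating_orbits p n s xi delta delta' : p`_0 = 0 -> delta' <= delta ->
    (forall x, 0 < x < delta' -> - delta < p.[x] < 0) ->
    alternating (second_iterate p) n s xi delta' ->
  `I_n #<= isolated_periodic2_orbits_in (fun x => p.[x]) delta.
Proof.
move=> p0 dd pneg alt; have [xi0 xin lt sg] := alt.
have F0 : second_iterate p != 0.
  by apply/eqP => E; have := sg 0%N isT; rewrite E horner0 mulr0 ltxx.
have zex i : exists z, (i < n)%N -> xi i < z < xi i.+1 /\ root (second_iterate p) z.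
  have [iN|] := ltnP i n; last by exists 0.
  have /(poly_ivtoo (ltW (lt i iN)))[z] :
      (second_iterate p).[xi i] * (second_iterate p).[xi i.+1] < 0.
    have := mulr_gt0 (sg i (ltnW iN)) (sg i.+1 iN); rewrite exprS => H.
    have s0 : s != 0 by apply/eqP => s0; move: H; rewrite s0 !mul0r ltxx.
    have : 0 < (s ^+ 2) * - ((second_iterate p).[xi i] * (second_iterate p).[xi i.+1]).
      apply: lt_le_trans H _; rewrite le_eqVlt; apply/orP; left; apply/eqP.
      have e : ((-1) ^+ i) ^+ 2 = 1 :> R by rewrite sqrr_sign.
      transitivity (((-1) ^+ i) ^+ 2 * (s ^+ 2 *
        - ((second_iterate p).[xi i] * (second_iterate p).[xi i.+1]))); last by rewrite e mul1r.
      by ring.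
    by rewrite pmulr_rgt0 ?oppr_gt0 // exprn_even_gt0.
  by rewrite in_itv /=; exists z.
have [z zP] := choice zex.
have zpos i : (i < n)%N -> 0 < z i < delta'.
  move=> iN; have [/andP[l r] _] := zP i iN; apply/andP; split.
    by apply: le_lt_trans l; apply: ltW; apply: lt_le_trans xi0 _;
       apply: (alternating_le alt); exact: ltnW.
  by apply: lt_trans r _; apply: le_lt_trans xin; apply: (alternating_le alt); rewrite iN leqnn.
have zlt i j : (i < j < n)%N -> z i < z j.
  move=> /andP[ij jn]; have [/andP[_ r] _] := zP i (ltn_trans ij jn).
  have [/andP[l _] _] := zP j jn; apply: lt_trans r _; apply: le_lt_trans l.
  by apply: (alternating_le alt); rewrite ij ltnW.
pose O i := [set z i; p.[z i]].
have OS i : (i < n)%N -> isolated_periodic2_orbits_in (fun x => p.[x]) delta (O i).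
  move=> iN; have [_ rz] := zP i iN; have /andP[z0 zd] := zpos i iN.
  have /andP[pd pn] := pneg _ (zpos i iN).
  split.
    apply: periodic2_isolated => //; exists (z i), p.[z i]; split => //.
      by apply/eqP; rewrite -rootF.
    by move=> E; move: pn; rewrite -E ltNge ltW.
  move=> x; rewrite -ball_normE /ball_ /= sub0r normrN => -[->|->].
    by rewrite gtr0_norm // (lt_le_trans zd).
  by rewrite ltr0_norm // ltrNl.
have Oinj : {in `I_n &, injective O}.
  move=> i j; rewrite !inE => iN jN E.
  have : O j (z i) by rewrite -E; left.
  case=> [zE|zE]; last first.
    have /andP[z0 _] := zpos i iN; have /andP[_ pn] := pneg _ (zpos j jN).
    by move: z0; rewrite zE ltNge ltW.
  have [ij|ij|//] := ltngtP i j.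
    by have := zlt i j; rewrite ij jN zE ltxx => /(_ isT).
  by have := zlt j i; rewrite ij iN zE ltxx => /(_ isT).
apply: (@card_le_trans _ _ _ (O @` `I_n)).
  by have := card_esym (inj_card_eq Oinj); rewrite card_eq_le => /andP[].
by apply: subset_card_le => _ [i iN <-]; exact: OS.
Qed.

End Alternation.

(** * Upper bounds *)

Section Family.
Variables (R : realType) (d : nat).
Implicit Types (a b : 'rV[R]_d.-1) (p : {poly R}).
Local Notation F b := (second_iterate (family_poly b)).

Lemma coef_family_poly a j : (family_poly a)`_j =
  if j is i.+2 then (if insub i is Some k then a 0 k else 0) else - (j == 1%N)%:R.
Proof.
rewrite /family_poly coefD coefN coefX coef_sum.
case: j => [|[|i]] /=.
- by rewrite big1 ?addr0 // => k _; rewrite coefZ coefXn mulr0.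
- by rewrite big1 ?addr0 // => k _; rewrite coefZ coefXn mulr0.
rewrite oppr0 add0r; case: insubP => [k _ ik|ilt].
  rewrite (bigD1 k) //= coefZ coefXn ik eqxx mulr1 big1 ?addr0 // => k' k'k.
  rewrite coefZ coefXn !eqSS; case: eqP => [E|_]; last by rewrite mulr0.
  by move: k'k; rewrite -val_eqE /= ik E eqxx.
rewrite big1 // => k _; rewrite coefZ coefXn !eqSS.
by case: eqP => [E|_]; [move: ilt; rewrite E ltn_ord|rewrite mulr0].
Qed.

Lemma family_poly0 a : (family_poly a)`_0 = 0.
Proof. by rewrite coef_family_poly oppr0. Qed.

Lemma family_poly1 a : (family_poly a)`_1 = -1.
Proof. by rewrite coef_family_poly. Qed.

Lemma coef_family_poly_ord a (i : 'I_d.-1) : (family_poly a)`_i.+2 = a 0 i.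
Proof. by rewrite coef_family_poly valK. Qed.

Lemma size_family_poly a : (1 < d)%N -> (size (family_poly a) <= d.+1)%N.
Proof.
move=> d1; apply/leq_sizeP => j dj; rewrite coef_family_poly.
case: j dj => [|[|i]] //; first by lia.
by move=> dj; rewrite insubN //; lia.
Qed.

Lemma family_poly_inj a p : (forall j : 'I_d.-1, p`_j.+2 = a 0 j) -> p`_0 = 0 ->
  p`_1 = -1 -> (size p <= d.+1)%N -> p = family_poly a.
Proof.
move=> pa p0 p1 sp; apply/polyP => -[|[|i]].
- by rewrite p0 family_poly0.
- by rewrite p1 family_poly1.
rewrite coef_family_poly; case: insubP => [k _ <-|ilt]; first exact: pa.
by rewrite nth_default // (leq_trans sp) //; lia.
Qed.

Lemma family_poly_eqNX a : family_poly a = - 'X -> a = 0.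
Proof.
move=> E; apply/rowP => i; rewrite mxE -coef_family_poly_ord E coefN coefX.
by rewrite oppr0.
Qed.

Lemma family_poly_0 : family_poly (0 : 'rV[R]_d.-1) = - 'X.
Proof.
by rewrite /family_poly big1 ?addr0 // => i _; rewrite mxE scale0r.
Qed.

(** Degrees multiply under composition, so p o p = X forces p to have degree 1. *)
Lemma second_iterate_eq0 p : p`_0 = 0 -> p`_1 = -1 -> second_iterate p = 0 ->
  p = - 'X.
Proof.
move=> p0 p1 /eqP; rewrite subr_eq0 => /eqP E.
have : (size p).-1 = 1%N.
  by have := size_comp_poly p p; rewrite E size_polyX /=; case: (size p).-1 => [|[|n]].
move=> sp; apply/polyP => -[|[|i]].
- by rewrite p0 coefN coefX oppr0.
- by rewrite p1 coefN coefX.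
by rewrite coefN coefX oppr0 nth_default //; move: sp; case: (size p) => // -[|[]].
Qed.

Lemma second_iterate_family_eq0 a : F a = 0 -> a = 0.
Proof.
move=> E; apply: family_poly_eqNX; apply: second_iterate_eq0 E.
  exact: family_poly0.
exact: family_poly1.
Qed.

(** Multiplying an orbit of -x by a factor 1 + e close to 1 gives another orbit inside any given
    neighbourhood. *)
Lemma isolated_orbits_reflection :
  isolated_periodic2_orbits (fun x : R => (- 'X : {poly R}).[x]) = set0.
Proof.
rewrite -classical_sets.subset0 => O [[x [y [xy yx nxy OE]]] [U [oU OU iU]]].
have {xy} yE : y = - x by rewrite -xy hornerN hornerX.
have x0 : x != 0 by apply/eqP => x0; apply: nxy; rewrite yE x0 oppr0.
have Ux : U x by apply: OU; rewrite OE; left.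
have Uy : U y by apply: OU; rewrite OE; right.
have [e1 /= e10 be1] : exists2 e : R, 0 < e & ball x e `<=` U.
  by have /nbhs_ballP := open_nbhs_nbhs (conj oU Ux).
have [e2 /= e20 be2] : exists2 e : R, 0 < e & ball y e `<=` U.
  by have /nbhs_ballP := open_nbhs_nbhs (conj oU Uy).
pose e := Num.min e1 e2 / (2 * `|x|).
have m0 : 0 < Num.min e1 e2 by rewrite lt_min e10.
have nx0 : 0 < `|x| by rewrite normr_gt0.
have e0 : 0 < e by rewrite divr_gt0 // mulr_gt0.
have ne : `|x * e| < Num.min e1 e2.
  rewrite normrM (gtr0_norm e0) /e.
  rewrite [X in X < _](_ : _ = Num.min e1 e2 / 2); last by field; rewrite normr_eq0.
  by rewrite ltr_pdivrMr // ltr_pMr // ltr1n.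
pose z := x * (1 + e).
have z0 : z != 0 by rewrite mulf_neq0 // lt0r_neq0 // addr_gt0.
have Oz : periodic2_orbits (fun x : R => (- 'X : {poly R}).[x]) [set z; - z].
  exists z, (- z); rewrite !hornerN !hornerX opprK; split => // /eqP.
  by rewrite -addr_eq0 -mulr2n mulrn_eq0 (negbTE z0).
have OzU : [set z; - z] `<=` U.
  move=> _ [->|->].
    apply: be1; rewrite -ball_normE /ball_ /= /z mulrDr mulr1 opprD addNKr normrN.
    by apply: lt_le_trans ne _; rewrite ge_min lexx.
  apply: be2; rewrite -ball_normE /ball_ /= yE /z mulrDr mulr1 opprK addKr.
  by apply: lt_le_trans ne _; rewrite ge_min lexx orbT.
have : O z by rewrite -(iU _ Oz OzU); left.
rewrite OE yE => -[/eqP|/eqP].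
  by rewrite /z mulrDr mulr1 -subr_eq0 addrAC subrr add0r mulf_eq0 (negbTE x0) gt_eqF.
rewrite /z -subr_eq0 opprK -[X in _ + X]mulr1 -mulrDr mulf_eq0 (negbTE x0) /=.
by rewrite gt_eqF // !addr_gt0.
Qed.

Lemma orbits_in_neq0 a K delta : (0 < K)%N ->
  `I_K #<= isolated_periodic2_orbits_in (family_map a) delta -> F a != 0.
Proof.
move=> K0 le; apply/eqP => /second_iterate_family_eq0 a0.
have : isolated_periodic2_orbits_in (family_map a) delta `<=` set0.
  by rewrite -isolated_orbits_reflection -family_poly_0 -a0 => O [].
move=> /subset_card_le /(card_le_trans le).
by rewrite card_le0 => /eqP E; have : `I_K 0%N by []; rewrite E.
Qed.

End Family.

(** * Small roots of polynomials dominated by their low coefficients *)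

Section TailRoots.
Variable R : realType.
Implicit Types (p q : {poly R}) (s : seq R) (delta : R).

(** Every product contributing to a coefficient below the leading one contains at least one of the
    small roots. *)
Lemma coef_prod_XsubC_small delta s i : 0 <= delta <= 1 ->
    (forall x, x \in s -> `|x| <= delta) ->
  `|(\prod_(x <- s) ('X - x%:P))`_i| <=
    2 ^+ size s * (if (i < size s)%N then delta else 1).
Proof.
move=> /andP[d0 d1]; elim: s i => [|x s IH] i sd.
  by rewrite big_nil coef1 /= expr0 mul1r; case: (i == 0%N); rewrite ?normr1 ?normr0.
have {}IH j : `|(\prod_(x <- s) ('X - x%:P))`_j| <=
    2 ^+ size s * (if (j < size s)%N then delta else 1).
  by apply: IH => y ys; apply: sd; rewrite inE ys orbT.
have xd : `|x| <= delta by apply: sd; rewrite mem_head.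
set Q := \prod_(_ <- _) _ in IH.
have Q1 j : `|Q`_j| <= 2 ^+ size s.
  apply: le_trans (IH j) _; rewrite -[leRHS]mulr1 ler_pM2l ?exprn_gt0 //.
  by case: ifP.
rewrite big_cons mulrBl coefB mul_polyC coefZ mulrC coefMX /= exprS -mulrA.
apply: le_trans (ler_normB _ _) _; rewrite normrM mulr_natl [leRHS]mulr2n.
have s0 : 0 < 2 ^+ size s :> R by rewrite exprn_gt0.
apply: lerD.
  case: i => [|i] /=; first by rewrite normr0 mulr_ge0 //; exact: ltW.
  by rewrite ltnS; exact: IH.
rewrite mulrC; apply: ler_pM => //.
by case: ifP => // _; exact: le_trans d1.
Qed.

(* If p = (prod (X - x)) * h, the coefficients of p of index less than M are small compared with those of h, while one of index at least M is not. *)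
Lemma small_roots_tail M L C : exists2 delta, 0 < delta & forall p s,
    p != 0 -> (size p <= L)%N ->
    (forall j, (M <= j)%N -> exists2 i, (i < M)%N & `|p`_j| <= C * `|p`_i|) ->
    size s = M -> (forall x, x \in s -> `|x| <= delta) ->
  ~~ (\prod_(x <- s) ('X - x%:P) %| p).
Proof.
pose B : R := L%:R * 2 ^+ M; pose C' := Num.max C 0.
have C'0 : 0 <= C' by rewrite le_max lexx orbT.
have B0 : 0 <= B by rewrite mulr_ge0.
(* Chosen so that (C' + 1) B delta < 1, the inequality contradicted at the end. *)
pose delta := (1 + (C' + 1) * B)^-1 / 2.
have den : 1 <= 1 + (C' + 1) * B by rewrite lerDl mulr_ge0 // addr_ge0.
have den0 : 0 < 1 + (C' + 1) * B by apply: lt_le_trans den.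
have delta0 : 0 < delta by rewrite divr_gt0 // invr_gt0.
have delta1 : delta <= 1.
  rewrite /delta ler_pdivrMr // mul1r (le_trans (_ : _ <= 1)) ?invf_le1 //.
  by rewrite ler1n.
have small : (C' + 1) * (B * delta) < 1.
  rewrite mulrA /delta mulrA ltr_pdivrMr // mul1r mulrC ltr_pdivrMl //.
  by apply: (@lt_trans _ _ (1 + (C' + 1) * B)); rewrite ?ltrDr // mulr2n mulrC; lra.
exists delta => // p s p0 pL tail sM sd; apply/negP => /dvdpP[h ph].
set Q := \prod_(_ <- _) _ in ph.
have h0 : h != 0 by apply: contraNneq p0 => h0; rewrite ph h0 mul0r.
have Qm : Q \is monic by exact: monic_prod_XsubC.
pose q := Q - 'X^M.
have sQ : size Q = M.+1 by rewrite size_prod_XsubC sM.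
have qM i : (M <= i)%N -> q`_i = 0.
  rewrite leq_eqVlt => /orP[/eqP<-|iM]; rewrite /q coefB coefXn.
    by rewrite eqxx; have := monicP Qm; rewrite lead_coefE sQ /= => ->; rewrite subrr.
  by rewrite gtn_eqF // subr0 nth_default // sQ.
have qd i : `|q`_i| <= 2 ^+ M * delta.
  have [iM|/qM->] := ltnP i M; last by rewrite normr0 mulr_ge0 // ltW.
  have := @coef_prod_XsubC_small delta s i; rewrite sM iM -/Q ltW // delta1.
  by move=> /(_ isT sd); rewrite /q coefB coefXn ltn_eqF // subr0.
(* At index i0 + M the term h X^M contributes the largest coefficient m of h, whereas below M only
   the small part q of the product contributes. The tail hypothesis then yields m <= (C' + 1) B
   delta m. *)
have [i0 _ hmax] : exists2 i0, (i0 < size h)%N & forall i, `|h`_i| <= `|h`_i0|.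
  have sh : (0 < size h)%N by rewrite size_poly_gt0.
  pose o := Ordinal sh.
  case: (@arg_maxP _ _ _ o xpredT (fun i : 'I_(size h) => `|h`_i|) isT) => i0 _ im.
  exists i0 => // i; have [ih|hi] := ltnP i (size h); first exact: (im (Ordinal ih)).
  by rewrite (nth_default _ hi) normr0.
have hi0 : 0 < `|h`_i0|.
  rewrite normr_gt0; apply: contraNneq h0 => E; apply/eqP/polyP => i.
  by apply/eqP; rewrite coef0 -normr_eq0 eq_le normr_ge0 andbT (le_trans (hmax i)) // E normr0.
set m := `|h`_i0| in hmax hi0.
have hq j : (j < L)%N -> `|(h * q)`_j| <= B * delta * m.
  move=> jL; rewrite coefM; apply: le_trans (ler_norm_sum _ _ _) _.
  apply: (@le_trans _ _ (\sum_(k < j.+1) (m * (2 ^+ M * delta)))).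
    by apply: ler_sum => k _; rewrite normrM ler_pM.
  rewrite sumr_const card_ord -[_ *+ j.+1]mulr_natl /B.
  rewrite [leRHS](_ : _ = L%:R * (m * (2 ^+ M * delta))); last by ring.
  by rewrite ler_wpM2r ?ler_nat // mulr_ge0 ?ltW // mulr_gt0 // exprn_gt0.
have pE j : p`_j = (h * 'X^M)`_j + (h * q)`_j.
  by rewrite ph -coefD -mulrDr /q addrC subrK.
have plow i : (i < M)%N -> (i < L)%N -> `|p`_i| <= B * delta * m.
  by move=> iM iL; rewrite pE coefMXn iM add0r hq.
have sp : size p = (size h + M)%N.
  by rewrite ph size_Mmonic // sQ addnS.
have i0L : (i0 + M < L)%N.
  apply: leq_trans pL; rewrite sp ltn_add2r ltnNge; apply/negP => hi.
  by move: hi0; rewrite /m nth_default // normr0 ltxx.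
have [i iM le] := tail (i0 + M)%N (leq_addl _ _).
have iL : (i < L)%N by apply: leq_trans i0L; rewrite ltnS (leq_trans (ltnW iM)) // leq_addl.
have hE : h`_i0 = p`_(i0 + M) - (h * q)`_(i0 + M).
  by rewrite pE coefMXn ltnNge leq_addl /= addnK addrK.
have : m <= C' * (B * delta * m) + B * delta * m.
  rewrite /m hE; apply: le_trans (ler_normB _ _) _; rewrite -hE -/m.
  apply: lerD (hq _ i0L); apply: le_trans le _.
  apply: (@le_trans _ _ (C' * `|p`_i|)).
    by rewrite ler_wpM2r // le_max lexx.
  by rewrite ler_wpM2l // plow.
rewrite [leRHS](_ : _ = (C' + 1) * (B * delta) * m); last by ring.
by rewrite -{1}[m]mul1r ler_pM2r // leNgt small.
Qed.

End TailRoots.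

Section CoefContinuity.
Variables (R : realType) (T : topologicalType).

Definition coef_continuous (P : T -> {poly R}) :=
  forall j, continuous (fun x => (P x)`_j : R).

Lemma continuous_bigsum (I : Type) (s : seq I) (f : I -> T -> R) :
  (forall i, continuous (f i)) -> continuous (fun x => \sum_(i <- s) f i x).
Proof.
move=> cf; elim: s => [|i s IH] x.
  by under eq_fun do rewrite big_nil; exact: cvg_cst.
by under eq_fun do rewrite big_cons; apply: cvgD; [exact: cf|exact: IH].
Qed.

Lemma continuous_subf (f g : T -> R) : continuous f -> continuous g ->
  continuous (fun x => f x - g x).
Proof. by move=> cf cg x; apply: cvgB; [exact: cf|exact: cg]. Qed.

Lemma continuous_mulf (f g : T -> R) : continuous f -> continuous g ->
  continuous (fun x => f x * g x).
Proof. by move=> cf cg x; apply: cvgM; [exact: cf|exact: cg]. Qed.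

Lemma continuous_normf (f : T -> R) : continuous f -> continuous (fun x => `|f x|).
Proof. by move=> cf x; apply: cvg_norm; exact: cf. Qed.

Lemma coef_continuousM P Q : coef_continuous P -> coef_continuous Q ->
  coef_continuous (fun x => P x * Q x).
Proof.
move=> cP cQ j; under eq_fun do rewrite coefM -(big_mkord xpredT (fun i => _`_i * _`_(j - i))).
by apply: continuous_bigsum => i x; apply: cvgM; [exact: cP|exact: cQ].
Qed.

Lemma coef_continuousX P n : coef_continuous P -> coef_continuous (fun x => P x ^+ n).
Proof.
move=> cP; elim: n => [|n IH].
  by move=> j x; under eq_fun do rewrite expr0; exact: cvg_cst.
by under eq_fun do rewrite exprS; exact: coef_continuousM.
Qed.

Lemma coef_continuous_comp P Q L : coef_continuous P -> coef_continuous Q ->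
  (forall x, (size (P x) <= L)%N) -> coef_continuous (fun x => P x \Po Q x).
Proof.
move=> cP cQ sP j.
have -> : (fun x => (P x \Po Q x)`_j) =
    (fun x => \sum_(i <- iota 0 L) (P x)`_i * (Q x ^+ i)`_j).
  apply/funext => x; rewrite comp_polyE coef_sum.
  rewrite (eq_bigr (fun i : 'I__ => (P x)`_i * (Q x ^+ i)`_j)); last first.
    by move=> i _; rewrite coefZ.
  rewrite (big_ord_widen _ (fun i => (P x)`_i * (Q x ^+ i)`_j) (sP x)) big_mkcond.
  rewrite (_ : iota 0 L = index_iota 0 L) ?big_mkord /index_iota ?subn0 //; apply: eq_bigr => i _.
  by case: ltnP => // h; rewrite (nth_default _ h) mul0r.
apply: continuous_bigsum => i x; apply: cvgM; first exact: cP.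
exact: coef_continuousX.
Qed.

End CoefContinuity.

Section TailBound.
Variables (R : realType) (d : nat).
Hypothesis d1 : (1 < d)%N.
Implicit Types (a b : 'rV[R]_d.-1).
Local Notation F b := (second_iterate (family_poly b)).

Lemma coef_family_continuous j : continuous (fun b => (F b)`_j : R).
Proof.
have cp : coef_continuous (fun b => family_poly b).
  move=> [|[|i]].
  - have -> : (fun b => (family_poly b)`_0 : R) = cst 0.
      by apply/funext => b; rewrite family_poly0.
    exact: cst_continuous.
  - have -> : (fun b => (family_poly b)`_1 : R) = cst (-1).
      by apply/funext => b; rewrite family_poly1.
    exact: cst_continuous.
  have [id|di] := ltnP i d.-1.
    have -> : (fun b => (family_poly b)`_i.+2 : R) = (fun b => b 0 (Ordinal id)).
      by apply/funext => b; rewrite -coef_family_poly_ord.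
    exact: coord_continuous.
  have -> : (fun b => (family_poly b)`_i.+2 : R) = cst 0.
    by apply/funext => b; rewrite coef_family_poly insubN // -leqNgt.
  exact: cst_continuous.
have -> : (fun b => (F b)`_j : R) =
    (fun b => (family_poly b \Po family_poly b)`_j - ('X : {poly R})`_j).
  by apply/funext => b; rewrite -coefB.
apply: continuous_subf; last exact: cst_continuous.
exact: (coef_continuous_comp cp cp (fun x => size_family_poly x d1)).
Qed.

Lemma size_second_iterate b : (size (F b) <= (d ^ 2).+1)%N.
Proof.
apply: leq_trans (size_polyD _ _) _; rewrite size_polyN size_polyX geq_max.
apply/andP; split; last by rewrite ltnS expn_gt0; lia.
have := size_comp_poly (family_poly b) (family_poly b).
have : ((size (family_poly b)).-1 <= d)%N.
  by have := size_family_poly b d1; case: (size _).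
move: (size (_ \Po _)) (size (family_poly b)).-1 => [//|k] m le /= ->.
by rewrite ltnS leq_sqr.
Qed.

Lemma coef_second_iterate_scale a b (lam : R) j :
  (forall i, b 0 i = lam ^+ i.+1 * a 0 i) ->
  lam * (F b)`_j = lam ^+ j * (F a)`_j.
Proof.
move=> ab.
have E : lam *: family_poly b = family_poly a \Po (lam *: 'X).
  apply/polyP => i; rewrite coefZ coef_comp_scale !coef_family_poly.
  case: i => [|[|i]]; rewrite ?oppr0 ?mulr0 ?mul0r //.
    by rewrite expr1 mulrC.
  by case: insubP => [k _ <-|_]; rewrite ?mulr0 ?mul0r // ab mulrA -exprS mulrC.
suff : lam *: F b = F a \Po (lam *: 'X).
  by move/(congr1 (fun P : {poly R} => P`_j)); rewrite coefZ coef_comp_scale mulrC => ->; rewrite mulrC.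
rewrite /second_iterate scalerBr linearB /= comp_polyX -linearZ /= E.
by rewrite -!comp_polyA -E linearZ /= comp_polyX.
Qed.

(* The weighted rescaling a_j -> lam^(j-1) a_j conjugates the maps and reduces to the sup sphere. *)
Lemma weighted_normalization b (B : R) : b != 0 -> 1 <= B -> (forall i, `|b 0 i| <= B) ->
  exists lam a, [/\ 0 < lam <= B, `|a| = 1 & forall i, b 0 i = lam ^+ i.+1 * a 0 i].
Proof.
move=> b0 B1 bB.
have n0 : (0 < d.-1)%N by rewrite -subn1 subn_gt0.
pose i1 : 'I_d.-1 := Ordinal n0.
(* The largest of these roots is the weighted sup norm of [b]; it is taken as [lam]. *)
pose root_of i := `|b 0 i| `^ (i.+1)%:R^-1.
have rootK i : root_of i ^+ i.+1 = `|b 0 i|.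
  by rewrite /root_of -powR_mulrn ?powR_ge0 // -powRrM mulVf ?powRr1 // pnatr_eq0.
case: (@arg_maxP _ _ _ i1 xpredT root_of isT) => i0 _ im.
set lam := root_of i0 in im.
have lam0 : 0 < lam.
  rewrite lt_neqAle eq_sym powR_ge0 andbT; apply: contraNneq b0 => lam0.
  apply/eqP/rowP => i; rewrite mxE; apply/eqP; rewrite -normr_eq0 -rootK.
  by rewrite expf_eq0 /= eq_le powR_ge0 andbT; have := im i isT; rewrite lam0.
have lamB : lam <= B.
  rewrite leNgt; apply/negP => lt; have := bB i0; rewrite -rootK -/lam => le.
  have lam1 : 1 <= lam by exact: le_trans B1 (ltW lt).
  have : lam <= lam ^+ i0.+1 by rewrite exprS ler_peMr ?exprn_ege1 // ltW.
  by move=> /le_trans /(_ le); rewrite leNgt lt.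
pose a : 'rV[R]_d.-1 := \row_i (b 0 i / lam ^+ i.+1).
exists lam, a; split; first by rewrite lam0.
  rewrite -[`|a|]/(mx_norm a) mx_normrE; apply/eqP; rewrite eq_le; apply/andP; split.
    apply: bigmax_le => //= -[u i] _ /=; rewrite (ord1 u) mxE normrM normfV.
    rewrite (ger0_norm (exprn_ge0 _ (ltW lam0))) ler_pdivrMr ?exprn_gt0 // mul1r.
    by rewrite -rootK lerXn2r ?nnegrE ?powR_ge0 ?(ltW lam0) //; exact: im.
  apply/bigmax_geP; right; exists (0, i0) => //=; rewrite mxE normrM normfV.
  rewrite (ger0_norm (exprn_ge0 _ (ltW lam0))) -rootK -/lam divff //.
  by rewrite expf_neq0 // gt_eqF.
by move=> i; rewrite mxE mulrC divfK // expf_neq0 // gt_eqF.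
Qed.

Lemma second_iterate_tail (B : R) :
    (forall b, (forall j, (j < d.*2)%N -> (F b)`_j = 0) -> b = 0) ->
  exists C, forall b, (forall i, `|b 0 i| <= B) ->
    forall j, (d.*2 <= j)%N -> exists2 i, (i < d.*2)%N & `|(F b)`_j| <= C * `|(F b)`_i|.
Proof.
move=> noinv; set L := (d ^ 2).+1.
pose g (P : pred nat) b : R := \sum_(j <- iota 0 L | P j) `|(F b)`_j|.
have gc P : continuous (g P).
  have -> : g P = (fun b => \sum_(j <- iota 0 L) (if P j then `|(F b)`_j| else 0)).
    by apply/funext => b; rewrite /g big_mkcond.
  apply: continuous_bigsum => j; case: (P j); last exact: cst_continuous.
  apply: continuous_normf; exact: coef_family_continuous.
have term (P : pred nat) b j : P j -> (j < L)%N -> `|(F b)`_j| <= g P b.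
  move=> Pj jL; have jin : j \in iota 0 L by rewrite mem_iota add0n.
  rewrite /g big_mkcond (bigD1_seq j jin (iota_uniq 0 L)) /= Pj.
  by rewrite lerDl sumr_ge0 // => i _; case: ifP.
pose K := [set a : 'rV[R]_d.-1 | `|a| = 1].
have cK : compact K.
  apply: bounded_closed_compact.
    by exists 1; split; [exact: num_real|move=> x x1 a /= ->; exact: ltW].
  have -> : K = (fun a : 'rV[R]_d.-1 => `|a|) @^-1` [set 1 : R] by [].
  by apply: closed_comp; [move=> a _; exact: norm_continuous|exact: closed_eq].
have n0 : (0 < d.-1)%N by rewrite -subn1 subn_gt0.
have K0 : K !=set0.
  have c1 : (const_mx 1 : 'rV[R]_d.-1) != 0.
    apply/eqP => /rowP /(_ (Ordinal n0)); rewrite !mxE => /eqP; by rewrite oner_eq0.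
  exists (`|const_mx 1 : 'rV[R]_d.-1|^-1 *: const_mx 1); rewrite /K /= normrZ normfV normr_id.
  by rewrite mulVf // normr_eq0.
have cw (P : pred nat) : {within K, continuous (g P)}.
  exact: continuous_subspaceT (gc P).
have [c cin cmin] := EVT_min_rV K0 cK (cw (fun j => (j < d.*2)%N)).
have [e ein emax] := EVT_max_rV K0 cK (cw xpredT).
set m := g _ c in cmin; set M := g _ e in emax.
have m0 : 0 < m.
  rewrite lt_neqAle eq_sym sumr_ge0 // andbT; apply/eqP => m0.
  have : c = 0.
    apply: noinv => j jd; have [jL|Lj] := ltnP j L; last first.
      by rewrite nth_default // (leq_trans (size_second_iterate c)).
    apply/eqP; rewrite -normr_eq0 eq_le normr_ge0 andbT.
    by have := term (fun j => (j < d.*2)%N) c j jd jL; rewrite -/m m0.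
  move=> c0; move: cin; rewrite inE /K /= c0 normr0 => /esym/eqP.
  by rewrite oner_eq0.
have M0 : 0 <= M by exact: sumr_ge0.
pose B1 := Num.max 1 B.
have B11 : 1 <= B1 by rewrite le_max lexx.
exists (M * B1 ^+ L * L%:R / m) => b bB j dj.
have d0 : (0 < d.*2)%N by lia.
have [->|b0] := eqVneq b 0.
  by exists 0%N; rewrite // (_ : F 0 = 0) ?coef0 ?normr0 ?mulr0 //
    /second_iterate family_poly_0 linearN /= comp_polyX opprK subrr.
have [jL|Lj] := ltnP j L; last first.
  exists 0%N => //; rewrite (nth_default _ (leq_trans (size_second_iterate b) Lj)).
  have B10 : 0 <= B1 by exact: le_trans ler01 B11.
  by rewrite normr0 mulr_ge0 // divr_ge0 ?(ltW m0) // mulr_ge0 // mulr_ge0 // exprn_ge0.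
have bB1 i : `|b 0 i| <= B1 by rewrite le_max bB orbT.
have [lam [a [/andP[lam0 lamB] a1 ba]]] := weighted_normalization b0 B11 bB1.
have Fa i : lam * `|(F b)`_i| = lam ^+ i * `|(F a)`_i|.
  rewrite -{1}(gtr0_norm lam0) -normrM (coef_second_iterate_scale i ba) normrM.
  by rewrite (ger0_norm (exprn_ge0 _ (ltW lam0))).
have aK : a \in K by rewrite inE.
have [i [id iL le]] : exists i, [/\ (i < d.*2)%N, (i < L)%N & m <= L%:R * `|(F a)`_i|].
  apply: contrapT => noi; have := cmin _ aK; rewrite leNgt => /negP; apply.
  rewrite /g big_mkcond /= (@lt_le_trans _ _ (\sum_(j <- iota 0 L) (m / L%:R))) //; last first.
    by rewrite big_const_seq count_predT size_iota iter_addr_0 -[_ *+ L]mulr_natr divfK // pnatr_eq0.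
  apply: ltr_sum => // i _.
  have mL : 0 < m / L%:R by rewrite divr_gt0 // ltr0n.
  case: ifP => // id; have [iL|Li] := ltnP i L; last first.
    by rewrite (nth_default _ (leq_trans (size_second_iterate a) Li)) normr0.
  rewrite ltr_pdivlMr ?ltr0n // ltNge mulrC; apply/negP => le.
  by apply: noi; exists i; split.
exists i => //.
have ij : (i <= j)%N by exact: leq_trans (ltnW id) dj.
rewrite -(ler_pM2l lam0) Fa mulrCA Fa.
(* As [lam] may be arbitrarily small, only nonnegative powers of it are bounded: this is where it
   matters that the dominating index i is not above j. *)
have lamj : lam ^+ j <= lam ^+ i * B1 ^+ L.
  rewrite -(subnKC ij) exprD ler_pM2l ?exprn_gt0 //.
  apply: (@le_trans _ _ (B1 ^+ (j - i))).
    by rewrite lerXn2r ?nnegrE ?(ltW lam0) // (le_trans ler01).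
  exact: (ler_weXn2l B11 (leq_trans (leq_subr _ _) (ltnW jL))).
have Mj : `|(F a)`_j| <= M by apply: le_trans (emax _ aK); exact: (term xpredT).
apply: (@le_trans _ _ (lam ^+ i * B1 ^+ L * M)).
  by apply: ler_pM => //; rewrite exprn_ge0 // ltW.
rewrite [leLHS](_ : _ = (M * B1 ^+ L) * lam ^+ i * (m / m)); last by rewrite divff ?gt_eqF //; ring.
rewrite [leRHS](_ : _ = (M * B1 ^+ L) * lam ^+ i * ((L%:R * `|(F a)`_i|) / m)); last by ring.
apply: ler_wpM2l; last by rewrite ler_pM2r // invr_gt0.
have B10 : 0 <= B1 by exact: le_trans ler01 B11.
by rewrite mulr_ge0 // ?exprn_ge0 ?(ltW lam0) // mulr_ge0 // exprn_ge0.
Qed.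

End TailBound.

Lemma card_II_dichotomy (T : Type) (A : set T) n : A #<= `I_n \/ `I_n.+1 #<= A.
Proof.
have [/finite_setP[k Ak]|infA] := pselect (finite_set A).
  have := Ak; rewrite card_eq_le => /andP[Ak1 Ak2].
  have [kn|nk] := leqP k n.
    by left; apply: card_le_trans Ak1 _; rewrite card_le_II.
  by right; apply: card_le_trans Ak2; rewrite card_le_II.
right; apply: card_le_trans (_ : [set: nat] #<= A); last exact/infiniteP.
exact: subset_card_le.
Qed.

(** * Local bounds on the number of orbits *)

Section UpperBounds.
Variables (R : realType) (d : nat).
Hypothesis d1 : (1 < d)%N.
Implicit Types (a b : 'rV[R]_d.-1).
Local Notation F b := (second_iterate (family_poly b)).
Local Notation V := [set: 'rV[R]_d.-1].

Lemma disc_coord (eps : R) a b i : disc eps a b -> `|b 0 i - a 0 i| < eps.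
Proof.
apply: le_lt_trans; rewrite -sqrtr_sqr; apply: ler_wsqrtr.
by rewrite (bigD1 i) //= lerDl sumr_ge0 // => j _; rewrite sqr_ge0.
Qed.

Lemma coef1_comp (A : comNzRingType) (p : {poly A}) : p`_0 = 0 ->
  (p \Po p)`_1 = p`_1 ^+ 2.
Proof.
move=> p0; have [s Es s0] := coef0_eq_mulX p0.
have -> : p \Po p = 'X^1 * s * (s \Po p) by rewrite {2}Es comp_polyM comp_polyX {1}Es.
by rewrite coef_Xn_mul coef0_comp // s0.
Qed.

Lemma second_iterate_X3 b : exists G, F b = 'X^3 * G.
Proof.
have p0 := family_poly0 b; have p1 := family_poly1 b.
have pp j : (j < 2)%N -> (family_poly b \Po family_poly b)`_j = 'X`_j.
  case: j => [|[|j]] // _; first by rewrite coef0_comp // p0 coefX.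
  by rewrite coef1_comp // p1 coefX sqrrN expr1n.
have /eqP := coef_comp_even p0 p1 (isT : (1 < 2)%N) isT pp.
rewrite mulrn_eq0 /= => /eqP pp2.
have F0 j : (j < 3)%N -> (F b)`_j = (0 : {poly R})`_j.
  move=> j3; rewrite /second_iterate coefB coef0.
  case: j j3 => [|[|[|j]]] // _; first by rewrite pp // subrr.
    by rewrite pp // subrr.
  by rewrite pp2 coefX subrr.
by have [G FG _] := eq_coef_mulXn F0; exists G; rewrite -FG subr0.
Qed.

(** Besides two roots for each orbit, 0 counts three times because X^3 divides F. *)
Lemma distinct_orbits_dvd b K delta : (0 < K)%N ->
    `I_K #<= isolated_periodic2_orbits_in (family_map b) delta -> 
  exists s : seq R, [/\ size s = K.*2.+3, forall x, x \in s -> `|x| <= `|delta| &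
    \prod_(x <- s) ('X - x%:P) %| F b].
Proof.
move=> K0 le; have [s [us ss sP]] := orbits_roots (family_poly0 b) le.
exists [:: 0, 0, 0 & s]; split; first by rewrite /= ss.
  move=> x; rewrite !inE => /or4P[/eqP->|/eqP->|/eqP->|/sP[_ _ /ltW xd]]; rewrite ?normr0 //.
  exact: le_trans xd (ler_norm _).
have [G FG] := second_iterate_X3 b; rewrite FG !big_cons subr0 !mulrA -!expr2 -exprSr.
rewrite dvdp_mul2l ?polyXn_eq0 //; last by rewrite expf_eq0 polyX_eq0.
apply: uniq_roots_dvdp; last by rewrite uniq_rootsE.
apply/allP => x /sP[+ x0 _]; rewrite FG rootM => /orP[|//].
by rewrite /root hornerXn expf_eq0 /= (negbTE x0).
Qed.

Lemma cyclicity_le_degree a :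
  origin_cyclicity_le V (@family_map R d) a ((d ^ 2 - 1) %/ 2)%N.
Proof.
apply: origin_cyclicity_exists; exists 1, 1; split => // b _.
have [//|le] := card_II_dichotomy (isolated_periodic2_orbits_in (family_map b) 1)
  ((d ^ 2 - 1) %/ 2)%N.
have F0 := orbits_in_neq0 (ltn0Sn _) le.
have [s [ss _ /(dvdp_leq F0)]] := distinct_orbits_dvd (ltn0Sn _) le.
rewrite size_prod_XsubC ss => /leq_trans /(_ (size_second_iterate d1 b)).
by move: (d ^ 2)%N => D; lia.
Qed.

Lemma cyclicity_le_weak_order a :
    (forall b, (forall j, (j < d.*2)%N -> (F b)`_j = 0) -> b = 0) ->
  origin_cyclicity_le V (@family_map R d) a (d - 2)%N.
Proof.
move=> noinv; pose B := 1 + \sum_i `|a 0 i|.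
have [C CP] := second_iterate_tail d1 B noinv.
have [delta d0 deltaP] := small_roots_tail d.*2 (d ^ 2).+1 C.
apply: origin_cyclicity_exists; exists 1, delta; split => // b ab.
have [//|le] := card_II_dichotomy (isolated_periodic2_orbits_in (family_map b) delta)
  (d - 2)%N.
have F0 := orbits_in_neq0 (ltn0Sn _) le.
have [s [ss sd sF]] := distinct_orbits_dvd (ltn0Sn _) le.
have bB i : `|b 0 i| <= B.
  rewrite -(subrK (a 0 i) (b 0 i)); apply: le_trans (ler_normD _ _) _.
  apply: lerD; first exact: ltW (disc_coord i ab).
  by rewrite (bigD1 i) //= lerDl sumr_ge0.
(* One orbit too many means d - 1 of them, hence 2(d - 1) + 3 = 2d + 1 small roots; 2d of these
   already contradict [small_roots_tail]. *)
have st : size (take d.*2 s) = d.*2 by rewrite size_take ss; case: ifP => //; lia.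
have /negP[] := deltaP (F b) (take d.*2 s) F0 (size_second_iterate d1 b) (CP b bB) st
  (fun x xs => le_trans (sd x (mem_take xs)) (eq_ind_r (fun y => y <= delta) (lexx _) (gtr0_norm d0))).
apply: dvdp_trans sF; rewrite -{2}(cat_take_drop d.*2 s) big_cat /=.
exact: dvdp_mulr.
Qed.

Lemma cyclicity_le_small a : (d <= 10)%N ->
  origin_cyclicity_le V (@family_map R d) a (d - 2)%N.
Proof.
move=> d10; have [|u [pure [pairs [chk su]]]] := @obstruction_checks d; first by rewrite d1.
apply: cyclicity_le_weak_order => b Fb; apply: family_poly_eqNX.
apply: (no_formal_involution chk su) => [||| n on /andP[n2 nd]].
- exact: size_family_poly.
- exact: family_poly0.
- exact: family_poly1.
have := Fb n nd; rewrite /second_iterate coefB coefX gtn_eqF ?subr0 //.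
exact: ltnW.
Qed.

End UpperBounds.

(** * Unfolding the trivial involution *)

Lemma finite_lower_bound (R : realType) (f : nat -> R) n : (forall i, (i <= n)%N -> 0 < f i) ->
  exists2 c, 0 < c & forall i, (i <= n)%N -> c <= f i.
Proof.
elim: n => [|n IH] f0; first by exists (f 0%N); [exact: f0|case].
have [|c c0 cP] := IH; first by move=> i /leqW; exact: f0.
exists (Num.min c (f n.+1)); first by rewrite lt_min c0 f0.
move=> i; rewrite leq_eqVlt => /orP[/eqP->|]; first by rewrite ge_min lexx orbT.
by rewrite ltnS ge_min => /cP->.
Qed.

Lemma horner_pos_near0 (R : realType) (q : {poly R}) : 0 < q`_0 ->
  exists2 t0, 0 < t0 & forall t, 0 <= t <= t0 -> 0 < q.[t].
Proof.
move=> q0; have [e e0 eP] := poly_cont 0 q q0.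
exists (e / 2); first by rewrite divr_gt0.
move=> t /andP[t0 te]; have := eP t; rewrite subr0 ger0_norm // horner_coef0.
have -> : t < e by apply: le_lt_trans te _; rewrite ltr_pdivrMr // ltr_pMr // ltr1n.
by move=> /(_ isT); rewrite ltr_norml => /andP[+ _]; rewrite ltrBrDr addNr.
Qed.

Section Unfolding.
Variables (R : realType) (d : nat).
Hypothesis d1 : (1 < d)%N.
Implicit Types (a b : 'rV[R]_d.-1).
Local Notation F b := (second_iterate (family_poly b)).

Lemma coord_disc a (eps : R) : 0 < eps -> exists2 eta, 0 < eta &
  forall b, (forall i, `|b 0 i - a 0 i| <= eta) -> disc eps a b.
Proof.
move=> e0; exists (eps / d.+1%:R); first by rewrite divr_gt0.
move=> b ba; rewrite /disc /=; set eta := eps / _ in ba *.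
have eta0 : 0 < eta by rewrite divr_gt0.
apply: (@le_lt_trans _ _ (Num.sqrt ((d%:R * eta) ^+ 2))).
  apply: ler_wsqrtr; apply: (@le_trans _ _ (\sum_(i < d.-1) eta ^+ 2)).
    apply: ler_sum => i _; rewrite -[leLHS]ger0_norm ?sqr_ge0 // normrX.
    by rewrite lerXn2r ?nnegrE // ltW.
  rewrite sumr_const card_ord -[_ *+ d.-1]mulr_natl [(d%:R * eta) ^+ 2]exprMn.
  rewrite ler_pM2r ?exprn_gt0 //.
  rewrite -natrX ler_nat; nia.
have de0 : 0 <= d%:R * eta by rewrite mulr_ge0 // ltW.
rewrite sqrtr_sqr ger0_norm // /eta mulrCA gtr_pMr // ltr_pdivrMr // mul1r.
by rewrite ltr_nat.
Qed.

Lemma family_map_negative (B delta : R) : 0 < delta -> exists2 delta', 0 < delta' <= delta &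
  forall b, (forall i, `|b 0 i| <= B) -> forall x, 0 < x < delta' ->
    - delta < (family_poly b).[x] < 0.
Proof.
move=> dp; pose M := d%:R * `|B| + 1.
have M0 : 0 < M by rewrite ltr_wpDl ?mulr_ge0.
exists (Num.min (Num.min 1 (delta / 2)) (M^-1 / 2)).
  rewrite !lt_min !divr_gt0 ?invr_gt0 // ltr01 /= !ge_min; apply/orP; left; apply/orP; right.
  by rewrite ler_pdivrMr // ler_peMr ?ler1n // ltW.
move=> b bB x /andP[x0]; rewrite !lt_min => /andP[/andP[x1 xd] xM].
have pE : (family_poly b).[x] = - x + \sum_(i < d.-1) b 0 i * x ^+ i.+2.
  rewrite /family_poly hornerD hornerN hornerX horner_sum; congr (_ + _).
  by apply: eq_bigr => i _; rewrite hornerZ hornerXn.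
have sB : `|\sum_(i < d.-1) b 0 i * x ^+ i.+2| <= x / 2.
  apply: le_trans (ler_norm_sum _ _ _) _.
  apply: (@le_trans _ _ (\sum_(i < d.-1) `|B| * (x * x))).
    apply: ler_sum => i _; rewrite normrM; apply: ler_pM => //.
      exact: le_trans (bB i) (ler_norm _).
    rewrite normrX gtr0_norm // exprS exprS mulrA.
    by apply: ler_piMr; [rewrite mulr_ge0 // ltW | rewrite exprn_ile1 // ltW].
  rewrite sumr_const card_ord -[_ *+ d.-1]mulr_natl mulrA.
  apply: (@le_trans _ _ (M * (x * x))).
    rewrite ler_pM2r ?mulr_gt0 // /M (@le_trans _ _ (d%:R * `|B|)) ?lerDl //.
    by rewrite ler_wpM2r // ler_nat leq_pred.
  rewrite mulrCA ler_pM2l // mulrC -ler_pdivlMr //.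
  by rewrite mulrC ltW.
move: sB; rewrite pE ler_norml => /andP[l r].
by apply/andP; split; lra.
Qed.

Lemma unfolds_alternating a n :
    (forall eps delta : R, 0 < eps -> 0 < delta -> exists2 b, disc eps a b &
       exists s xi, alternating (F b) n s xi delta) ->
  unfolds (@family_map R d) a n.
Proof.
move=> alt eps delta ep dp; pose B := 1 + \sum_i `|a 0 i|.
have [delta' /andP[d'0 d'd] neg] := family_map_negative B dp.
have [||b ab [s [xi bxi]]] := alt (Num.min eps 1) delta'.
- by rewrite lt_min ep ltr01.
- by [].
exists b; first by apply: sub_disc ab; rewrite ge_min lexx.
apply: (alternating_orbits (family_poly0 b) d'd) bxi; apply: neg => i.
have ab1 : disc 1 a b by apply: sub_disc ab; rewrite ge_min lexx orbT.
rewrite -(subrK (a 0 i) (b 0 i)); apply: le_trans (ler_normD _ _) _.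
apply: lerD; first exact: ltW (disc_coord i ab1).
by rewrite (bigD1 i) //= lerDl sumr_ge0.
Qed.

End Unfolding.

Section EvenUnfolding.
Variables (R : realType).

Definition comb_poly m (r : R) : {poly R} :=
  'X^2 * \prod_(i < m) ('X^2 - ((i.+1%:R * r) ^+ 2)%:P).

Lemma size_comb_poly m r : size (comb_poly m r) = m.*2.+3.
Proof.
rewrite /comb_poly size_monicM ?monicXn //; last first.
  by apply/monic_neq0/monic_prod => i _; exact: monicXnsubC.
rewrite size_polyXn size_prod; last by move=> i _; rewrite monic_neq0 // monicXnsubC.
under eq_bigr do rewrite size_XnsubC //.
by rewrite sum_nat_const card_ord; lia.
Qed.

Lemma horner_comb_poly m r x :
  (comb_poly m r).[x] = x ^+ 2 * \prod_(i < m) (x ^+ 2 - (i.+1%:R * r) ^+ 2).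
Proof.
rewrite /comb_poly hornerM hornerXn horner_prod; congr (_ * _).
by apply: eq_bigr => i _; rewrite hornerD hornerN hornerXn hornerC.
Qed.

Lemma comb_poly_even m r x : (comb_poly m r).[- x] = (comb_poly m r).[x].
Proof. by rewrite !horner_comb_poly sqrrN. Qed.

Lemma deriv_comb_poly_odd m r x :
  (comb_poly m r)^`().[- x] = - (comb_poly m r)^`().[x].
Proof.
pose h : {poly R} := 'X * \prod_(i < m) ('X - ((i.+1%:R * r) ^+ 2)%:P).
have -> : comb_poly m r = h \Po 'X^2.
  rewrite /h comp_polyM comp_polyX rmorph_prod; congr (_ * _).
  by apply: eq_bigr => i _; rewrite /= rmorphB /= comp_polyX comp_polyC.
rewrite deriv_comp derivXn expr1 !hornerM !horner_comp !hornerXn sqrrN !hornerMn.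
by rewrite !hornerX mulNrn mulrN.
Qed.

Lemma comb_poly_eq0 m r x : 0 < r -> 0 <= x ->
  ((comb_poly m r).[x] == 0) = [exists i : 'I_m.+1, x == i%:R * r].
Proof.
move=> r0 x0; rewrite horner_comb_poly mulf_eq0 expf_eq0 /=.
apply/orP/existsP => [[/eqP->|/prodf_eq0[i _]]|[[[|i] im] /= /eqP->]].
- by exists ord0; rewrite mul0r.
- rewrite subr_eq0 => E.
  exists (lift ord0 i); rewrite lift0 -(eqrXn2 (isT : (0 < 2)%N)) //.
  by rewrite mulr_ge0 // ltW.
- by left; rewrite mul0r.
- right; apply/prodf_eq0; exists (Ordinal (im : (i < m)%N)) => //=.
  by rewrite subrr.
Qed.

(* Between consecutive zeros of e the derivative of e^2 takes positive values. *)
Lemma comb_poly_square_increasing m r i : 0 < r -> (i <= m)%N ->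
  exists2 mu, i%:R * r < mu < i.+1%:R * r &
    0 < (comb_poly m r).[mu] * (comb_poly m r)^`().[mu].
Proof.
move=> r0 im; set e := comb_poly m r.
pose mid := (i%:R + 2^-1) * r.
have lt1 : i%:R * r < mid by rewrite ltr_pM2r // ltrDl invr_gt0.
have lt2 : mid < i.+1%:R * r.
  by rewrite ltr_pM2r // -[i.+1%:R]natr1 ltrD2l invf_lt1 // ltr1n.
have ei : e.[i%:R * r] = 0.
  apply/eqP; rewrite comb_poly_eq0 // ?mulr_ge0 ?(ltW r0) //.
  by apply/existsP; exists (Ordinal (im : (i < m.+1)%N)).
have emid : e.[mid] != 0.
  rewrite comb_poly_eq0 // ?mulr_ge0 ?addr_ge0 ?(ltW r0) ?invr_ge0 //.
  apply/negP => /existsP[k /eqP]; rewrite /mid => /(mulIf (lt0r_neq0 r0)) E.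
  have : (i.*2.+1)%:R = (k.*2)%:R :> R.
    by rewrite -[i.*2.+1%:R]natr1 -!muln2 !natrM -E mulrDl mulVf.
  by move/eqP; rewrite eqr_nat => /eqP; lia.
(* The square of e rises from 0 at a zero of e to a positive value at the midpoint, so its
   derivative 2 e e' is positive somewhere between. *)
have [c cin cE] := mvt (e ^+ 2) lt1.
move: cin; rewrite in_itv /= => /andP[lc rc].
exists c; first by rewrite lc (lt_trans rc).
have : 0 < (e ^+ 2)^`().[c] * (mid - i%:R * r).
  by rewrite -cE !horner_exp ei expr0n subr0 exprn_even_gt0.
rewrite pmulr_lgt0 ?subr_gt0 // expr2 derivM hornerD !hornerM.
by rewrite mulrC -mulr2n pmulrn_lgt0.
Qed.

Variable d : nat.
Hypothesis d1 : (1 < d)%N.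
Local Notation F b := (second_iterate (family_poly b)).

Definition scaled_comb m r c t : {poly R} :=
  - 'X + t *: comb_poly m r - (t ^+ 2 * c) *: 'X^3.

Definition scaled_comb_row m r c t : 'rV[R]_d.-1 :=
  \row_i (t * (comb_poly m r)`_i.+2 - t ^+ 2 * c * (i.+2 == 3)%:R).

Lemma family_scaled_comb m r c t : (0 < m)%N -> (m.*2.+2 <= d)%N ->
  family_poly (scaled_comb_row m r c t) = scaled_comb m r c t.
Proof.
move=> m0 md; apply/esym/family_poly_inj.
- move=> j; rewrite mxE /scaled_comb !(coefD, coefN, coefZ) coefX coefXn /=.
  by rewrite oppr0 add0r.
- rewrite /scaled_comb !(coefD, coefN, coefZ) coefX coefXn /comb_poly coefXnM /=.
  by rewrite !mulr0 oppr0 !addr0.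
- rewrite /scaled_comb !(coefD, coefN, coefZ) coefX coefXn /comb_poly coefXnM /=.
  by rewrite !mulr0 oppr0 !addr0.
rewrite /scaled_comb; apply: leq_trans (size_polyD _ _) _.
rewrite geq_max size_polyN; apply/andP; split.
  apply: leq_trans (size_polyD _ _) _; rewrite geq_max size_polyN size_polyX.
  apply/andP; split; first by lia.
  by apply: leq_trans (size_scale_leq _ _) _; rewrite size_comb_poly; lia.
by apply: leq_trans (size_scale_leq _ _) _; rewrite size_polyXn; lia.
Qed.

(** For fixed x, F(x) is a polynomial in t. Evenness of e gives e(-x) = e(x), which kills the order
    t; at order t^2 the derivative of e(f(x)) is e'(-x) e(x) = -e e', and the cubic terms of the two
    iterations add up. *)
Lemma second_iterate_scaled_comb m r c x : exists2 q : {poly R},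
    q`_0 = 2 * c * x ^+ 3 - (comb_poly m r).[x] * (comb_poly m r)^`().[x] &
    forall t, (second_iterate (scaled_comb m r c t)).[x] = t ^+ 2 * q.[t].
Proof.
set e := comb_poly m r.
have hE t y : (scaled_comb m r c t).[y] = - y + t * e.[y] - t ^+ 2 * c * y ^+ 3.
  by rewrite /scaled_comb !(hornerD, hornerN, hornerZ, hornerXn, hornerX).
have [Y [YE Y0 Y1]] : exists Y : {poly R},
    [/\ forall t, Y.[t] = - x + t * e.[x] - t ^+ 2 * c * x ^+ 3, Y`_0 = - x & Y`_1 = e.[x]].
  exists (- x%:P + e.[x] *: 'X - (c * x ^+ 3) *: 'X^2); split => [t||].
  - by rewrite !(hornerD, hornerN, hornerZ, hornerXn, hornerX, hornerC); ring.
  - by rewrite !(coefD, coefN, coefZ) coefC coefX coefXn /= !mulr0 oppr0 !addr0.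
  - by rewrite !(coefD, coefN, coefZ) coefC coefX coefXn /= mulr1 mulr0 !oppr0 add0r addr0.
pose S := 'X * ((e \Po Y) - (e.[x])%:P) + 'X^2 * (c *: (x ^+ 3)%:P - c *: Y ^+ 3).
have SE t : (second_iterate (scaled_comb m r c t)).[x] = S.[t].
  rewrite /second_iterate hornerD hornerN hornerX horner_comp [_.[x]]hE -YE hE.
  rewrite /S hornerD [('X * _).[t]]hornerM [('X^2 * _).[t]]hornerM hornerXn hornerX !hornerD !hornerN !hornerZ !hornerC.
  rewrite horner_comp horner_exp.
  move: e.[Y.[t]] (Y.[t] ^+ 3) => E Z; rewrite YE; ring.
have eY0 : (e \Po Y)`_0 = e.[x] by rewrite -horner_coef0 horner_comp horner_coef0 Y0 comb_poly_even.
have eY1 : (e \Po Y)`_1 = - (e.[x] * e^`().[x]).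
  have := congr1 (fun P : {poly R} => P`_0) (deriv_comp e Y).
  rewrite /= coef_deriv mulr1n => ->.
  rewrite -horner_coef0 hornerM horner_comp [Y.[0]]horner_coef0 Y0 deriv_comb_poly_odd.
  by rewrite horner_coef0 coef_deriv mulr1n Y1; ring.
have S0 : forall j, (j < 2)%N -> S`_j = (0 : {poly R})`_j.
  move=> [|[|j]] // _; rewrite /S coefD coefXM coefXnM coef0 /= ?addr0 //.
  by rewrite coefB eY0 coefC subrr.
have [q Sq q0] := eq_coef_mulXn S0.
exists q; last by move=> t; rewrite SE -[S]subr0 Sq hornerM hornerXn.
rewrite q0 coef0 subr0 /S coefD coefXM coefXnM /= coefB eY1 coefC subr0.
rewrite coefB !coefZ coefC /= -[(Y ^+ 3)`_0]horner_coef0 horner_exp horner_coef0 Y0.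
ring.
Qed.

End EvenUnfolding.

Section UnfoldOrigin.
Variables (R : realType) (d : nat).
Hypothesis d1 : (1 < d)%N.

(** An even comb of degree 2m + 2 <= d has m positive zeros, each worth two sign changes. This gives
    d - 2 for even d and only d - 3 for odd d. *)
Lemma unfolds_origin : unfolds (@family_map R d) 0 (d./2.-1).*2.
Proof.
set m := d./2.-1; have md : (m.*2.+2 <= d)%N.
  by rewrite /m; move: d1; lia.
have [->|m0] := posnP m.
  move=> eps delta ep dp; exists 0; first exact: disc_self.
  by rewrite double0 II0; exact: card_ge0.
apply: unfolds_alternating => // eps delta ep dp.
(* All samples will lie below (m + 1) r = delta. *)
pose r := delta / m.+1%:R; have r0 : 0 < r by rewrite divr_gt0.
set e := comb_poly m r.
have muex i : exists mu, (i <= m)%N -> i%:R * r < mu < i.+1%:R * r /\ 0 < e.[mu] * e^`().[mu].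
  have [im|//] := leqP i m; last by exists 0.
  by have [mu h1 h2] := comb_poly_square_increasing r0 im; exists mu.
have [mu muP] := choice muex.
have mu0 i : (i <= m)%N -> 0 < mu i.
  by move=> /muP[/andP[lt _] _]; apply: le_lt_trans lt; rewrite mulr_ge0 // ltW.
(* Then 2 c x^3 is at most half of e e' at each [mu i], where the term of order t^2 is negative; at
   the zeros of e only 2 c x^3 > 0 remains. *)
have [c c0 cP] : exists2 c, 0 < c & forall i, (i <= m)%N ->
    c <= e.[mu i] * e^`().[mu i] / (4 * mu i ^+ 3).
  apply: finite_lower_bound => i im; have [_ h] := muP i im.
  by rewrite divr_gt0 // mulr_gt0 // exprn_gt0 // mu0.
(* The 2m + 1 samples are mu_0, r, mu_1, 2 r, ..., m r, mu_m. *)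
pose xi j := if odd j then (j./2.+1)%:R * r else mu j./2.
have half_le j : (j <= m.*2)%N -> (j./2 <= m)%N.
  by move=> jm; rewrite -(doubleK m); exact: half_leq.
have xi0 j : (j <= m.*2)%N -> 0 < xi j.
  by move=> /half_le jm; rewrite /xi; case: (odd j); [rewrite mulr_gt0|exact: mu0].
have qex j : exists q : {poly R}, [/\ (j <= m.*2)%N -> 0 < -1 * (-1) ^+ j * q`_0 &
    forall t, (second_iterate (scaled_comb m r c t)).[xi j] = t ^+ 2 * q.[t]].
  have [q q0 qP] := second_iterate_scaled_comb m r c (xi j).
  exists q; split=> // jm; rewrite q0 -/e /xi -signr_odd; case: (boolP (odd j)) => oj.
    have jm' : (j./2 < m)%N.
      by have := odd_double_half j; rewrite oj; move: jm; lia.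
    have -> : e.[j./2.+1%:R * r] = 0.
      apply/eqP; rewrite comb_poly_eq0 //; last exact: mulr_ge0 (ler0n _ _) (ltW r0).
      by apply/existsP; exists (Ordinal (jm' : (j./2.+1 < m.+1)%N)).
    rewrite mul0r subr0 expr1 mulN1r opprK mul1r.
    by rewrite !mulr_gt0 // exprn_gt0 // mulr_gt0.
  have jm' := half_le j jm; have := cP _ jm'; have [_ h] := muP _ jm'.
  have mu3 : 0 < mu j./2 ^+ 3 by rewrite exprn_gt0 // mu0.
  have den : 0 < 4 * mu j./2 ^+ 3 by rewrite mulr_gt0.
  rewrite (ler_pdivlMr _ _ den) [_ ^+ false]expr0 mulr1 mulN1r opprB subr_gt0 => le.
  apply: lt_le_trans le; rewrite [c * (4 * _)]mulrA ltr_pM2r //; lra.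
have [q qP] := choice qex.
have tex j : exists t, 0 < t /\ ((j <= m.*2)%N -> forall t', 0 <= t' <= t ->
    0 < -1 * (-1) ^+ j * (q j).[t']).
  have [jm|_] := leqP j m.*2; last by exists 1; split.
  have [q0 _] := qP j; have {}q0 := q0 jm.
  have [|t t0 tP] := @horner_pos_near0 R ((-1 * (-1) ^+ j) *: q j); first by rewrite coefZ.
  by exists t; split => // _ t' /tP; rewrite hornerZ.
have [tj tjP] := choice tex.
have [t1 t10 t1P] : exists2 t1, 0 < t1 & forall j, (j <= m.*2)%N -> t1 <= tj j.
  by apply: finite_lower_bound => j _; have [] := tjP j.
have [eta eta0 etaP] := coord_disc d1 (0 : 'rV[R]_d.-1) ep.
pose M := 1 + \sum_(i < d.-1) (`|e`_i.+2| + c).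
have M0 : 0 < M by rewrite ltr_wpDr // sumr_ge0 // => i _; rewrite addr_ge0 // ltW.
pose t := Num.min (Num.min t1 1) (eta / M).
have t0 : 0 < t by rewrite !lt_min t10 ltr01 divr_gt0.
have tt1 : t <= t1 by rewrite !ge_min lexx.
have tle1 : t <= 1 by rewrite !ge_min lexx orbT.
have teta : t * M <= eta by rewrite -ler_pdivlMr // !ge_min lexx orbT.
exists (scaled_comb_row d m r c t).
  apply: etaP => i; rewrite !mxE subr0 -/e; apply: le_trans teta.
  apply: le_trans (ler_normB _ _) _; rewrite normrM (gtr0_norm t0).
  apply: (@le_trans _ _ (t * (`|e`_i.+2| + c))).
    rewrite mulrDr lerD2l normrM normr_nat normrM normrX (gtr0_norm t0) (gtr0_norm c0).
    apply: (@le_trans _ _ (t ^+ 2 * c)).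
      by rewrite ler_piMr ?mulr_ge0 ?exprn_ge0 ?(ltW t0) ?(ltW c0) //; case: (_ == _).
    by rewrite ler_pM2r // expr2 ler_piMr // ltW.
  rewrite ler_pM2l // /M (bigD1 i) //= addrCA lerDl addr_ge0 // sumr_ge0 // => k _.
  by rewrite addr_ge0 // ltW.
exists (-1), xi; rewrite family_scaled_comb //; split.
- exact: xi0.
- rewrite /xi odd_double doubleK; have [/andP[_ lt] _] := muP m (leqnn m).
  by rewrite (lt_le_trans lt) // /r mulrC divfK // pnatr_eq0.
- move=> j jm; have [jm1 jm2] := (half_le j (ltnW jm), half_le j.+1 jm).
  rewrite /xi /=; case: (boolP (odd j)) => oj /=.
    have E : (uphalf j = j./2.+1)%N by rewrite uphalf_half oj.
    by rewrite E; have [/andP[+ _] _] := muP (j./2.+1) (leq_trans (eq_leq (esym E)) jm2).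
  have E : (uphalf j = j./2)%N by rewrite uphalf_half (negbTE oj).
  by rewrite E; have [/andP[_ +] _] := muP _ jm1.
- move=> j jm; have [_ ->] := qP j; rewrite mulrCA mulr_gt0 ?exprn_gt0 //.
  have [_ ->] := tjP j => //; rewrite ltW //=; exact: le_trans tt1 (t1P j jm).
Qed.

End UnfoldOrigin.

(** * Unfoldings in odd degree *)

Section Chain.
Variables (R : realType) (d : nat).
Hypothesis d1 : (1 < d)%N.
Implicit Types (a b : 'rV[R]_d.-1) (s eps delta : R).
Local Notation F b := (second_iterate (family_poly b)).

Definition close eps a b := forall i, `|b 0 i - a 0 i| < eps.

Lemma close_trans eps eps' a b c : close eps a b -> close eps' b c ->
  close (eps + eps') a c.
Proof.
move=> ab bc i; have -> : c 0 i - a 0 i = (b 0 i - a 0 i) + (c 0 i - b 0 i) by ring.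
by apply: le_lt_trans (ler_normD _ _) _; apply: ltrD.
Qed.

Definition leading b k s := (forall j, (j < k.*2.+1)%N -> (F b)`_j = 0) /\
  0 < s * (F b)`_(k.*2.+1).

(** Even coefficients need no separate check: once all lower ones vanish, [coef_comp_even] kills the
    next even one. *)
Lemma leading_odd b k s :
    (forall i, (0 < i < k)%N -> (F b)`_i.*2.+1 = 0) -> 0 < s * (F b)`_(k.*2.+1) ->
  leading b k s.
Proof.
move=> odd0 sk; split=> // j; have [n] := ubnP j; elim: n j => // n IH j jn jk.
have [G FG] := second_iterate_X3 b.
have [j3|j3] := ltnP j 3.
  by rewrite FG mulrC coefMXn j3.
have p0 := family_poly0 b; have p1 := family_poly1 b.
case: (boolP (odd j)) => oj.
  have -> : j = (j./2).*2.+1 by rewrite -[LHS]odd_double_half oj.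
  by apply: odd0; lia.
have pp i : (i < j)%N -> (family_poly b \Po family_poly b)`_i = 'X`_i.
  move=> ij; apply/eqP; rewrite -subr_eq0 -coefB; apply/eqP.
  by apply: IH; [exact: leq_trans ij _|exact: ltn_trans jk].
have /eqP := coef_comp_even p0 p1 (ltnW j3) oj pp.
by rewrite mulrn_eq0 /= /second_iterate coefB coefX gtn_eqF ?(ltnW j3) // subr0 => /eqP.
Qed.

Lemma leading_sample b k s delta : 0 < delta -> leading b k s ->
  exists2 x, 0 < x < delta & 0 < s * (F b).[x].
Proof.
move=> dp [F0 Fk].
have F0' j : (j < k.*2.+1)%N -> (F b)`_j = (0 : {poly R})`_j.
  by move=> /F0 ->; rewrite coef0.
have [G FG G0] := eq_coef_mulXn F0'; rewrite coef0 !subr0 in FG G0.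
have [|t t0 tP] := @horner_pos_near0 R (s *: G); first by rewrite coefZ G0.
exists (Num.min t (delta / 2)).
  rewrite lt_min t0 divr_gt0 //= gt_min; apply/orP; right.
  by rewrite ltr_pdivrMr // ltr_pMr // ltr1n.
set x := Num.min _ _; have x0 : 0 < x by rewrite lt_min t0 divr_gt0.
rewrite FG hornerM hornerXn mulrCA mulr_gt0 ?exprn_gt0 //.
by rewrite -hornerZ tP // ltW // ge_min lexx.
Qed.

Lemma positive_open (g : 'rV[R]_d.-1 -> R) b : continuous g -> 0 < g b ->
  exists2 eps, 0 < eps & forall b', close eps b b' -> 0 < g b'.
Proof.
move=> cg gb.
have op : open [set x : R | 0 < x] by exact: open_gt.
have /cg /nbhs_ballP[e /= e0 eP] : nbhs (g b) [set x : R | 0 < x].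
  exact: open_nbhs_nbhs.
exists e => // b' bb'; apply: eP; split => // i j.
by rewrite (ord1 i) -ball_normE /ball_ /= distrC; exact: bb'.
Qed.

Lemma horner_second_iterate_continuous x : continuous (fun b => (F b).[x]).
Proof.
have -> : (fun b => (F b).[x]) =
    (fun b => \sum_(j <- iota 0 (d ^ 2).+1) (F b)`_j * x ^+ j).
  apply/funext => b; rewrite (horner_coef_wide _ (size_second_iterate d1 b)).
  by rewrite -(big_mkord xpredT (fun j => (F b)`_j * x ^+ j)) /index_iota subn0.
apply: continuous_bigsum => j; apply: continuous_mulf; last exact: cst_continuous.
exact: coef_family_continuous.
Qed.

Lemma alternating_open b n s xi delta : alternating (F b) n s xi delta ->
  exists2 eps, 0 < eps & forall b', close eps b b' ->
    alternating (F b') n s xi delta.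
Proof.
move=> [xi0 xin lt sg].
have ex i : exists eps, 0 < eps /\ ((i <= n)%N ->
    forall b', close eps b b' -> 0 < s * (-1) ^+ i * (F b').[xi i]).
  have [iN|] := leqP i n; last by exists 1.
  have [|eps e0 eP] := @positive_open (fun b => s * (-1) ^+ i * (F b).[xi i]) b _ (sg i iN).
    apply: continuous_mulf; first exact: cst_continuous.
    exact: horner_second_iterate_continuous.
  by exists eps.
have [e eP] := choice ex.
have [e0 e00 e0P] : exists2 c, 0 < c & forall i, (i <= n)%N -> c <= e i.
  by apply: finite_lower_bound => i _; have [] := eP i.
exists e0 => // b' bb'; split => // i iN; have [_] := eP i; apply => // j.
exact: lt_le_trans (bb' j) (e0P i iN).
Qed.

(* One more sign change appears when a new leading coefficient of opposite sign is switched on. *)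
Lemma alternating_step (T : set 'rV[R]_d.-1) b n k s xi delta :
    alternating (F b) n s xi delta ->
    (forall eps, 0 < eps -> exists b', [/\ close eps b b', leading b' k (- s) & T b']) ->
  forall eps, 0 < eps -> exists b' xi', [/\ close eps b b', leading b' k (- s), T b' &
    alternating (F b') n.+1 (- s) xi' delta].
Proof.
move=> alt mv eps ep; have [e0 e00 e0P] := alternating_open alt.
have [|b' [bb' lead Tb']] := mv (Num.min eps e0); first by rewrite lt_min ep.
have [xi0 xin lt sg] : alternating (F b') n s xi delta.
  by apply: e0P => i; apply: lt_le_trans (bb' i) _; rewrite ge_min lexx orbT.
have [x /andP[x0 xd] sx] := leading_sample xi0 lead.
exists b', (fun i => if i is j.+1 then xi j else x); split => //.
  by move=> i; apply: lt_le_trans (bb' i) _; rewrite ge_min lexx.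
split => //.
- by case=> [|i] // iN; exact: lt.
- case=> [|i] iN; first by rewrite expr0 mulr1.
  by rewrite exprS mulN1r mulrNN; exact: sg.
Qed.

Lemma coef_second_iterate_perturb a b n : (1 < n)%N ->
    (forall i : 'I_d.-1, (i.+2 < n)%N -> b 0 i = a 0 i) ->
  (forall j, (j < n)%N -> (F b)`_j = (F a)`_j) /\
  (F b)`_n = (F a)`_n + ((family_poly b)`_n - (family_poly a)`_n) * ((-1) ^+ n - 1).
Proof.
move=> n1 ab.
have pab j : (j < n)%N -> (family_poly b)`_j = (family_poly a)`_j.
  rewrite !coef_family_poly; case: j => [|[|j]] //.
  by case: insubP => // i _ <- jn; exact: ab.
have p0 := family_poly0 a; have p1 := family_poly1 a.
split.
  move=> j jn; rewrite /second_iterate !coefB; congr (_ - _).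
  case: j jn => [|[|j]] jn.
  - by rewrite !coef0_comp ?family_poly0.
  - by rewrite !coef1_comp ?family_poly0 // !family_poly1.
  rewrite (coef_comp_perturb p0 p1 (isT : (1 < j.+2)%N)) => [|i ij].
    by rewrite pab // subrr mul0r addr0.
  by apply: pab; exact: ltn_trans ij jn.
by rewrite /second_iterate !coefB (coef_comp_perturb p0 p1 n1 pab) addrAC.
Qed.

Lemma alternating_descent k b n s xi delta : (k.*2 < d)%N ->
    leading b k.+1 s -> `|s| = 1 -> alternating (F b) n s xi delta ->
  forall eps, 0 < eps -> exists b' s' xi', close eps b b' /\
    alternating (F b') (n + k) s' xi' delta.
Proof.
elim: k b n s xi => [|k IH] b n s xi kd lead s1 alt eps ep.
  exists b, s, xi; split; last by rewrite addn0.
  by move=> i; rewrite subrr normr0.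
have kd' : (k.*2.+1 < d.-1)%N by rewrite doubleS in kd; lia.
pose i0 : 'I_d.-1 := Ordinal kd'.
have mv e : 0 < e -> exists b', [/\ close e b b', leading b' k.+1 (- s) & setT b'].
  (* Adding eta to an odd coefficient changes the coefficient of F of the same degree by -2 eta and
     no lower one; eta has the sign of s in order to produce -s. *)
  move=> e0; pose eta := s * (e / 2).
  have ne : `|eta| = e / 2 by rewrite normrM s1 mul1r gtr0_norm // divr_gt0.
  pose b' := \row_i (b 0 i + (if i == i0 then eta else 0)).
  have [||low hi] := @coef_second_iterate_perturb b b' k.*2.+3.
  - by [].
  - move=> i ilt; rewrite mxE; case: eqP => [E|_]; last by rewrite addr0.
    by move: ilt; rewrite E /= ltnn.
  have [F0 Fk] := lead.
  exists b'; split => //.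
    move=> i; rewrite mxE addrAC subrr add0r; case: eqP => _; last by rewrite normr0.
    by rewrite ne ltr_pdivrMr // ltr_pMr // ltr1n.
  split => [j jk|]; first by rewrite low // F0 // doubleS; exact: ltn_trans jk _.
  rewrite doubleS hi F0 // add0r.
  have -> : (family_poly b')`_k.*2.+3 - (family_poly b)`_k.*2.+3 = eta.
    rewrite -[k.*2.+3]/((i0 : nat).+2) !coef_family_poly_ord mxE eqxx.
    by rewrite addrAC subrr add0r.
  rewrite -signr_odd /= odd_double expr1 -opprD mulrN mulrNN /eta.
  have s2 : s * s = 1 by rewrite -expr2 -real_normK ?num_real // s1 expr1n.
  have -> : s * (s * (e / 2) * (1 + 1)) = s * s * e by field.
  by rewrite s2 mul1r.
have [|b1 [xi1 [bb1 lead1 _ alt1]]] := alternating_step alt mv (eps := eps / 2).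
  by rewrite divr_gt0.
have [|||b2 [s2 [xi2 [b12 alt2]]]] := IH b1 n.+1 (- s) xi1 _ lead1 _ alt1 (eps / 2) _.
- by rewrite doubleS in kd; lia.
- by rewrite normrN.
- by rewrite divr_gt0.
exists b2, s2, xi2; split; last by rewrite addnS -addSn.
by rewrite [eps]splitr; exact: close_trans bb1 b12.
Qed.

End Chain.

(** * Exact substitution and sign certificates on boxes *)

Definition sym_const (r : nat) (c : Z) : sym := [:: (nseq r 0%N, c)].
Definition sym_mul (f g : sym) : sym := sym_muladd 0 f g [::].
Definition sym_pow (r : nat) (f : sym) (n : nat) : sym :=
  iter n (sym_mul f) (sym_const r 1).

(* [sym_subst r Y D k f] replaces the variables of f by the list Y and clears the denominator D of the last one, which occurs in f with degree at most k. *)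
Definition mono_subst (r : nat) (Y : seq sym) (m : mono) : sym :=
  foldr (fun Ye acc => sym_mul (sym_pow r Ye.1 Ye.2) acc) (sym_const r 1) (zip Y m).

Definition sym_subst (r : nat) (Y : seq sym) (D : sym) (k : nat) (f : sym) : sym :=
  foldr (fun t acc => sym_muladd 0 (sym_axpy 0 t.2 [::]
           (sym_mul (mono_subst r Y t.1) (sym_pow r D (k - last 0%N t.1))) [::])
           (sym_const r 1) acc) [::] f.

Section ExactVal.
Variables (A : comNzRingType) (r : nat) (z : nat -> A).
Local Notation ev := (sym_val r z).

Lemma cong0 x y : cong r z 0 x y -> x = y.
Proof. by move=> [g ->]; rewrite /zeta mul0r addr0. Qed.

Lemma ev_const c : ev (sym_const r c) = zeta A c.
Proof. exact: ev_one. Qed.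

Lemma ev_mul f g : ev (sym_mul f g) = ev f * ev g.
Proof. by rewrite (cong0 (sym_muladdP _ _ _ _ _ _)) sym_val_nil addr0. Qed.

Lemma ev_pow f n : ev (sym_pow r f n) = ev f ^+ n.
Proof.
elim: n => [|n IH]; first by rewrite ev_const expr0.
by rewrite /sym_pow iterS -/(sym_pow r f n) ev_mul IH exprS.
Qed.

Lemma ev_mono_subst Y m : ev (mono_subst r Y m) =
  \prod_(i < size Y) ev (nth [::] Y i) ^+ nth 0%N m i.
Proof.
rewrite /mono_subst; elim: Y m => [|f Y IH] [|e m] /=; rewrite ?big_ord0 ?ev_const //.
  by rewrite big1 // => i _; rewrite nth_nil expr0.
by rewrite big_ord_recl ev_mul ev_pow IH.
Qed.

Variables (s : nat) (y : nat -> A).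

Lemma ev_subst Y D k f : size Y = s.+1 ->
    (forall i, (i < s)%N -> y i = ev (nth [::] Y i)) ->
    ev D * y s = ev (nth [::] Y s) ->
    all (fun t => (size t.1 == s.+1) && (last 0%N t.1 <= k)%N) f ->
  ev (sym_subst r Y D k f) = ev D ^+ k * sym_val s.+1 y f.
Proof.
move=> sY yE ysE; elim: f => [|[m c] f IH] /=; first by rewrite !sym_val_nil mulr0.
move=> /andP[/andP[/eqP sm mk] /IH {}IH].
rewrite (cong0 (sym_muladdP _ _ _ _ _ _)) (cong0 (sym_axpyP _ _ _ _ _ _ _)) IH.
rewrite sym_val_nil addr0 ev_const mono_val_nil !mulr1 sym_val_cons mulrDr.
congr (_ + _); rewrite ev_mul ev_pow ev_mono_subst sY /mono_val big_ord_recr /= big_ord_recr /=.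
have nE : last 0%N m = nth 0%N m s by rewrite -nth_last sm.
rewrite nE in mk *; rewrite -ysE exprMn.
have -> : ev D ^+ k = ev D ^+ (k - nth 0%N m s) * ev D ^+ nth 0%N m s.
  by rewrite -exprD subnK.
rewrite (eq_bigr (fun i : 'I_s => y i ^+ nth 0%N m i)); last by move=> i _; rewrite yE.
by ring.
Qed.

End ExactVal.

Section Box.
Variables (R : realType).

Definition box (z : nat -> R) := forall i, `|z i| <= 1.

Definition abs_sum (f : sym) : Z := foldr (fun t acc => Z.add (Z.abs t.2) acc) Z0 f.

(* In a sorted polynomial the constant term comes first. *)
Definition positive_check (r : nat) (f : sym) : bool :=
  if f is (m, c) :: f' then (m == nseq r 0%N) && Z.ltb (abs_sum f') c else false.

Lemma zeta_norm c : `|zeta R c| = zeta R (Z.abs c).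
Proof.
rewrite /zeta -intr_norm; congr (_%:~R); case: c => [|p|p] //=.
by rewrite NegzE /= normrN; congr Posz; lia.
Qed.

Lemma zeta_lt a b : Z.lt a b -> zeta R a < zeta R b.
Proof. by move=> ab; rewrite /zeta ltr_int; lia. Qed.

Lemma sym_val_abs r z f : box z -> `|sym_val r z f| <= zeta R (abs_sum f).
Proof.
move=> bz; elim: f => [|[m c] f IH]; first by rewrite sym_val_nil normr0.
rewrite sym_val_cons /= zetaD; apply: le_trans (ler_normD _ _) _; apply: lerD => //.
rewrite normrM zeta_norm -[leRHS]mulr1 ler_wpM2l -?zeta_norm //.
rewrite /mono_val normr_prod; apply: prodr_ile1 => i _.
by rewrite normr_ge0 normrX exprn_ile1.
Qed.

Lemma positive_checkP r z f : box z -> positive_check r f -> 0 < sym_val r z f.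
Proof.
case: f => [//|[m c] f] bz /= /andP[/eqP-> /Z.ltb_lt /zeta_lt lt].
rewrite sym_val_cons /mono_val big1 ?mulr1; last by move=> i _; rewrite nth_nseq ltn_ord.
have := sym_val_abs r f bz; rewrite ler_norml => /andP[le _]; move: lt le.
set u := zeta R c; set v := zeta R (abs_sum f); set w := sym_val _ _ _; lra.
Qed.

End Box.

Definition even_param d : ser := elim_odd 0 d./2 d.*2 d (odds 3 d.+1).

(** For n < 2d, a quarter of the coefficient of degree n of F at [even_point], as a polynomial in
    the even unknowns; see [second_iterate_even]. *)
Definition return_coef d n : sym :=
  nth [::] (ser_quarter 0 d./2 d.*2 d (even_param d)) n.

Definition sym_shape s (f : sym) := all (fun t => size t.1 == s) f.

Definition even_param_check d :=
  [&& nilp (nth [::] (even_param d) 0), nilp (nth [::] (even_param d) 1),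
      size (even_param d) <= d.+1,
      all (fun n => nilp (return_coef d n)) (odds 3 d.+1) &
      all (fun n => sym_shape d./2 (return_coef d n)) (odds d.+1 d.*2)]%N.

Section EvenPoint.
Variables (R : realType) (d : nat).
Hypotheses (d1 : (1 < d)%N) (check : even_param_check d).
Implicit Type y : nat -> R.
Local Notation F b := (second_iterate (family_poly b)).
Local Notation val y := (sym_val d./2 y).

(* The point whose even coefficients are the 2 y_i, the odd ones killing the coefficients of degree at most d of the second iterate. *)
Definition even_point y : 'rV[R]_d.-1 :=
  \row_i (val y (nth [::] (even_param d) i.+2) *+ 2).

Lemma second_iterate_even y n : (n < d.*2)%N ->
  (F (even_point y))`_n = val y (return_coef d n) *+ 4.
Proof.
have /and5P[/nilP al0 /nilP al1 sal _ _] := check.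
pose be : {poly R} := \poly_(j < d.+1) val y (nth [::] (even_param d) j).
have -> : family_poly (even_point y) = refl_poly be.
  apply/polyP => j; rewrite coef_family_poly coefD coefN coefX coefMn coef_poly.
  case: j => [|[|j]] /=.
  - by rewrite al0 sym_val_nil mul0rn addr0 oppr0.
  - by rewrite al1 sym_val_nil !(mul0rn, if_same) addr0.
  rewrite oppr0 add0r; case: insubP => [i _ <-|].
    have il : (i.+2 < d.+1)%N by have := ltn_ord i; lia.
    by rewrite mxE il.
  by case: ifP; rewrite ?mul0rn //; lia.
have be1 : be`_1 = 0 by rewrite coef_poly al1 sym_val_nil if_same.
move=> nd; rewrite /second_iterate (@comp_refl_poly _ d) ?size_poly // coefMn.
congr (_ *+ _); apply: (@cong0 _ d./2 y).
apply: (@repr_quarter 0 d./2 d.*2 R y d) => //; last by lia.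
move=> j jd; rewrite coef_poly; case: ifP => [_|jn]; first exact: cong_refl.
rewrite nth_default ?sym_val_nil; first exact: cong_refl.
by apply: leq_trans sal _; rewrite leqNgt jn.
Qed.

Lemma leading_even y k s : (k < d)%N ->
    (forall i, (d <= i.*2)%N -> (i < k)%N -> val y (return_coef d i.*2.+1) = 0) ->
    0 < s * val y (return_coef d k.*2.+1) ->
  leading (even_point y) k s.
Proof.
move=> kd v0 vk; apply: leading_odd => //.
  move=> i /andP[i0 ik]; rewrite second_iterate_even; last by lia.
  have [di|di] := leqP d i.*2; first by rewrite v0 // mul0rn.
  have /and5P[_ _ _ /allP /(_ i.*2.+1)] := check.
  rewrite /odds mem_filter mem_index_iota /= odd_double /=.
  have -> : (3 <= i.*2.+1 < d.+1)%N by lia.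
  by move=> /(_ isT) /nilP -> _; rewrite sym_val_nil mul0rn.
by rewrite second_iterate_even ?mulrnAr ?pmulrn_lgt0 //; lia.
Qed.

Lemma sym_val_continuous r (g : R -> nat -> R) f t :
    (forall i, (i < r)%N -> {for t, continuous (g^~ i)}) ->
  {for t, continuous (fun u => sym_val r (g u) f)}.
Proof.
move=> cg; elim: f => [|[m c] f IH].
  have -> : (fun u => sym_val r (g u) [::]) = cst 0.
    by apply/funext => u; rewrite sym_val_nil.
  exact: cvg_cst.
have -> : (fun u => sym_val r (g u) ((m, c) :: f)) =
    (fun u => zeta R c * mono_val r (g u) m + sym_val r (g u) f).
  by apply/funext => u; rewrite sym_val_cons.
apply: cvgD => //; apply: cvgM; first exact: cvg_cst.
rewrite /mono_val; elim: (index_enum _) => [|i l IHl].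
  have -> : (fun u => \prod_(j <- ([::] : seq 'I_r)) g u j ^+ nth 0%N m j) = cst 1.
    by apply/funext => u; rewrite big_nil.
  rewrite big_nil; exact: cvg_cst.
have -> : (fun u => \prod_(j <- i :: l) g u j ^+ nth 0%N m j) =
    (fun u => g u i ^+ nth 0%N m i * \prod_(j <- l) g u j ^+ nth 0%N m j).
  by apply/funext => u; rewrite big_cons.
rewrite big_cons; apply: cvgM => //.
apply: (@cvg_comp _ _ _ (fun u => g u i) (fun x : R => x ^+ nth 0%N m i)).
  exact: cg.
exact: exprn_continuous.
Qed.

Lemma even_point_close (g : R -> nat -> R) t (Q : set R) :
    (forall i, (i < d./2)%N -> {for t, continuous (g^~ i)}) ->
    (forall e, 0 < e -> exists2 u, `|u - t| < e & Q u) ->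
  forall eps, 0 < eps -> exists2 u, close eps (even_point (g t)) (even_point (g u)) & Q u.
Proof.
move=> cg tQ eps ep.
have : \forall u \near t, close eps (even_point (g t)) (even_point (g u)).
  rewrite /close; apply: (@filter_forall R (ordinal d.-1) (fun i u =>
    `|even_point (g u) 0 i - even_point (g t) 0 i| < eps) _ (nbhs_filter t)) => i.
  have cv : (fun u => sym_val d./2 (g u) (nth [::] (even_param d) i.+2) *+ 2) @ t -->
      sym_val d./2 (g t) (nth [::] (even_param d) i.+2) *+ 2.
    by apply: cvgMn; exact: sym_val_continuous.
  move/cvgrPdist_lt : cv => /(_ _ ep); apply: filterS => u.
  by rewrite distrC !mxE.
move=> /nbhs_ballP[e /= e0 eP]; have [u ut Qu] := tQ e e0.
by exists u => //; apply: eP; rewrite -ball_normE /ball_ /= distrC.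
Qed.

End EvenPoint.

Section Sprout.
Variables (R : realType) (d : nat).
Hypothesis d1 : (1 < d)%N.
Implicit Types (a b : 'rV[R]_d.-1) (s eps delta : R).
Local Notation F b := (second_iterate (family_poly b)).

(* Arbitrarily small moves of b add n sign changes below those already present. *)
Definition sprouts b k s n := leading b k s /\
  forall delta m xi, alternating (F b) m s xi delta ->
  forall eps, 0 < eps -> exists b' s' xi',
    close eps b b' /\ alternating (F b') (m + n) s' xi' delta.

Lemma sprouts_descent b k s : (k.*2 < d)%N -> leading b k.+1 s -> `|s| = 1 ->
  sprouts b k.+1 s k.
Proof.
by move=> kd lead s1; split=> // delta m xi; exact: alternating_descent.
Qed.

Lemma sprouts_step b k k' s n : leading b k s ->
    (forall eps, 0 < eps -> exists2 b', close eps b b' & sprouts b' k' (- s) n) ->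
  sprouts b k s n.+1.
Proof.
move=> lead mv; split=> // delta m xi alt eps ep.
have e20 : 0 < eps / 2 by rewrite divr_gt0.
have mv' e : 0 < e -> exists b', [/\ close e b b', leading b' k' (- s) &
    sprouts b' k' (- s) n].
  by move=> /mv[b' bb' sb']; exists b'; split=> //; case: sb'.
have [b1 [xi1 [bb1 _ [_ grow] alt1]]] := alternating_step d1 alt mv' e20.
have [b2 [s2 [xi2 [b12 alt2]]]] := grow _ _ _ alt1 _ e20.
exists b2, s2, xi2; split; last by rewrite addnS -addSn.
by rewrite [eps]splitr; exact: close_trans bb1 b12.
Qed.

Lemma sprouts_unfolds b k s n : sprouts b k s n -> unfolds (@family_map R d) b n.
Proof.
move=> [lead grow]; apply: unfolds_alternating => // eps delta e0 delta0.
have [x /andP[x0 xd] sx] := leading_sample delta0 lead.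
have alt : alternating (F b) 0 s (fun=> x) delta.
  by split=> // i; rewrite leqn0 => /eqP ->; rewrite expr0 mulr1.
have [rho rho0 rhoP] := coord_disc d1 b e0.
have [b' [s' [xi' [bb' alt']]]] := grow _ _ _ alt rho rho0.
exists b'; first by apply: rhoP => i; exact: ltW.
by exists s', xi'; rewrite add0n in alt'.
Qed.

End Sprout.

(** * Zeros approached through negative values *)

Section Crossing.
Variable R : realType.

(** c is the infimum of the points where h is negative. An arbitrary zero would not do, since h
    might be nonnegative all around it. *)
Lemma zero_crossing (h : R -> R) : continuous h -> 0 < h (-1) -> h 1 < 0 ->
  exists2 c, h c = 0 & forall e, 0 < e -> exists2 u, `|u - c| < e & h u < 0.
Proof.
move=> ch hm hp; pose S := [set u : R | -1 <= u /\ h u < 0].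
have S1 : S 1 by split=> //; lra.
have Slb : lbound S (-1) by move=> u [].
have hS : has_inf S by split; [exists 1|exists (-1)].
set c := inf S.
have cm : -1 <= c by apply: lb_le_inf => //; exists 1.
have near (e : R) : 0 < e -> exists2 u, `|u - c| < e & h u < 0.
  move=> e0; have [u [Su hu] uc] := inf_adherent e0 hS.
  exists u => //; have : c <= u by apply: ge_inf => //; exists (-1).
  by rewrite -/c in uc; rewrite ltr_norml; lra.
exists c => //; apply/eqP; rewrite eq_le; apply/andP; split; rewrite leNgt; apply/negP => hc.
  have /ch /nbhs_ballP[e /= e0 eP] : nbhs (h c) [set x : R | 0 < x].
    by apply: open_nbhs_nbhs; split=> //; exact: open_gt.
  have [u uc] := near e e0; apply/negP; rewrite -leNgt ltW //.
  by apply: eP; rewrite -ball_normE /ball_ /= distrC.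
have cm' : -1 < c.
  by rewrite lt_neqAle cm andbT; apply: contraTneq hc => <-; rewrite -leNgt ltW.
have /ch /nbhs_ballP[e /= e0 eP] : nbhs (h c) [set x : R | x < 0].
  by apply: open_nbhs_nbhs; split=> //; exact: open_lt.
pose u := Num.max (-1) (c - e / 2).
have uc : u < c by rewrite gt_max cm' /=; lra.
have ue : c - e / 2 <= u by rewrite le_max lexx orbT.
have : c <= u.
  apply: ge_inf; first by exists (-1).
  split; first by rewrite le_max lexx.
  by apply: eP; rewrite -ball_normE /ball_ /= ltr_norml; lra.
by lra.
Qed.

(** Projection onto [-1, 1]: it makes curves continuous on the whole line without leaving the box on
    which signs are certified. *)
Definition clamp (u : R) : R := (`|u + 1| - `|u - 1|) / 2.

Lemma clamp_norm u : `|clamp u| <= 1.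
Proof.
rewrite normrM [`|2^-1|]gtr0_norm ?invr_gt0 // ler_pdivrMr // mul1r.
apply: le_trans (ler_dist_dist _ _) _.
have -> : u + 1 - (u - 1) = 2 by ring.
by rewrite gtr0_norm.
Qed.

Lemma clamp_id u : `|u| <= 1 -> clamp u = u.
Proof.
rewrite ler_norml => /andP[um up].
by rewrite /clamp ger0_norm ?ler0_norm; [field|lra|lra].
Qed.

Lemma clamp_continuous : continuous clamp.
Proof.
move=> u; apply: cvgM; last exact: cvg_cst.
by apply: cvgB; apply: cvg_norm; [apply: cvgD|apply: cvgB]; (exact: cvg_id || exact: cvg_cst).
Qed.

End Crossing.

(** * The instances of degree 3, 5, 7 and 9 *)

Definition last_degree (f : sym) := foldr maxn 0%N [seq last 0%N t.1 | t <- f].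

Lemma last_degree_shape s f : sym_shape s f ->
  all (fun t => (size t.1 == s) && (last 0%N t.1 <= last_degree f)%N) f.
Proof.
elim: f => //= t f IH /andP[/eqP -> /IH {IH}fs]; rewrite eqxx leq_maxl /=.
by apply: sub_all fs => t' /andP[-> le]; apply: leq_trans le (leq_maxr _ _).
Qed.

Definition sym_var i : sym := [:: (mkseq (fun k => nat_of_bool (k == i)) 3, Zpos xH)].
Definition sym_affine (c0 c1 c2 c3 : Z) : sym :=
  foldr (fun ic => sym_axpy 0 ic.2 [::] (sym_var ic.1)) (sym_const 3 c0)
    [:: (0, c1); (1, c2); (2, c3)]%N.
Definition sym_opp (f : sym) : sym := sym_axpy 0 (Z.opp 1) [::] f [::].
Definition sym_spec (Z : seq sym) (f : sym) : sym :=
  sym_subst 3 Z (sym_const 3 1) (last_degree f) f.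
(** The coefficient of degree n along the surface given by Y, with the last coordinate divided by D,
    multiplied by a power of D to become polynomial. Where D > 0 the sign is unchanged. *)
Definition pull d (Y : seq sym) (D : sym) n : sym :=
  sym_subst 3 Y D (last_degree (return_coef d n)) (return_coef d n).

Section Spec.
Variables (R : realType) (z : nat -> R).
Local Notation ev := (sym_val 3 z).

Lemma ev_var i : (i < 3)%N -> ev (sym_var i) = z i.
Proof.
move=> i3; rewrite sym_val_cons sym_val_nil addr0 zeta1 mul1r /mono_val.
rewrite (bigD1 (Ordinal i3)) //= nth_mkseq // eqxx expr1 big1 ?mulr1 // => j ji.
by rewrite nth_mkseq // (_ : _ == _ = false) ?expr0 //; apply/negbTE.
Qed.

Lemma ev_opp f : ev (sym_opp f) = - ev f.
Proof.
rewrite (cong0 (sym_axpyP _ _ _ _ _ _ _)) sym_val_nil addr0 mono_val_nil mulr1.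
by rewrite -[zeta R _]/(-1) mulN1r.
Qed.

Lemma ev_spec Z f : size Z = 3 -> sym_shape 3 f ->
  ev (sym_spec Z f) = sym_val 3 (fun i => ev (nth [::] Z i)) f.
Proof.
move=> sZ /last_degree_shape sf.
rewrite (@ev_subst _ 3 z 2 (fun i => ev (nth [::] Z i)) Z _ _ _ sZ _ _ sf) //.
  by rewrite ev_const zeta1 expr1n mul1r.
by rewrite ev_const zeta1 mul1r.
Qed.

End Spec.

Lemma sym_val_ext (A : comNzRingType) r (y y' : nat -> A) f :
  (forall i, (i < r)%N -> y i = y' i) -> sym_val r y f = sym_val r y' f.
Proof.
move=> yy; rewrite /sym_val; apply: eq_bigr => t _; congr (_ * _).
by rewrite /mono_val; apply: eq_bigr => i _; rewrite yy.
Qed.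

Section Curve.
Variables (R : realType) (d : nat) (Y : seq sym) (D : sym).
Hypotheses (d1 : (1 < d)%N) (dodd : odd d) (check : even_param_check d).
Hypotheses (sizeY : size Y = d./2) (posD : positive_check 3 D).
Implicit Type z : nat -> R.
Local Notation ev := (sym_val 3).

(* The point of the parametrized surface at z: only the last coordinate has the denominator D. *)
Definition curve z i : R :=
  ev z (nth [::] Y i) / (if i.+1 == size Y then ev z D else 1).

Lemma ev_pull z k : box z -> (d <= k.*2)%N -> (k < d)%N ->
  exists2 c, 0 < c &
    ev z (pull d Y D k.*2.+1) = c * sym_val d./2 (curve z) (return_coef d k.*2.+1).
Proof.
move=> bz dk kd; have D0 := positive_checkP bz posD.
have /and5P[_ _ _ _ /allP /(_ k.*2.+1)] := check.
rewrite mem_filter mem_index_iota /= odd_double.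
have -> /= : (d < k.*2.+1 < d.*2)%N by lia.
move=> /(_ isT) /last_degree_shape sh.
have [s sE] : exists s, d./2 = s.+1 by exists d./2.-1; lia.
have sY := sizeY; rewrite sE in sh sY *; exists (ev z D ^+ last_degree (return_coef d k.*2.+1)).
  exact: exprn_gt0.
rewrite /pull (@ev_subst R 3 z s (curve z) Y D _ _ sY _ _ sh) //.
  by move=> i si; rewrite /curve sY eqSS ltn_eqF // divr1.
by rewrite /curve sY eqxx mulrC divfK // gt_eqF.
Qed.

Lemma curve_leading z k s : box z -> (k < d)%N -> (d <= k.*2)%N ->
    (forall i, (d <= i.*2)%N -> (i < k)%N -> ev z (pull d Y D i.*2.+1) = 0) ->
    0 < s * ev z (pull d Y D k.*2.+1) ->
  leading (even_point d (curve z)) k s.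
Proof.
move=> bz kd dk v0 vk; apply: leading_even => // [i di ik|].
  have [c c0 E] := ev_pull bz di (ltn_trans ik kd).
  have /eqP := v0 i di ik; rewrite E mulf_eq0 gt_eqF //= => /eqP; exact.
by have [c c0 E] := ev_pull bz dk kd; move: vk; rewrite E mulrCA pmulr_rgt0.
Qed.

Lemma curve_close (g : R -> nat -> R) t (Q : set R) :
    (forall i, {for t, continuous (g^~ i)}) -> box (g t) ->
    (forall e, 0 < e -> exists2 u, `|u - t| < e & Q u) ->
  forall eps, 0 < eps ->
  exists2 u, close eps (even_point d (curve (g t))) (even_point d (curve (g u))) & Q u.
Proof.
move=> cg bg tQ; apply: (@even_point_close _ _ (fun u => curve (g u))) => // i _.
apply: cvgM; first by apply: sym_val_continuous => j _; exact: cg.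
case: eqP => _; last exact: cvg_cst.
apply: cvgV; first by rewrite gt_eqF // positive_checkP.
by apply: sym_val_continuous => j _; exact: cg.
Qed.

(* u moves along the curve, w is solved for (only for d = 9), e is the value of return_coef d (d+2). *)
Definition point (u w e : R) : nat -> R := nth 0 [:: u; w; e].

Lemma box_point u w e : `|u| <= 1 -> `|w| <= 1 -> `|e| <= 1 -> box (point u w e).
Proof. by move=> hu hw he [|[|[|i]]] //=; rewrite /point nth_default // normr0. Qed.

Lemma solved_eq0 n u w : pull d Y D n = sym_mul (sym_var 2) D ->
  ev (point u w 0) (pull d Y D n) = 0.
Proof. by move=> ->; rewrite ev_mul ev_var // mul0r. Qed.

(** With e nonzero, F starts in degree d + 2; switching on the odd coefficients of degree d, d - 2,
    ..., 3 then adds d./2 sign changes. *)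
Lemma last_sprouts u w e s : (2 < d)%N ->
    pull d Y D d.+2 = sym_mul (sym_var 2) D ->
    `|u| <= 1 -> `|w| <= 1 -> `|e| <= 1 -> 0 < s * e -> `|s| = 1 ->
  sprouts (even_point d (curve (point u w e))) d./2.+1 s d./2.
Proof.
move=> d2 pullE hu hw he se s1; apply: sprouts_descent => //; first by lia.
have bz := box_point hu hw he.
apply: curve_leading => // [||i di ik|]; [lia|lia|lia|].
have -> : (d./2.+1).*2.+1 = d.+2 by lia.
by rewrite pullE ev_mul ev_var // mulrA mulr_gt0 // positive_checkP.
Qed.

Lemma last_step u w k s : (2 < d)%N ->
    pull d Y D d.+2 = sym_mul (sym_var 2) D ->
    `|u| <= 1 -> `|w| <= 1 -> `|s| = 1 ->
    leading (even_point d (curve (point u w 0))) k s ->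
  sprouts (even_point d (curve (point u w 0))) k s d./2.+1.
Proof.
move=> d2 pullE hu hw s1 lead; apply: sprouts_step lead _ => // eps ep.
have bz : box (point u w 0) by apply: box_point; rewrite ?normr0.
have [i|e e0|e cl [he e1]] := @curve_close (fun e => point u w e) 0
    [set e | 0 < - s * e /\ `|e| <= 1] _ bz _ eps ep.
- by case: i => [|[|[|i]]]; rewrite /point /= ?nth_nil; (exact: cvg_cst || exact: cvg_id).
- have m0 : 0 < Num.min 1 (e / 2) by rewrite lt_min ltr01 divr_gt0.
  have ns : `|- s * Num.min 1 (e / 2)| = Num.min 1 (e / 2).
    by rewrite normrM normrN s1 mul1r gtr0_norm.
  exists (- s * Num.min 1 (e / 2)); rewrite ?subr0 /= ns.
    by rewrite gt_min; apply/orP; right; lra.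
  split; last by rewrite ge_min lexx.
  by rewrite mulrA mulrNN -expr2 -real_normK ?num_real // s1 expr1n mul1r.
exists (even_point d (curve (point u w e))) => //.
by apply: last_sprouts; rewrite ?normrN.
Qed.

Definition crossing_check (h : sym) :=
  [&& sym_shape 3 h,
      positive_check 3 (sym_spec [:: sym_const 3 (Z.opp 1); sym_var 1; [::]] h) &
      positive_check 3 (sym_opp (sym_spec [:: sym_const 3 1; sym_var 1; [::]] h))].

(** With [phi] chosen to kill the lower coefficients, the one of degree 2k + 1 goes from positive at
    u = -1 to negative at u = 1. Where it vanishes, F starts in degree 2k + 3 with a positive
    coefficient; at nearby u with a negative value the opposite sign appears below it. *)
Lemma crossing_sprouts (phi : R -> R) k n : continuous phi -> (forall u, `|phi u| <= 1) ->
    (k.+1 < d)%N -> (d <= k.*2)%N ->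
    (forall u i, (d <= i.*2)%N -> (i < k)%N ->
       ev (point (clamp u) (phi u) 0) (pull d Y D i.*2.+1) = 0) ->
    crossing_check (pull d Y D k.*2.+1) ->
    positive_check 3 (pull d Y D k.*2.+3) ->
    (forall u, leading (even_point d (curve (point (clamp u) (phi u) 0))) k (-1) ->
       sprouts (even_point d (curve (point (clamp u) (phi u) 0))) k (-1) n) ->
  exists b : 'rV[R]_d.-1, sprouts b k.+1 1 n.+1.
Proof.
move=> cphi phi1 kd dk zero /and3P[sh chm chp] top grow.
pose g u := point (clamp u) (phi u) 0.
have bg u : box (g u) by apply: box_point; rewrite ?clamp_norm ?normr0.
have cg i : continuous (g^~ i).
  case: i => [|[|[|i]]] u; rewrite /g /point /=.
  - exact: clamp_continuous.
  - exact: cphi.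
  - exact: cvg_cst.
  - by rewrite nth_nil; exact: cvg_cst.
pose h u := ev (g u) (pull d Y D k.*2.+1).
have hE c u : zeta R c = u -> `|u| <= 1 ->
    h u = ev (g u) (sym_spec [:: sym_const 3 c; sym_var 1; [::]] (pull d Y D k.*2.+1)).
  move=> cu u1; rewrite ev_spec //; apply: sym_val_ext => -[|[|[|i]]] //= _.
  - by rewrite ev_const cu /g /point /= clamp_id.
  - by rewrite ev_var.
  - by rewrite sym_val_nil.
have ch : continuous h by move=> u; apply: sym_val_continuous => i _; exact: cg.
have [||c hc near] := @zero_crossing R h ch.
- by rewrite (@hE (Z.opp 1)) ?normrN ?normr1 //; exact: positive_checkP.
- rewrite (@hE (Zpos xH)) ?normr1 // -oppr_gt0 -ev_opp; exact: positive_checkP.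
exists (even_point d (curve (g c))); apply: sprouts_step => //.
  apply: curve_leading => // [|i di ik|]; first by lia.
    by have [ik'|ki] := ltnP i k; [exact: zero|rewrite (_ : i = k) //; lia].
  by rewrite mul1r; apply: positive_checkP.
move=> eps ep; have [|u ? hu] := @curve_close g c (fun u => h u < 0) _ (bg c) near eps ep.
  by move=> i; exact: cg.
exists (even_point d (curve (g u))) => //; apply: grow.
apply: (curve_leading (bg u) (ltnW kd) dk); last by rewrite mulN1r oppr_gt0.
by move=> i; exact: zero.
Qed.

End Curve.

(* Divided difference in the second variable, whose two values become the second and third variables, of the part of f free of the third variable. *)
Definition divided_difference (f : sym) : sym :=
  foldr (fun t acc =>
      if nth 0%N t.1 2 == 0%N then
        foldr (fun l => sym_insert 0 [:: nth 0 t.1 0; l; (nth 0 t.1 1).-1 - l]%N t.2)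
          acc (iota 0 (nth 0%N t.1 1))
      else acc) [::] f.

(** The divided difference is not trusted: the identity f(w') - f(w) = (w' - w) Q is verified
    symbolically. Positivity of Q makes f increasing in w, and the signs at w = -1 and w = 1 locate
    its zero. *)
Definition monotone_check (f : sym) :=
  [&& sym_shape 3 f,
      positive_check 3 (divided_difference f),
      sym_axpy 0 (Z.opp 1) [::] (sym_spec [:: sym_var 0; sym_var 1; [::]] f)
          (sym_spec [:: sym_var 0; sym_var 2; [::]] f) ==
        sym_mul (sym_affine 0 0 (Z.opp 1) 1) (divided_difference f),
      positive_check 3 (sym_spec [:: sym_var 0; sym_const 3 1; [::]] f) &
      positive_check 3
        (sym_opp (sym_spec [:: sym_var 0; sym_const 3 (Z.opp 1); [::]] f))].

(** * An implicit curve from monotonicity *)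

Section Implicit.
Variables (R : realType) (f : sym).
Hypothesis check : monotone_check f.
Let g (u w : R) := sym_val 3 (point (clamp u) w 0) f.

Let g_incr u w w' : `|w| <= 1 -> `|w'| <= 1 -> w < w' -> g u w < g u w'.
Proof.
move=> hw hw' ww; have /and5P[sh pos /eqP diff _ _] := check.
have bz : box (point (clamp u) w w') by apply: box_point => //; exact: clamp_norm.
have := congr1 (sym_val 3 (point (clamp u) w w')) diff.
rewrite (cong0 (sym_axpyP _ _ _ _ _ _ _)) mono_val_nil mulr1 mulN1r ev_mul.
rewrite !ev_spec //.
have -> : sym_val 3 (point (clamp u) w w') (sym_affine 0 0 (Z.opp 1) 1) = w' - w.
  rewrite /sym_affine /= !sym_val_cons !sym_val_nil /mono_val !big_ord_recl !big_ord0 /= /point /=.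
  rewrite -[zeta R (-1)]/(-1) -[zeta R 1]/1; ring.
have -> : sym_val 3 (fun i => sym_val 3 (point (clamp u) w w')
    (nth [::] [:: sym_var 0; sym_var 1; [::]] i)) f = g u w.
  by apply: sym_val_ext => -[|[|[|i]]] //= _; rewrite ?ev_var ?sym_val_nil.
have -> : sym_val 3 (fun i => sym_val 3 (point (clamp u) w w')
    (nth [::] [:: sym_var 0; sym_var 2; [::]] i)) f = g u w'.
  by apply: sym_val_ext => -[|[|[|i]]] //= _; rewrite ?ev_var ?sym_val_nil.
have pq := positive_checkP bz pos => E.
by rewrite -subr_gt0 addrC E mulr_gt0 // subr_gt0.
Qed.

Let g_ends u : g u (-1) < 0 < g u 1.
Proof.
have /and5P[sh _ _ cp cm] := check.
have bz : box (point (clamp u) 0 0).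
  by apply: box_point; rewrite ?clamp_norm ?normr0.
apply/andP; split.
  have := positive_checkP bz cm; rewrite ev_opp oppr_gt0 ev_spec //.
  congr (_ < 0); apply: sym_val_ext => -[|[|[|i]]] //= _.
  - by rewrite ev_var.
  - by rewrite ev_const.
  - by rewrite sym_val_nil.
have := positive_checkP bz cp; rewrite ev_spec //.
congr (0 < _); apply: sym_val_ext => -[|[|[|i]]] //= _.
- by rewrite ev_var.
- by rewrite ev_const.
- by rewrite sym_val_nil.
Qed.

Let g_continuous2 u : continuous (g u).
Proof.
move=> w; apply: (@sym_val_continuous R 3 (fun w => point (clamp u) w 0)) => -[|[|[|i]]] // _;
  rewrite /point /=.
- exact: cvg_cst.
- exact: cvg_id.
- exact: cvg_cst.
Qed.

Let g_continuous1 w : continuous (g^~ w).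
Proof.
move=> u; apply: (@sym_val_continuous R 3 (fun u => point (clamp u) w 0)) => -[|[|[|i]]] // _;
  rewrite /point /=.
- exact: clamp_continuous.
- exact: cvg_cst.
- exact: cvg_cst.
Qed.

Lemma implicit_curve : exists phi : R -> R, [/\ continuous phi,
  forall u, `|phi u| < 1,
  forall u, sym_val 3 (point (clamp u) (phi u) 0) f = 0 &
  forall u w, `|w| <= 1 -> phi u < w -> 0 < sym_val 3 (point (clamp u) w 0) f].
Proof.
have ex u : exists w, `|w| <= 1 /\ g u w = 0.
  have [|||c hc _] := @zero_crossing R (fun w => - g u (clamp w)).
  - move=> w; apply: cvgN.
    apply: (@cvg_comp _ _ _ (@clamp R) (g u)); first exact: clamp_continuous.
    exact: g_continuous2.
  - by rewrite clamp_id ?normrN1 // oppr_gt0; have /andP[] := g_ends u.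
  - by rewrite clamp_id ?normr1 // oppr_lt0; have /andP[] := g_ends u.
  exists (clamp c); split; first exact: clamp_norm.
  by apply/eqP; rewrite -oppr_eq0 hc.
have [phi phiP] := choice ex; exists phi.
have phi1 u : `|phi u| < 1.
  have [h1 h0] := phiP u; have /andP[gm gp] := g_ends u.
  rewrite lt_neqAle h1 andbT; apply/eqP => n1.
  have : `|phi u| == 1 by rewrite n1.
  rewrite eqr_norml ler01 andbT => /orP[]/eqP E.
    by move: gp; rewrite -E h0 ltxx.
  by move: gm; rewrite -E h0 ltxx.
split=> // [u|u|u w hw uw]; last 2 first.
- by case: (phiP u).
- by have [hu h0] := phiP u; have := g_incr u hu hw uw; rewrite h0.
(* g u is negative at phi u - e and so is g v for v near u; as g v is increasing, its zero phi v
   lies further right. If phi u - e < -1, the bound on phi v is enough. *)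
have lo e : 0 < e -> \forall v \near u, phi u - e < phi v.
  move=> e0; have [lt|ge] := ltP (phi u - e) (-1).
    near=> v; apply: lt_trans lt _.
    by have := phi1 v; rewrite ltr_norml => /andP[].
  have w1 : `|phi u - e| <= 1.
    by rewrite ler_norml ge /=; have := phi1 u; rewrite ltr_norml; lra.
  have gw : g u (phi u - e) < 0.
    have [hu h0] := phiP u; rewrite -h0; apply: g_incr => //; by rewrite gtrBl.
  have nb : nbhs u [set v | g v (phi u - e) < 0].
    apply: (@g_continuous1 (phi u - e) u [set x | x < 0]).
    by apply: open_nbhs_nbhs; split=> //; exact: open_lt.
  apply: filterS nb => v gv; rewrite ltNge; apply/negP => le.
  have [hv h0] := phiP v; move: le; rewrite le_eqVlt => /orP[/eqP E|lt].
    by move: gv; rewrite /= -E h0 ltxx.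
  by have := lt_trans (g_incr v hv w1 lt) gv; rewrite h0 ltxx.
have hi e : 0 < e -> \forall v \near u, phi v < phi u + e.
  move=> e0; have [lt|ge] := ltP 1 (phi u + e).
    near=> v; apply: lt_trans lt.
    by have := phi1 v; rewrite ltr_norml => /andP[].
  have w1 : `|phi u + e| <= 1.
    by rewrite ler_norml ge andbT; have := phi1 u; rewrite ltr_norml; lra.
  have gw : 0 < g u (phi u + e).
    have [hu h0] := phiP u; rewrite -h0; apply: g_incr => //; by rewrite ltrDl.
  have nb : nbhs u [set v | 0 < g v (phi u + e)].
    apply: (@g_continuous1 (phi u + e) u [set x | 0 < x]).
    by apply: open_nbhs_nbhs; split=> //; exact: open_gt.
  apply: filterS nb => v gv; rewrite ltNge; apply/negP => le.
  have [hv h0] := phiP v; move: le; rewrite le_eqVlt => /orP[/eqP E|lt].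
    by move: gv; rewrite /= E h0 ltxx.
  by have := lt_trans gv (g_incr v w1 hv lt); rewrite h0 ltxx.
apply/cvgrPdist_lt => e e0; near=> v.
have l : phi u - e < phi v by near: v; exact: lo.
have h : phi v < phi u + e by near: v; exact: hi.
by rewrite ltr_norml; lra.
Unshelve. all: by end_near. Qed.

End Implicit.

(* Conversion checks on goals over R would otherwise unfold the symbolic computations. *)
Local Opaque pull return_coef.

Section Instances.
Variable R : realType.

(* 33 + u crosses the zero 18 + sqrt 220 of the coefficient of degree 7. *)
Definition curve5 : seq sym := [:: sym_const 3 1; sym_affine 33 1 0 0].

Definition last_coef (k : nat) (f : sym) : sym :=
  [seq (rcons (take (size t.1).-1 t.1) 0%N, t.2) | t <- f & last 0%N t.1 == k].

(* The coefficient of degree d+2 is affine in the last variable, with slope [solve_den]; the last variable is chosen so as to give it the value E. *)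
Definition solve_den d (Y : seq sym) : sym :=
  sym_subst 3 (rcons Y [::]) (sym_const 3 1) 0 (last_coef 1 (return_coef d d.+2)).
Definition solve_last d (Y : seq sym) : seq sym :=
  rcons Y (sym_axpy 0 (Z.opp 1) [::]
    (sym_subst 3 (rcons Y [::]) (sym_const 3 1) 0 (last_coef 0 (return_coef d d.+2)))
    (sym_var 2)).

(* The conditions being weighted homogeneous, a numerical solution has been scaled so as to lie in a box with integral corners. *)
Definition curve7 : seq sym := [:: sym_affine 0 1 0 0; sym_const 3 (Z.opp 1000000)].
Definition curve9 : seq sym :=
  [:: sym_const 3 10; sym_affine 7025 20 0 0; sym_affine 9325000 128000 25000 0].

Lemma sprouts3 : exists b : 'rV[R]_3.-1, sprouts b 2 1 1.
Proof.
exists (even_point 3 (fun=> 1)); apply: sprouts_descent; rewrite ?normr1 //.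
have check : even_param_check 3 by vm_compute.
apply: (@leading_even R 3 isT check (fun=> 1) 2 1 isT); first by move=> i di ik; exfalso; lia.
have -> : return_coef 3 2.*2.+1 = [:: ([:: 4%N], Zpos 16)] by vm_compute.
rewrite mul1r sym_val_cons sym_val_nil /mono_val big_ord1 expr1n addr0 mulr1.
by rewrite /zeta ltr0z.
Qed.

Lemma sprouts5 : exists b : 'rV[R]_5.-1, sprouts b 4 1 3.
Proof.
have check : even_param_check 5 by vm_compute.
have posD : positive_check 3 (sym_const 3 1) by vm_compute.
apply: (@crossing_sprouts R 5 curve5 _ isT isT check (erefl _) posD (fun=> 0) 3).
- by move=> u; exact: cvg_cst.
- by move=> u; rewrite normr0.
- by [].
- by [].
- by move=> u i di ik; exfalso; lia.
- by vm_compute.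
- by vm_compute.
by move=> u lead; apply: sprouts_descent; rewrite ?normrN1.
Qed.

Definition curve_last7 := Eval vm_compute in solve_last 7 curve7.
Definition curve_den7 := Eval vm_compute in solve_den 7 curve7.

Lemma sprouts7 : exists b : 'rV[R]_7.-1, sprouts b 6 1 5.
Proof.
have check : even_param_check 7 by vm_compute.
have posD : positive_check 3 curve_den7 by vm_compute.
have solved n : n = 9%N -> pull 7 curve_last7 curve_den7 n = sym_mul (sym_var 2) curve_den7.
  by move=> ->; vm_compute.
have zero u w i : (7 <= i.*2)%N -> (i < 5)%N ->
    sym_val 3 (@point R u w 0) (pull 7 curve_last7 curve_den7 i.*2.+1) = 0.
  by move=> di ik; apply: solved_eq0; apply: solved; lia.
apply: (@crossing_sprouts R 7 curve_last7 curve_den7 isT isT check (erefl _) posD (fun=> 0) 5).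
- by move=> u; exact: cvg_cst.
- by move=> u; rewrite normr0.
- by [].
- by [].
- by move=> u i di ik; exact: zero.
- by vm_compute.
- by vm_compute.
move=> u; apply: (@last_step R 7 curve_last7 curve_den7 isT isT check (erefl _) posD _ _ _ _
  isT (solved _ (erefl _)) (clamp_norm u)).
  by rewrite normr0.
by rewrite normrN1.
Qed.

Definition curve_last9 := Eval vm_compute in solve_last 9 curve9.
Definition curve_den9 := Eval vm_compute in solve_den 9 curve9.

Lemma sprouts9 : exists b : 'rV[R]_9.-1, sprouts b 8 1 7.
Proof.
have check : even_param_check 9 by vm_compute.
have posD : positive_check 3 curve_den9 by vm_compute.
have solved n : n = 11%N -> pull 9 curve_last9 curve_den9 n = sym_mul (sym_var 2) curve_den9.
  by move=> ->; vm_compute.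
have mono : monotone_check (pull 9 curve_last9 curve_den9 13) by vm_compute.
have [phi [cphi phi1 phi0 phi_gt]] := implicit_curve R mono.
have zero u w : sym_val 3 (@point R u w 0) (pull 9 curve_last9 curve_den9 5.*2.+1) = 0.
  by apply: solved_eq0; apply: solved.
apply: (@crossing_sprouts R 9 curve_last9 curve_den9 isT isT check (erefl _) posD phi 7).
- exact: cphi.
- by move=> u; exact: ltW.
- by [].
- by [].
(* Degree 11 is killed by e = 0 and degree 13 by w = phi u, which leaves u for degree 15. *)
- move=> u i di ik; have [->|->] : i = 5%N \/ i = 6%N by lia.
    exact: zero.
  exact: phi0.
- by vm_compute.
- by vm_compute.
move=> u lead; apply: (@sprouts_step R 9 isT _ 7 6 (-1) 5 lead) => eps ep.
have bz w : `|w| <= 1 -> box (@point R (clamp u) w 0).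
  by move=> hw; apply: box_point; rewrite ?clamp_norm ?normr0.
have [i|e e0|w cl [uw w1]] := @curve_close R 9 curve_last9 curve_den9 posD
    (fun w => @point R (clamp u) w 0) (phi u) [set w | phi u < w /\ `|w| <= 1]
    _ (bz _ (ltW (phi1 u))) _ eps ep.
- by case: i => [|[|[|i]]]; rewrite /point /= ?nth_nil; (exact: cvg_cst || exact: cvg_id).
- have := phi1 u; rewrite ltr_norml => /andP[pm pp].
  (* Strictly to the right of phi u, where the coefficient of degree 13 is positive, yet still in
     the box. *)
  exists (Num.min 1 (phi u + e / 2)); last split.
  - have [le|le] := leP 1 (phi u + e / 2); rewrite gtr0_norm; lra.
  - by rewrite lt_min pp ltrDl divr_gt0.
  - by have [le|le] := leP 1 (phi u + e / 2); rewrite ler_norml; lra.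
exists (even_point 9 (curve curve_last9 curve_den9 (@point R (clamp u) w 0))); first exact: cl.
rewrite opprK.
apply: (@last_step R 9 curve_last9 curve_den9 isT isT check (erefl _) posD _ _ _ _
  isT (solved _ (erefl _)) (clamp_norm u) w1).
  exact: normr1.
apply: (@curve_leading R 9 curve_last9 curve_den9 isT isT check (erefl _) posD _ 6 1 (bz w w1) isT isT).
  by move=> i di ik; have -> : i = 5%N by lia.
by rewrite mul1r; exact: phi_gt.
Qed.

End Instances.

(** * Involutions, weak fixed points and the assembled statement *)

Lemma involutive_family_map (R : realType) d (a : 'rV[R]_d.-1) :
  involutive (@family_map R d a) <-> a = 0.
Proof.
split=> [inv|->].
  apply: second_iterate_family_eq0; apply/eqP; apply/negPn/negP => F0.
  (* Natural numbers serve as more distinct roots than a nonzero F can have. *)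
  have := @max_poly_roots R _ [seq k%:R | k <- iota 0 (size (second_iterate (family_poly a)))] F0.
  rewrite size_map size_iota ltnn => lt; suff : false by [].
  apply: lt.
    apply/allP => x /mapP[k _ ->]; rewrite /root /second_iterate !hornerE horner_comp subr_eq0.
    by apply/eqP; exact: inv.
  by rewrite map_inj_uniq ?iota_uniq // => i j /eqP; rewrite eqr_nat => /eqP.
by move=> x; rewrite /family_map family_poly_0 !hornerE opprK.
Qed.

Lemma weak_fixed_point_exists (R : realType) m :
  exists a : 'rV[R]_(4 * m + 3).-1, weak_fixed_point (family_poly a) (4 * m + 3 - 2)%N.
Proof.
pose a : 'rV[R]_(4 * m + 3).-1 := \row_i (weak_poly R m)`_i.+2.
have coefE j : (weak_poly R m)`_j =
    - (j == 1%N)%:R + (j == m.*2.+2)%:R - m.+1%:R * (j == (4 * m).+3)%:R.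
  by rewrite /weak_poly coefB coefD coefN coefX coefXn -polyC_natr coefCM coefXn.
have E : weak_poly R m = family_poly a.
  apply: family_poly_inj => [j|||].
  - by rewrite mxE.
  - by rewrite coefE /= oppr0 !add0r mulr0 oppr0.
  - by rewrite coefE /= mulr0 addr0 subr0.
  apply/leq_sizeP => j jm; rewrite coefE !gtn_eqF ?mulr0 ?oppr0 ?addr0 //; lia.
have [e compE e0] := weak_poly_comp R m.
have coef_comp j : (j <= (8 * m).+4.+1)%N -> (1 < j)%N ->
    (family_poly a \Po family_poly a)`_j = if j == (8 * m).+4.+1 then e`_0 else 0.
  move=> jm j1; rewrite -E compE coefD coefX gtn_eqF // add0r mulrC coefMXn.
  by rewrite ltn_neqAle jm andbT; case: eqP => //= ->; rewrite subnn.
exists a; split=> [i im|].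
  split=> [j ji|]; rewrite coef_comp; try lia; rewrite ltn_eqF //; lia.
exists e`_0; last exact/eqP.
split=> [j ji|]; rewrite coef_comp; try lia; first by rewrite ltn_eqF //; lia.
by rewrite (_ : _ == _ = true) //; apply/eqP; lia.
Qed.

Theorem theorem2 (R : realType) (d : nat) (hd : (2 <= d)%N) :
  let f := @family_map R d in
  let V : set 'rV[R]_d.-1 := setT in
  (* the only involution *)
  (forall a : 'rV[R]_d.-1, involutive (f a) <-> a = 0) /\
  (forall x, f 0 x = - x) /\
  family_cyclicity_le V f ((d ^ 2 - 1) %/ 2)%N /\
  (* (a) *)
  (~~ odd d ->
     family_cyclicity_ge V f (d - 2)%N /\
     (d \in [:: 2; 4]%N -> family_cyclicity V f (d - 2)%N) /\
     (d \in [:: 6; 8; 10]%N ->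
        forall a : 'rV[R]_d.-1, a <> 0 -> origin_cyclicity_le V f a (d - 2)%N) /\
     (d = 6%N -> origin_cyclicity_le V f 0 5) /\
     (d = 8%N -> origin_cyclicity_le V f 0 9) /\
     (d = 10%N -> origin_cyclicity_le V f 0 13)) /\
  (* (b) *)
  (odd d ->
     family_cyclicity_ge V f (d - 3)%N /\
     (d = 3%N -> family_cyclicity V f 1) /\
     (d \in [:: 5; 7; 9]%N ->
        (forall a : 'rV[R]_d.-1, a <> 0 -> origin_cyclicity_le V f a (d - 2)%N) /\
        (exists a : 'rV[R]_d.-1, origin_cyclicity V f a (d - 2)%N)) /\
     (d = 5%N -> origin_cyclicity_le V f 0 4) /\
     (d = 7%N -> origin_cyclicity_le V f 0 7) /\
     (d = 9%N -> origin_cyclicity_le V f 0 10) /\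
     (forall m : nat, d = (4 * m + 3)%N ->
        exists a : 'rV[R]_d.-1, weak_fixed_point (family_poly a) (d - 2)%N)).
Proof.
move=> f V.
have up := cyclicity_le_degree (R := R) hd.
have small a : (d <= 10)%N -> origin_cyclicity_le V f a (d - 2) by exact: cyclicity_le_small.
have weaken K a : (d <= 10)%N -> (d - 2 <= K)%N -> origin_cyclicity_le V f a K.
  by move=> /(small a)[k fk kd] dK; exists k => //; exact: leq_trans kd dK.
have low : unfolds f 0 (d./2.-1).*2 := @unfolds_origin R d hd.
split; first exact: involutive_family_map.
split; first by move=> x; rewrite /f /family_map family_poly_0 !hornerE.
split; first exact: family_cyclicity_exists.
split=> [de|dd].
  have lowE : (d./2.-1).*2 = (d - 2)%N by lia.
  rewrite lowE in low.
  split; first exact: family_cyclicity_ge_unfolds up low.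
  split.
    rewrite !inE => d24; apply: family_cyclicity_eq low => a; apply: small; lia.
  split; first by rewrite !inE => d6 a _; apply: small; lia.
  by split; [|split]; move=> dE; apply: weaken; rewrite dE.
have lowE : (d./2.-1).*2 = (d - 3)%N by lia.
rewrite lowE in low.
split; first exact: family_cyclicity_ge_unfolds up low.
split.
  move=> d3; move: @f @V small {up low weaken lowE}; subst d => f V small.
  have [b sb] := sprouts3 R; apply: (@family_cyclicity_eq _ _ _ b) => [a|].
    exact: small.
  exact: sprouts_unfolds sb.
split.
  move=> d579; split; first by rewrite !inE in d579; move=> a _; apply: small; lia.
  have [b un] : exists b, unfolds f b (d - 2).
    rewrite /f {up small weaken low lowE}; case/or4P: d579 hd dd => // /eqP ->.
    - by move=> hd _; have [b sb] := sprouts5 R; exists b; exact: sprouts_unfolds sb.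
    - by move=> hd _; have [b sb] := sprouts7 R; exists b; exact: sprouts_unfolds sb.
    - by move=> hd _; have [b sb] := sprouts9 R; exists b; exact: sprouts_unfolds sb.
  exists b; apply: origin_cyclicity_le_unfolds => //; apply: small.
  by rewrite !inE in d579; lia.
do 3![split; first by move=> dE; apply: weaken; rewrite dE].
by move=> m dE; subst d; exact: weak_fixed_point_exists.
Qed.
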